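(* Let $D$ be a non-commutative division ring with center $F$, and let $G$ be a subnormal subgroup of ${\rm GL}_n(D)$ with $n\geq 2$. Assume additionally that $F$ contains at least five elements. If $M$ is a solvable maximal subgroup of $G$, then $M$ is abelian. *)

(* Defs.v *)
(* Groups of invertible n x n matrices over a (possibly
   non-commutative, infinite) division ring D; since D is infinite, the
   finite-group library does not apply, so subgroups are Prop-valued
   predicates on 'M[D]_n. *)
From mathcomp Require Import all_boot all_algebra.
Set Implicit Arguments.
Unset Strict Implicit.
Unset Printing Implicit Defensive.
Import GRing.Theory.
Local Open Scope ring_scope.

Definition is_division_ring (D : nzRingType) : Prop :=
  forall x : D, x != 0 -> exists y : D, x * y = 1 /\ y * x = 1.

Definition noncommutative (D : nzRingType) : Prop :=
  exists x y : D, x * y <> y * x.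

Definition center (D : nzRingType) (x : D) : Prop := forall y : D, x * y = y * x.

Definition card_at_least (D : nzRingType) (P : D -> Prop) (k : nat) : Prop :=
  exists s : seq D, uniq s /\ size s = k /\ forall x, x \in s -> P x.

Section MatGroups.
Variables (D : nzRingType) (n : nat).
Local Notation M := 'M[D]_n.

Definition mat_inv_pair (A B : M) : Prop := A *m B = 1%:M /\ B *m A = 1%:M.

Definition GL (A : M) : Prop := exists B, mat_inv_pair A B.

Definition subset (P Q : M -> Prop) : Prop := forall x, P x -> Q x.

Definition is_subgroup (H : M -> Prop) : Prop :=
  subset H GL /\ H 1%:M /\
  (forall A B, H A -> H B -> H (A *m B)) /\
  (forall A B, H A -> mat_inv_pair A B -> H B).

Definition normal_in (N K : M -> Prop) : Prop :=
  is_subgroup N /\ is_subgroup K /\ subset N K /\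
  (forall g gi h, K g -> mat_inv_pair g gi -> N h -> N (gi *m h *m g)).

Inductive subnormal_in : (M -> Prop) -> (M -> Prop) -> Prop :=
  | sn_refl K : is_subgroup K -> subnormal_in K K
  | sn_step N H K : normal_in N H -> subnormal_in H K -> subnormal_in N K.

Definition maximal_in (M0 G : M -> Prop) : Prop :=
  is_subgroup M0 /\ is_subgroup G /\ subset M0 G /\
  (exists x, G x /\ ~ M0 x) /\
  (forall H, is_subgroup H -> subset M0 H -> subset H G ->
     subset H M0 \/ subset G H).

Definition gen (S : M -> Prop) (x : M) : Prop :=
  forall K, is_subgroup K -> subset S K -> K x.

Definition commutators (H : M -> Prop) (x : M) : Prop :=
  exists a b ai bi, H a /\ H b /\ mat_inv_pair a ai /\ mat_inv_pair b bi /\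
    x = ai *m bi *m a *m b.

Fixpoint derived (k : nat) (H : M -> Prop) : M -> Prop :=
  match k with
  | 0 => H
  | k'.+1 => gen (commutators (derived k' H))
  end.

Definition solvable_grp (H : M -> Prop) : Prop :=
  exists k, forall x, derived k H x -> x = 1%:M.

Definition abelian_grp (H : M -> Prop) : Prop :=
  forall x y, H x -> H y -> x *m y = y *m x.

End MatGroups.

(* Main.v *)
(** Write L for the matrix ring, V for its row vectors, on which L acts on the right, and Z for the center of L. A noncentral subnormal subgroup G contains the group T generated by the transvections (Iwasawa), and a subring of L containing Z and normalised by T is central or all of L. Hence, by maximality, a subring S containing Z and normalised by M is central, or equal to L, or all its units lying in G belong to M; the last two alternatives applied to well chosen S drive the whole proof.

Let A be a maximal abelian normal subgroup of M and K the center of the centraliser of A in L; irreducibility of M on V and Fitting's lemma make K a field. If M is not contained in A, solvability gives a normal subgroup B of M with A properly contained in B and [B,B] in A, such that either A is its own centraliser in M ("alpha"), or B centralises K ("beta"). Distinct cosets of A in B are linearly independent over K, so R, the K-span of B, is a crossed product of K with B/A.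

If B/A is torsion free, R is a domain (order B/A), an Ore domain (polynomial growth), and its division ring of fractions is contained in L; Hua's method then shows that it is commutative, a contradiction. If B/A has p-torsion and R is not L, commutators of explicit units of R would have to lie in M, which the independence of cosets forbids. If R = L, then in case alpha a dimension count over K forces D to be commutative; in case beta K = Z and, after scaling, B is generated by elements with p-th power 1 or -1: a minimal joint eigenspace leaves only p = 2 with anticommuting elements of square -1, and then M lies in the group of similitudes of the anti-automorphism of L inverting these elements, against maximality. *)
From HB Require Import structures.
Require Import Defs.
From mathcomp Require Import all_boot all_algebra zify.
From mathcomp Require Import boolp classical_sets.
Set Implicit Arguments.
Unset Strict Implicit.
Unset Printing Implicit Defensive.
Import GRing.Theory.
Local Open Scope ring_scope.

(** * Normalising equations in abelian groups and rings *)

(** Beyond being a group in which [M] is maximal, [G] matters through two facts: it contains T, and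
    it contains all commutators of GL, because GL/T is abelian. So a commutator of units of a
    subring lies in [G] whatever [G] is, and the subnormal chain is descended once. Five central
    elements supply a central [t] different from 0, 1 and -1: it separates the linear and quadratic
    parts of conjugation by a transvection, writes transvections as commutators, gives Hua's method
    two relations to subtract, and replaces 1 where a unit c + b is wanted. Solvability enters in
    three ways: it yields B; it bounds division rings whose commutators lie in M; and it forbids a
    vector on which M induces all scalars of D, which is what excludes invariant subspaces and
    idempotents. The obstacle is that D may have infinite dimension over its center, so that there
    is no determinant or polynomial identity to use. Independence of cosets takes their place: an
    identity in R is read coset by coset, and an element known to lie in B has only one
    component. *)

(* Reflexive decision of equalities in abelian groups: both sides are reified and the multiplicities of their atoms compared. *)
Inductive zexp := ZVar of nat | ZAdd of zexp & zexp | ZOpp of zexp | ZZero.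

Section Zexp.
Variable (W : zmodType).
Fixpoint zeval (e : seq W) (x : zexp) : W :=
  match x with
  | ZVar i => e`_i
  | ZAdd y z => zeval e y + zeval e z
  | ZOpp y => - zeval e y
  | ZZero => 0
  end.
Fixpoint zocc (b : bool) (x : zexp) (i : nat) : nat :=
  match x with
  | ZVar j => if b then eqn i j : nat else 0%N
  | ZAdd y z => Nat.add (zocc b y i) (zocc b z i)
  | ZOpp y => zocc (~~ b) y i
  | ZZero => 0%N
  end.
Definition zcheck (n : nat) x := all (fun i => eqn (zocc true x i) (zocc false x i)) (iota 0 n).

Lemma zeval_occ e x : zeval e x = \sum_(i < size e) e`_i *+ zocc true x i
  - \sum_(i < size e) e`_i *+ zocc false x i.
Proof.
elim: x => [j|y ihy z ihz|y ih|] /=.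
- rewrite [X in _ - X]big1 // subr0.
  have eqb i : eqn i j = (i == j) by [].
  case: (ltnP j (size e)) => lt.
    rewrite (bigD1 (Ordinal lt)) //= eqb eqxx mulr1n big1 ?addr0 // => i ne.
    by rewrite eqb; case: eqP => // ij; case/eqP: ne; apply: val_inj.
  rewrite nth_default // big1 // => i _; rewrite eqb; case: eqP => // ij.
  by move: (ltn_ord i); rewrite ij ltnNge lt.
- rewrite ihy ihz addrACA -opprD -!big_split /=.
  by congr (_ - _); apply: eq_bigr => i _; rewrite -mulrnDr.
- by rewrite ih opprB.
- by rewrite !big1 ?subr0.
Qed.

Lemma zcheckP e x : zcheck (size e) x -> zeval e x = 0.
Proof.
move=> /allP h; rewrite zeval_occ; apply/eqP; rewrite subr_eq0; apply/eqP.
apply: eq_bigr => i _; congr (_ *+ _); apply/eqnP.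
by apply: h; rewrite mem_iota /=.
Qed.

Lemma zmod_eqP e x y : zcheck (size e) (ZAdd x (ZOpp y)) -> zeval e x = zeval e y.
Proof. by move=> /zcheckP /=; apply: subr0_eq. Qed.
End Zexp.

(** The match on the dummy [Set] runs [unify] while a term is being built, so atoms are identified
    up to unification and not only syntactically. *)
Ltac z_eq x y := match constr:(Set) with
  | _ => let _ := match constr:(Set) with _ => unify x y end in constr:(true)
  | _ => constr:(false)
  end.
Ltac z_in x l := lazymatch l with
  | nil => constr:(false)
  | x :: _ => constr:(true)
  | ?y :: ?l' => let b := z_eq x y in
    lazymatch b with true => constr:(true) | false => z_in x l' end
  end.
Ltac z_atoms x l := lazymatch x with
  | (?a + ?b)%R => let l1 := z_atoms a l in z_atoms b l1
  | (- ?a)%R => z_atoms a l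
  | 0%R => l
  | _ => let b := z_in x l in lazymatch b with true => l | false => constr:(x :: l) end
  end.
Ltac z_index x l := lazymatch l with
  | x :: _ => constr:(0%N)
  | ?y :: ?l' => let b := z_eq x y in
    lazymatch b with true => constr:(0%N) | false => let i := z_index x l' in constr:(S i) end
  end.
Ltac z_reify x l := lazymatch x with
  | (?a + ?b)%R => let a' := z_reify a l in let b' := z_reify b l in constr:(ZAdd a' b')
  | (- ?a)%R => let a' := z_reify a l in constr:(ZOpp a')
  | 0%R => constr:(ZZero)
  | _ => let i := z_index x l in constr:(ZVar i)
  end.
Ltac zmod := lazymatch goal with
  | |- @eq ?T ?a ?b =>
    let l := z_atoms a (@nil T) in let l := z_atoms b l in
    let a' := z_reify a l in let b' := z_reify b l in
    refine (@zmod_eqP _ l a' b' _); vm_compute; reflexivity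
  end.
Ltac ncring := rewrite ?(mulrDl, mulrDr, mulNr, mulrN, mulr1, mul1r, mulr0, mul0r, mulrA, opprK); zmod.

(** Derives a linear consequence of one equation: only an identity between the two differences is
    left, which [zmod] settles. *)
Lemma eq_by_diff (W : zmodType) (x y u v : W) : x = y -> u - v = x - y -> u = v.
Proof. by move=> -> h; apply: subr0_eq; rewrite h subrr. Qed.

(** * Linear algebra over a division ring *)

(* The library makes matrices a unit ring only over commutative rings; [clu R] is R with classically defined units and inverses. *)
Definition clu (R : nzRingType) : Type := R.
HB.instance Definition _ (R : nzRingType) := GRing.NzRing.on (clu R).

Section Clu.
Variable R : nzRingType.

Definition clu_unit (x : clu R) : bool := `[< exists y : clu R, y * x = 1 /\ x * y = 1 >].

Definition clu_inv (x : clu R) : clu R :=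
  if pselect (exists y : clu R, y * x = 1 /\ x * y = 1) is left e then projT1 (cid e) else x.

Fact clu_mulV : {in clu_unit, left_inverse 1 clu_inv *%R}.
Proof.
move=> x /asboolP ex; rewrite /clu_inv; case: pselect => // e.
by case: (cid e) => y /= [].
Qed.

Fact clu_mulrV : {in clu_unit, right_inverse 1 clu_inv *%R}.
Proof.
move=> x /asboolP ex; rewrite /clu_inv; case: pselect => // e.
by case: (cid e) => y /= [].
Qed.

Fact clu_unitP (x y : clu R) : y * x = 1 /\ x * y = 1 -> clu_unit x.
Proof. by move=> h; apply/asboolP; exists y. Qed.

Fact clu_inv_out : {in [predC clu_unit], clu_inv =1 id}.
Proof.
move=> x /negP nx; rewrite /clu_inv; case: pselect => // e.
by case: nx; apply/asboolP.
Qed.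

HB.instance Definition _ := GRing.NzRing_hasMulInverse.Build (clu R)
  clu_mulV clu_mulrV clu_unitP clu_inv_out.
End Clu.

Section Dep.
Variable (R : unitRingType).

(** [dsV] carries no condition x != 0, because a non-unit is its own inverse by convention. *)
Record division_subring (K : R -> Prop) : Prop := DivisionSubring {
  ds1 : K 1;
  dsB : forall x y, K x -> K y -> K (x - y);
  dsM : forall x y, K x -> K y -> K (x * y);
  dsU : forall x, K x -> x != 0 -> x \is a GRing.unit;
  dsV : forall x, K x -> K x^-1 }.

Variable K : R -> Prop.
Hypothesis hK : division_subring K.

Lemma ds0 : K 0. Proof. by rewrite -(subrr 1); apply: (dsB hK); apply: (ds1 hK). Qed.
Lemma dsN x : K x -> K (- x).
Proof. by move=> ?; rewrite -sub0r; apply: (dsB hK) => //; apply: ds0. Qed.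
Lemma dsD x y : K x -> K y -> K (x + y).
Proof. by move=> ? ?; rewrite -[y]opprK; apply: (dsB hK) => //; apply: dsN. Qed.
Lemma ds_sum (I : Type) (r : seq I) (P : pred I) F :
  (forall i, P i -> K (F i)) -> K (\sum_(i <- r | P i) F i).
Proof. by move=> h; apply: big_ind => //; [apply: ds0|apply: dsD]. Qed.
Lemma ds_nat n : K n%:R.
Proof. by elim: n => [|n ih]; [apply: ds0|rewrite -addn1 natrD; apply: dsD => //; apply: (ds1 hK)]. Qed.
Lemma dsX x n : K x -> K (x ^+ n).
Proof. by move=> h; elim: n => [|n ih]; [apply: (ds1 hK)|rewrite exprS; apply: (dsM hK)]. Qed.

(** Gaussian elimination with all multipliers on the left, which is valid over a division ring; the
    entries lie in [K], and so do the coefficients found. *)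
Lemma linear_dependence n m (X : 'I_m -> 'I_n -> R) : (n < m)%N ->
  (forall i j, K (X i j)) ->
  exists c : 'I_m -> R, (forall i, K (c i)) /\ (exists i, c i != 0) /\
    forall j, \sum_i c i * X i j = 0.
Proof.
elim: n m X => [|n IH] [|m] // X ltnm KX.
  exists (fun=> 1); split; [by move=> _; apply: (ds1 hK)|split; last by case].
  by exists ord0; apply: oner_neq0.
have [/existsP[i nz]|/existsPn z] := boolP [exists i, X i ord0 != 0].
  have uX := dsU hK (KX i ord0) nz.
  pose X' j k := X (lift i j) (lift ord0 k) -
     X (lift i j) ord0 * (X i ord0)^-1 * X i (lift ord0 k).
  have KX' j k : K (X' j k).
    by apply: (dsB hK) => //; apply: (dsM hK) => //; apply: (dsM hK) => //; apply: (dsV hK).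
  have [c [Kc [[j0 nz0] hc]]] := IH m X' ltnm KX'.
  (* The coefficient of the pivot row that cancels column 0. *)
  pose s := - \sum_j c j * X (lift i j) ord0 * (X i ord0)^-1.
  pose d k := if unlift i k is Some j then c j else s.
  have dl j : d (lift i j) = c j by rewrite /d liftK.
  have di : d i = s by rewrite /d unlift_none.
  exists d; split=> [k|].
    rewrite /d; case: unliftP => [j _|_] //; apply: dsN; apply: ds_sum => j _.
    by apply: (dsM hK); [apply: (dsM hK)|apply: (dsV hK)].
  split; first by exists (lift i j0); rewrite dl.
  move=> k; rewrite (bigD1_ord i) //= di.
  under eq_bigr => j _ do rewrite dl.
  case: (unliftP ord0 k) => [k' ->|->].
    apply: etrans (hc k'); rewrite /s mulNr mulr_suml.
    under [RHS]eq_bigr => j _ do rewrite /X' mulrBr.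
    rewrite sumrB addrC; congr (_ - _).
    by apply: eq_bigr => j _; rewrite !mulrA.
  rewrite /s mulNr mulr_suml; apply/eqP; rewrite addrC subr_eq0; apply/eqP.
  by apply: eq_bigr => j _; rewrite mulrVK.
have [|c [Kc [nz hc]]] := IH m.+1 (fun i j => X i (lift ord0 j)) (ltnW ltnm) _.
  by [].
exists c; split=> //; split=> // j.
case: (unliftP ord0 j) => [j' ->|->]; first exact: hc.
by apply: big1 => i _; move/negbNE/eqP: (z i) => ->; rewrite mulr0.
Qed.
End Dep.

Section LinAlg.
Variables (D : unitRingType) (n : nat).
Hypothesis dD : forall x : D, x != 0 -> x \is a GRing.unit.
Local Notation N := n.+2.
Local Notation L := (clu 'M[D]_N).
Local Notation V := 'rV[D]_N.
Implicit Types (u v w : V) (x y z g : L) (W : V -> Prop).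

Lemma actM v x y : v *m (x * y) = v *m x *m y.
Proof. by rewrite -mulmxA. Qed.
Lemma actD v x y : v *m (x + y) = v *m x + v *m y.
Proof. by rewrite mulmxDr. Qed.
Lemma actB v x y : v *m (x - y) = v *m x - v *m y.
Proof. by rewrite mulmxBr. Qed.
Lemma actN v x : v *m (- x) = - (v *m x).
Proof. by rewrite mulmxN. Qed.
Lemma act1 v : v *m (1 : L) = v.
Proof. by rewrite mulmx1. Qed.
Lemma act0 v : v *m (0 : L) = 0.
Proof. by rewrite mulmx0. Qed.
Lemma act_sum v (I : Type) (r : seq I) (P : pred I) (F : I -> L) :
  v *m (\sum_(i <- r | P i) F i) = \sum_(i <- r | P i) v *m F i.
Proof. by rewrite mulmx_sumr. Qed.

Definition e_ (i : 'I_N) : V := delta_mx 0 i.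

Lemma act_ext x y : (forall i, e_ i *m x = e_ i *m y) -> x = y.
Proof.
move=> h; apply/matrixP => i j.
by have := congr1 (fun v : V => v 0 j) (h i); rewrite -!rowE !mxE.
Qed.

Lemma e_sum v : v = \sum_i v 0 i *: e_ i.
Proof. exact: row_sum_delta. Qed.

Definition rows_mx (f : 'I_N -> V) : L := \matrix_i f i.
Lemma rows_mxE f i : e_ i *m rows_mx f = f i.
Proof. by rewrite -rowE rowK. Qed.

Definition indep r (u : 'I_r -> V) : Prop :=
  forall c : 'I_r -> D, \sum_i c i *: u i = 0 -> forall i, c i = 0.

Lemma dsD_full : division_subring (fun _ : D => True).
Proof. by split=> // x _; apply: dD. Qed.

Lemma indep_le r (u : 'I_r -> V) : indep u -> (r <= N)%N.
Proof.
move=> iu; rewrite leqNgt; apply/negP => lt.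
have [c [_ [[i nz] hc]]] := linear_dependence dsD_full (X := fun i j => u i 0 j) lt (fun _ _ => I).
move/eqP: nz; apply; apply: iu; apply/rowP => j.
by rewrite summxE mxE -[RHS](hc j); apply: eq_bigr => k _; rewrite mxE.
Qed.

Definition subsp W : Prop :=
  [/\ W 0, forall u v, W u -> W v -> W (u + v) & forall a v, W v -> W (a *: v)].

Lemma subspN W v : subsp W -> W v -> W (- v).
Proof. by case=> _ _ h /(h (-1)); rewrite scaleN1r. Qed.
Lemma subspB W u v : subsp W -> W u -> W v -> W (u - v).
Proof. by move=> h ? ?; case: (h) => _ hD _; apply: hD => //; apply: subspN. Qed.
Lemma subsp_sum W (I : Type) (r : seq I) (P : pred I) (F : I -> V) :
  subsp W -> (forall i, P i -> W (F i)) -> W (\sum_(i <- r | P i) F i).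
Proof. by case=> h0 hD _ h; apply: big_ind. Qed.

Lemma extend_indep W r (u : 'I_r -> V) v : subsp W -> (forall i, W (u i)) ->
  indep u -> ~ W v ->
  indep (fun i : 'I_r.+1 => if unlift ord0 i is Some j then u j else v).
Proof.
move=> sW Wu iu nWv c; rewrite big_ord_recl /= unlift_none.
under eq_bigr => i _ do rewrite liftK.
move=> h.
have c0 : c ord0 = 0.
  apply/eqP; apply: contrapT => /negP nz; apply: nWv.
  have -> : v = - ((c ord0)^-1 *: \sum_i c (lift ord0 i) *: u i).
    rewrite -scalerN -(addr0_eq h) opprK scalerA mulVr ?scale1r //; exact: dD.
  apply: subspN => //; case: (sW) => _ _; apply.
  by apply: subsp_sum => // i _; case: (sW) => _ _; apply.
move: h; rewrite c0 scale0r add0r => /iu h i.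
by case: (unliftP ord0 i) => [j ->|->].
Qed.

Definition has_indep W r : Prop := exists u : 'I_r -> V, indep u /\ forall i, W (u i).

Lemma has_indep0 W : exists r, `[< has_indep W r >].
Proof. by exists 0%N; apply/asboolP; exists (fun=> 0); split; [move=> c _ []|case]. Qed.
Lemma has_indep_le W r : `[< has_indep W r >] -> (r <= N)%N.
Proof. by move/asboolP => [u [/indep_le]]. Qed.

Definition dimW W : nat := ex_maxn (has_indep0 W) (@has_indep_le W).

Lemma dimW_le W : (dimW W <= N)%N.
Proof. by rewrite /dimW; case: ex_maxnP => r /has_indep_le. Qed.

Lemma dimW_eq W W' : subsp W' -> (forall v, W' v -> W v) -> (dimW W <= dimW W')%N ->
  forall v, W v -> W' v.
Proof.
move=> sW' sub; rewrite /dimW; case: ex_maxnP => r _ maxr; case: ex_maxnP => r' /asboolP[u [iu Wu]] _ le v Wv.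
apply: contrapT => nW'v.
have /maxr : `[< has_indep W r'.+1 >].
  apply/asboolP; exists (fun i => if unlift ord0 i is Some j then u j else v).
  split; first exact: (extend_indep sW' Wu iu nW'v).
  by move=> i; case: (unlift ord0 i) => [j|] //; apply: sub.
by move=> lt; move: (leq_trans lt le); rewrite ltnn.
Qed.

(** The dimension is the size of a largest independent family, so an inclusion between subspaces of
    equal dimension is an equality, and a member of least dimension is minimal. *)
Lemma subspace_dcc (Fam : (V -> Prop) -> Prop) W0 : Fam W0 ->
  (forall W, Fam W -> subsp W) ->
  exists2 W, Fam W & forall W', Fam W' -> (forall v, W' v -> W v) -> forall v, W v -> W' v.
Proof.
move=> F0 sF.
have ex : exists d, `[< exists2 W, Fam W & dimW W = d >].
  by exists (dimW W0); apply/asboolP; exists W0.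
case: (ex_minnP ex) => d /asboolP[W FW dW] mind.
exists W => // W' FW' sub; apply: dimW_eq => //; first exact: sF.
by rewrite dW; apply: mind; apply/asboolP; exists W'.
Qed.

Lemma subspace_acc (Fam : (V -> Prop) -> Prop) W0 : Fam W0 ->
  (forall W, Fam W -> subsp W) ->
  exists2 W, Fam W & forall W', Fam W' -> (forall v, W v -> W' v) -> forall v, W' v -> W v.
Proof.
move=> F0 sF.
have ex : exists d, `[< exists2 W, Fam W & dimW W = d >].
  by exists (dimW W0); apply/asboolP; exists W0.
have bd d : `[< exists2 W, Fam W & dimW W = d >] -> (d <= N)%N.
  by move/asboolP => [W _ <-]; apply: dimW_le.
case: (ex_maxnP ex bd) => d /asboolP[W FW dW] maxd.
exists W => // W' FW' sub; apply: dimW_eq => //; first exact: sF.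
by rewrite dW; apply: maxd; apply/asboolP; exists W'.
Qed.

Lemma indep_e : indep e_.
Proof.
move=> c h i; have := congr1 (fun v : V => v 0 i) h.
rewrite summxE (bigD1 i) //= big1 ?addr0 => [|j ne].
  by rewrite !mxE !eqxx mulr1.
by rewrite !mxE eqxx /= eq_sym (negbTE ne) mulr0.
Qed.

(** A basis vector outside the image, added to the images of the basis, would give N + 1 independent
    vectors. Preimages of the basis vectors are the rows of a left inverse, which injectivity makes
    two-sided. *)
Lemma unit_of_ker x : (forall v, v *m x = 0 -> v = 0) -> x \is a GRing.unit.
Proof.
move=> kx.
have ex i : exists v, v *m x = e_ i.
  apply: contrapT => nex.
  pose W w := exists v, w = v *m x.
  have sW : subsp W.
    split; first by exists 0; rewrite mul0mx.
      by move=> _ _ [v ->] [w ->]; exists (v + w); rewrite mulmxDl.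
    by move=> a _ [v ->]; exists (a *: v); rewrite scalemxAl.
  have iu : indep (fun i => e_ i *m x).
    move=> c h; apply: indep_e; apply: kx; rewrite mulmx_suml -[RHS]h.
    by apply: eq_bigr => j _; rewrite scalemxAl.
  have Wu j : W (e_ j *m x) by exists (e_ j).
  have nW : ~ W (e_ i) by case=> v hv; apply: nex; exists v.
  by move/indep_le: (extend_indep sW Wu iu nW); rewrite ltnn.
have /choice[f hf] := ex.
pose y := rows_mx f.
have yx : y * x = 1.
  by apply: act_ext => i; rewrite actM rows_mxE hf act1.
apply/unitrP; exists y; split=> //.
have : forall v, v *m (x * y - 1) = 0.
  move=> v; apply: kx; rewrite -actM mulrBl mul1r -mulrA yx mulr1 subrr; exact: act0.
move=> h; apply: subr0_eq; apply: act_ext => i; rewrite h act0 //.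
Qed.

Lemma unit_ker x v : x \is a GRing.unit -> v *m x = 0 -> v = 0.
Proof. by move=> ux h; rewrite -[v]act1 -(mulrV ux) actM h mul0mx. Qed.

End LinAlg.

(** * Transvections and the commutator subgroup *)

Section Groups.
Variable R : unitRingType.
Implicit Types (x y : R) (H N : R -> Prop).

Record grp H : Prop := Grp {
  grpU : forall x, H x -> x \is a GRing.unit;
  grp1 : H 1;
  grpM : forall x y, H x -> H y -> H (x * y);
  grpV : forall x, H x -> H x^-1 }.

Definition normalized_by H N := forall x y, H x -> N y -> N (x^-1 * y * x).

Definition comm x y := x^-1 * y^-1 * x * y.

Definition central x := forall y, x * y = y * x.

Lemma commE x y : x \is a GRing.unit -> y \is a GRing.unit -> x * y = y * x * comm x y.
Proof.
move=> ux uy; rewrite /comm !mulrA mulrK // mulrV // mul1r //.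
Qed.

Lemma grp_conjV H N x y : grp H -> normalized_by H N -> H x -> N y -> N (x * y * x^-1).
Proof. by move=> gH nH Hx Ny; rewrite -{1}[x]invrK; apply: nH => //; apply: grpV. Qed.

End Groups.

Section Transvections.
Variables (D : unitRingType) (n : nat).
Hypothesis dD : forall x : D, x != 0 -> x \is a GRing.unit.
Local Notation N := n.+2.
Local Notation L := (clu 'M[D]_N).
Local Notation V := 'rV[D]_N.
Local Notation C := 'cV[D]_N.
Implicit Types (u v w : V) (x y z g : L) (W : V -> Prop) (phi psi : C).
Local Notation e_ := (@e_ D n).

Lemma act_extV x y : (forall v, v *m x = v *m y) -> x = y.
Proof. by move=> h; apply: act_ext. Qed.

(* [pr v psi] pairs the row v with the column psi, and [rk psi w] is the rank one endomorphism v |-> (v psi) w; a transvection is 1 + rk psi w with w psi = 0. [colZ] is right scaling of columns. *)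
Definition pr v psi : D := (v *m psi) 0 0.
Definition rk psi w : L := psi *m w.
Definition colZ psi (a : D) : C := psi *m a%:M.

Lemma prDl u v psi : pr (u + v) psi = pr u psi + pr v psi.
Proof. by rewrite /pr mulmxDl mxE. Qed.
Lemma prNl u psi : pr (- u) psi = - pr u psi.
Proof. by rewrite /pr mulNmx mxE. Qed.
Lemma prBl u v psi : pr (u - v) psi = pr u psi - pr v psi.
Proof. by rewrite prDl prNl. Qed.
Lemma prZl a u psi : pr (a *: u) psi = a * pr u psi.
Proof. by rewrite /pr -scalemxAl mxE. Qed.
Lemma pr0l psi : pr 0 psi = 0.
Proof. by rewrite /pr mul0mx mxE. Qed.
Lemma prDr u psi phi : pr u (psi + phi) = pr u psi + pr u phi.
Proof. by rewrite /pr mulmxDr mxE. Qed.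
Lemma prNr u psi : pr u (- psi) = - pr u psi.
Proof. by rewrite /pr mulmxN mxE. Qed.
Lemma prBr u psi phi : pr u (psi - phi) = pr u psi - pr u phi.
Proof. by rewrite prDr prNr. Qed.
Lemma pr0r u : pr u 0 = 0.
Proof. by rewrite /pr mulmx0 mxE. Qed.
Lemma prZr u psi a : pr u (colZ psi a) = pr u psi * a.
Proof.
rewrite /pr /colZ mulmxA [u *m psi]mx11_scalar -scalar_mxM [LHS]mxE eqxx mulr1n [X in _ = X * _]mxE eqxx mulr1n //.
Qed.
Lemma pr_act v x psi : pr (v *m x) psi = pr v ((x : 'M[D]_N) *m psi).
Proof. by rewrite /pr mulmxA. Qed.

Lemma act_rk v psi w : v *m rk psi w = pr v psi *: w.
Proof. by rewrite /rk mulmxA [v *m psi]mx11_scalar mul_scalar_mx. Qed.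

Lemma rkD psi u v : rk psi (u + v) = rk psi u + rk psi v.
Proof. by rewrite /rk mulmxDr. Qed.
Lemma rkN psi u : rk psi (- u) = - rk psi u.
Proof. by rewrite /rk mulmxN. Qed.
Lemma rkDc psi phi u : rk (psi + phi) u = rk psi u + rk phi u.
Proof. by rewrite /rk mulmxDl. Qed.
Lemma rkZ psi a u : rk psi (a *: u) = rk (colZ psi a) u.
Proof. by apply: act_extV => v; rewrite !act_rk prZr scalerA. Qed.
Lemma rkM psi w phi v : rk psi w * rk phi v = rk psi (pr w phi *: v).
Proof.
by apply: act_extV => u; rewrite actM [u *m rk psi w]act_rk -scalemxAl !act_rk.
Qed.
Lemma mul_rk psi w x : rk psi w * x = rk psi (w *m x).
Proof. by apply: act_extV => u; rewrite actM !act_rk scalemxAl. Qed.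
Lemma rk_mul psi w x : x * rk psi w = rk ((x : 'M[D]_N) *m psi) w.
Proof. by apply: act_extV => u; rewrite actM !act_rk pr_act. Qed.
Lemma rk0 psi : rk psi 0 = 0. Proof. by rewrite /rk mulmx0. Qed.

Definition c_ (i : 'I_N) : C := delta_mx i 0.
Lemma pr_c v i : pr v (c_ i) = v 0 i.
Proof. by rewrite /pr -colE mxE. Qed.
Lemma e_c i j : pr (e_ i) (c_ j) = (i == j)%:R.
Proof. by rewrite pr_c mxE eqxx eq_sym. Qed.

Lemma ex_dual w : w != 0 -> exists psi, pr w psi = 1.
Proof.
move=> nz; have [/existsP[i nzi]|/existsPn z] := boolP [exists i, w 0 i != 0].
  by exists (colZ (c_ i) (w 0 i)^-1); rewrite prZr pr_c mulrV // dD.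
case/negP: nz; apply/eqP/rowP => i; rewrite mxE; exact/eqP/negbNE/z.
Qed.

Lemma ex_dual_col psi : psi != 0 -> exists w, pr w psi = 1.
Proof.
move=> nz; have [/existsP[i nzi]|/existsPn z] := boolP [exists i, psi i 0 != 0].
  exists ((psi i 0)^-1 *: e_ i); rewrite prZl /pr -rowE mxE mulVr // dD //.
case/negP: nz; apply/eqP/colP => i; rewrite mxE; exact/eqP/negbNE/z.
Qed.

Lemma ex_separate w v : w != 0 -> (forall a, v != a *: w) ->
  exists psi, pr w psi = 0 /\ pr v psi = 1.
Proof.
move=> nz ind; have [phi hphi] := ex_dual nz.
pose x := v - pr v phi *: w.
have /ex_dual[psi0 h0] : x != 0 by rewrite subr_eq0.
pose psi := psi0 - colZ phi (pr w psi0).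
have wpsi : pr w psi = 0 by rewrite prBr prZr hphi mul1r subrr.
exists psi; split=> //.
have : pr x psi = pr v psi by rewrite prBl prZl wpsi mulr0 subr0.
have xphi : pr x phi = 0 by rewrite prBl prZl hphi mulr1 subrr.
by move=> <-; rewrite prBr prZr xphi mul0r subr0.
Qed.

(** [phi] and [psi] are coordinates dual to [w] and [v]; their common kernel complements the plane
    of [w] and [v]. *)
Definition frame w v phi psi : Prop :=
  [/\ pr w phi = 1, pr w psi = 0, pr v phi = 0 & pr v psi = 1].

Lemma frame_sym w v phi psi : frame w v phi psi -> frame v w psi phi.
Proof. by case. Qed.

Lemma ex_frame w v : w != 0 -> (forall a, v != a *: w) -> exists phi psi, frame w v phi psi.
Proof.
move=> nz ind; have [psi [h1 h2]] := ex_separate nz ind.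
have nzv : v != 0 by move: (ind 0); rewrite scale0r.
have ind' a : w != a *: v.
  apply/eqP => h; case: (eqVneq a 0) => [a0|a0].
    by move: nz; rewrite h a0 scale0r eqxx.
  by move: (ind a^-1); rewrite h scalerA mulVr ?scale1r ?eqxx // dD.
have [phi [h3 h4]] := ex_separate nzv ind'.
by exists phi, psi.
Qed.

Lemma frame_ne0 w v phi psi : frame w v phi psi -> w != 0.
Proof. by case=> h _ _ _; apply/eqP => w0; move/eqP: h; rewrite w0 pr0l eq_sym oner_eq0. Qed.
Lemma ex_frame_w w : w != 0 -> exists v phi psi, frame w v phi psi.
Proof.
move=> nz; suff [v iv] : exists v, forall a, v != a *: w.
  by have [phi [psi h]] := ex_frame nz iv; exists v, phi, psi.
apply: contrapT => nex.
have h i : exists a, e_ i = a *: w.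
  apply: contrapT => ne; apply: nex; exists (e_ i) => a; apply/eqP => e; apply: ne.
  by exists a.
have [a0 h0] := h ord0; have [a1 h1] := h (lift ord0 ord0).
have ua : a0 \is a GRing.unit.
  apply: dD; apply/eqP => z; have := congr1 (fun v : V => v 0 ord0) h0.
  by rewrite z scale0r !mxE !eqxx => /eqP; rewrite oner_eq0.
have : e_ (lift ord0 ord0) = (a1 * a0^-1) *: e_ ord0.
  by rewrite h0 scalerA mulrVK.
move/(congr1 (fun v : V => v 0 (lift ord0 ord0))).
by rewrite !mxE !eqxx /= mulr0 => /eqP; rewrite oner_eq0.
Qed.

Lemma ex_frame_wpsi w psi : w != 0 -> psi != 0 -> pr w psi = 0 ->
  exists v phi, frame w v phi psi.
Proof.
move=> /ex_dual[phi0 h0] /ex_dual_col[v hv] wp.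
exists v, (phi0 - colZ psi (pr v phi0)); split=> //.
  by rewrite prBr prZr wp mul0r subr0.
by rewrite prBr prZr hv mul1r subrr.
Qed.

Inductive Tg : L -> Prop :=
| Tg1 : Tg 1
| Tgm psi w x : pr w psi = 0 -> Tg x -> Tg ((1 + rk psi w) * x).

Lemma rk_sq psi w phi : pr w phi = 0 -> rk psi w * rk phi w = 0.
Proof. by move=> h; rewrite rkM h scale0r rk0. Qed.

Lemma tvM psi w : pr w psi = 0 -> (1 - rk psi w) * (1 + rk psi w) = 1.
Proof.
move=> h; rewrite mulrDr mulr1 mulrBl mul1r rk_sq // subr0.
by rewrite addrAC addrK.
Qed.
Lemma tvM' psi w : pr w psi = 0 -> (1 + rk psi w) * (1 - rk psi w) = 1.
Proof.
move=> h; have := @tvM psi (- w); rewrite rkN opprK; apply.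
by rewrite prNl h oppr0.
Qed.
Lemma tvU psi w : pr w psi = 0 -> (1 + rk psi w) \is a GRing.unit.
Proof. by move=> h; apply/unitrP; exists (1 - rk psi w); rewrite tvM ?tvM'. Qed.
Lemma tvV psi w : pr w psi = 0 -> (1 + rk psi w)^-1 = 1 - rk psi w.
Proof.
by move=> h; apply: (mulrI (tvU h)); rewrite mulrV ?tvU // tvM'.
Qed.

Lemma Tg_tv psi w : pr w psi = 0 -> Tg (1 + rk psi w).
Proof. by move=> h; rewrite -[X in Tg X]mulr1; apply: Tgm => //; apply: Tg1. Qed.

Lemma Tg_grp : grp Tg.
Proof.
have TM x y : Tg x -> Tg y -> Tg (x * y).
  by elim=> [|psi w z h _ ih] Ty; rewrite ?mul1r // -mulrA; apply: Tgm => //; apply: ih.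
have TU x : Tg x -> x \is a GRing.unit.
  by elim=> [|psi w z h _ ih]; rewrite ?unitr1 // unitrMl // tvU.
split=> //; first exact: Tg1.
move=> x; elim=> [|psi w z h Tz ih]; first by rewrite invr1; apply: Tg1.
rewrite invrM ?tvU ?TU //; apply: TM => //.
by rewrite tvV // -rkN; apply: Tg_tv; rewrite prNl h oppr0.
Qed.

Lemma conj_tv x psi w : x \is a GRing.unit ->
  x^-1 * (1 + rk psi w) * x = 1 + rk ((x^-1 : 'M[D]_N) *m psi) (w *m x).
Proof. by move=> ux; rewrite mulrDr mulr1 mulrDl mulVr // rk_mul mul_rk. Qed.

Lemma pr_conj x psi w : x \is a GRing.unit ->
  pr (w *m x) ((x^-1 : 'M[D]_N) *m psi) = pr w psi.
Proof. by move=> ux; rewrite -pr_act -actM mulrV // act1. Qed.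

Lemma Tg_norm : normalized_by (fun x : L => x \is a GRing.unit) Tg.
Proof.
move=> x y ux; elim=> [|psi w z h _ ih]; first by rewrite mulr1 mulVr //; apply: Tg1.
have -> : x^-1 * ((1 + rk psi w) * z) * x = (x^-1 * (1 + rk psi w) * x) * (x^-1 * z * x).
  by rewrite !mulrA mulrK.
by rewrite conj_tv //; apply: Tgm => //; rewrite pr_conj.
Qed.

(* On the plane spanned by w and v this is diag(a, a^-1). *)
Definition hh w v phi psi (a : D) : L :=
  1 + rk phi ((a - 1) *: w) + rk psi ((a^-1 - 1) *: v).

Lemma act_hh w v phi psi a u :
  u *m hh w v phi psi a = u + (pr u phi * (a - 1)) *: w + (pr u psi * (a^-1 - 1)) *: v.
Proof. by rewrite /hh !actD act1 !act_rk !scalerA. Qed.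

Lemma hh_Tg w v phi psi a : frame w v phi psi -> a \is a GRing.unit ->
  Tg (hh w v phi psi a).
Proof.
move=> [wf wp vf vp] ua.
pose X b := 1 + rk phi (b *: v); pose Y b := 1 + rk psi (b *: w).
have TX b : Tg (X b) by apply: Tg_tv; rewrite prZl vf mulr0.
have TY b : Tg (Y b) by apply: Tg_tv; rewrite prZl wp mulr0.
have aX b u : u *m X b = u + (pr u phi * b) *: v by rewrite actD act1 act_rk scalerA.
have aY b u : u *m Y b = u + (pr u psi * b) *: w by rewrite actD act1 act_rk scalerA.
(* Whitehead's identity: diag(a, a^-1) is the product of the monomial elements X(a) Y(-a^-1) X(a)
   and X(-1) Y(1) X(-1). *)
suff -> : hh w v phi psi a = X a * Y (- a^-1) * X a * X (-1) * Y 1 * X (-1).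
  by do !apply: (grpM Tg_grp).
apply: act_extV => u; rewrite !actM act_hh.
set al := pr u phi; set be := pr u psi.
rewrite [u *m X a]aX -/al.
have p1 : pr (u + (al * a) *: v) phi = al by rewrite prDl prZl vf mulr0 addr0.
have q1 : pr (u + (al * a) *: v) psi = be + al * a by rewrite prDl prZl vp mulr1.
move: p1 q1; set u1 := u + _ => p1 q1.
rewrite [u1 *m Y _]aY q1.
have -> : (be + al * a) * - a^-1 = - (be * a^-1 + al) by rewrite mulrN mulrDl mulrK.
set s := be * a^-1.
have p2 : pr (u1 - (s + al) *: w) phi = - s by rewrite prBl prZl wf p1 mulr1 opprD addrCA subrr addr0.
have q2 : pr (u1 - (s + al) *: w) psi = be + al * a by rewrite prBl prZl wp q1 mulr0 subr0.
rewrite scaleNr; move: p2 q2; set u2 := u1 - _ => p2 q2.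
rewrite [u2 *m X a]aX p2 mulNr [s * a]mulrVK // scaleNr.
have p3 : pr (u2 - be *: v) phi = - s by rewrite prBl prZl vf p2 mulr0 subr0.
have q3 : pr (u2 - be *: v) psi = al * a by rewrite prBl prZl vp q2 mulr1 addrAC subrr add0r.
move: p3 q3; set u3 := u2 - _ => p3 q3.
rewrite [u3 *m X _]aX p3 mulrN1 opprK.
have p4 : pr (u3 + s *: v) phi = - s by rewrite prDl prZl vf p3 mulr0 addr0.
have q4 : pr (u3 + s *: v) psi = al * a + s by rewrite prDl prZl vp q3 mulr1.
move: p4 q4; set u4 := u3 + _ => p4 q4.
rewrite [u4 *m Y _]aY q4 mulr1.
have p5 : pr (u4 + (al * a + s) *: w) phi = al * a by rewrite prDl prZl wf p4 mulr1 addrC addrK.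
move: p5; set u5 := u4 + _ => p5.
rewrite [u5 *m X _]aX p5 mulrN1 scaleNr.
rewrite /u5 /u4 /u3 /u2 /u1 !mulrBr !mulr1 -/s !scalerBl !scalerDl; zmod.
Qed.

Lemma e_E i j : (e_ i) 0 j = (i == j)%:R.
Proof. by rewrite mxE eqxx eq_sym. Qed.

(** The diagonal matrix with [a] in place [i] and 1 elsewhere. With [i] the last index these
    represent all classes of units modulo T. *)
Definition dil (a : D) i : L := 1 + rk (c_ i) ((a - 1) *: e_ i).

Lemma act_dil a i v : v *m dil a i = v + (v 0 i * (a - 1)) *: e_ i.
Proof. by rewrite actD act1 act_rk scalerA pr_c. Qed.

Lemma e_dil a i j : j != i -> e_ j *m dil a i = e_ j.
Proof. by move=> ne; rewrite act_dil mxE eqxx eq_sym (negbTE ne) mul0r scale0r addr0. Qed.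
Lemma ee_dil a i : e_ i *m dil a i = a *: e_ i.
Proof. by rewrite act_dil mxE !eqxx mul1r -{1}[e_ i]scale1r -scalerDl addrCA subrr addr0. Qed.

Lemma dilU a i : a \is a GRing.unit -> dil a i \is a GRing.unit.
Proof.
move=> ua; apply/unitrP; exists (dil a^-1 i).
have h b c : b * c = 1 -> dil b i * dil c i = 1.
  move=> bc; apply: act_ext => j; rewrite act1 actM.
  case: (eqVneq j i) => [->|ne]; last by rewrite !e_dil.
  by rewrite ee_dil -scalemxAl ee_dil scalerA bc scale1r.
by rewrite !h ?mulrV ?mulVr.
Qed.

Lemma dil_comm a b i j : i != j -> dil a i * dil b j = dil b j * dil a i.
Proof.
move=> ne; have h c k l : k != l -> pr ((c - 1) *: e_ k) (c_ l) = 0.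
  by move=> h; rewrite prZl e_c (negbTE h) mulr0.
have ne' : j != i by rewrite eq_sym.
by rewrite /dil !(mulrDl, mulrDr, mul1r, mulr1) !rkM !h // !scale0r !rk0; zmod.
Qed.

Lemma fixed_span (P : pred 'I_N) g v : (forall i, P i -> e_ i *m g = e_ i) ->
  (forall i, ~~ P i -> v 0 i = 0) -> v *m g = v.
Proof.
move=> h z; rewrite [in LHS](e_sum v) [in RHS](e_sum v) mulmx_suml.
apply: eq_bigr => i _; rewrite -scalemxAl.
by have [/h -> //|/z ->] := boolP (P i); rewrite !scale0r.
Qed.

(** Otherwise [e_ k *m g] would be in the span of the fixed basis vectors, hence fixed by [g], and
    injectivity would give [e_ k *m g = e_ k], which is outside that span. *)
Lemma gauss_coord (P : pred 'I_N) g k : g \is a GRing.unit ->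
  (forall i, P i -> e_ i *m g = e_ i) -> ~~ P k ->
  exists2 j, ~~ P j & (e_ k *m g) 0 j != 0.
Proof.
move=> ug h nPk.
have [/existsP[j /andP[? ?]]|/existsPn z] := boolP [exists j, ~~ P j && ((e_ k *m g) 0 j != 0)].
  by exists j.
have hv : e_ k *m g *m g = e_ k *m g.
  by apply: (fixed_span h) => i nP; have := z i; rewrite nP /= negbK => /eqP.
have : e_ k *m g - e_ k = 0.
  by apply: (unit_ker ug); rewrite mulmxBl hv subrr.
move=> /subr0_eq e; have := z k; rewrite nPk e mxE !eqxx /= oner_eq0 //.
Qed.

Lemma gauss_step (P : pred 'I_N) (y : V) k j : ~~ P k -> ~~ P j -> j != k -> y 0 j != 0 ->
  exists psi w, [/\ pr w psi = 0, forall i, P i -> e_ i *m (1 + rk psi w) = e_ i &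
    y *m (1 + rk psi w) = e_ k].
Proof.
move=> nPk nPj ne nz.
(* [psi] takes the value 1 at both [y] and [e_ k]; it therefore kills [e_ k - y], and the
   transvection in this direction carries [y] to [e_ k]. *)
pose psi := c_ k + colZ (c_ j) ((y 0 j)^-1 * (1 - y 0 k)).
have yp : pr y psi = 1.
  by rewrite prDr prZr !pr_c mulVKr ?dD // addrCA subrr addr0.
have kp : pr (e_ k) psi = 1.
  by rewrite prDr prZr !e_c eqxx eq_sym (negbTE ne) mul0r addr0.
exists psi, (e_ k - y); split; first by rewrite prBl kp yp subrr.
  move=> i Pi; rewrite actD act1 act_rk prDr prZr !e_c.
  have -> : i == k = false by apply: contraNF nPk => /eqP <-.
  have -> : i == j = false by apply: contraNF nPj => /eqP <-.
  by rewrite mul0r addr0 scale0r addr0.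
by rewrite actD act1 act_rk yp scale1r addrCA subrr addr0.
Qed.

(** Only n + 1 of the n + 2 rows are normalised: each step uses a coordinate outside the rows
    already treated and different from the current one. *)
Lemma gauss g : g \is a GRing.unit -> forall k, (k <= n.+1)%N ->
  exists2 tau, Tg tau & forall i : 'I_N, (i < k)%N -> e_ i *m (g * tau) = e_ i.
Proof.
move=> ug; elim=> [_|k IH lek].
  by exists 1; [apply: Tg1|].
have [tau Tt ht] := IH (ltnW lek).
set g1 := g * tau in ht.
have ug1 : g1 \is a GRing.unit by rewrite /g1 unitrMl ?(grpU Tg_grp Tt).
have ltk : (k < N)%N by apply: (leq_trans lek).
pose kk : 'I_N := Ordinal ltk; pose P := [pred i : 'I_N | (i < k)%N].
have nPk : ~~ P kk by rewrite /= ltnn.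
have [j nPj nzj] := gauss_coord ug1 ht nPk.
suff [sg Ts [hs ys]] : exists2 sg, Tg sg & (forall i, P i -> e_ i *m sg = e_ i) /\ (e_ kk *m g1 *m sg = e_ kk).
  exists (tau * sg); first exact: (grpM Tg_grp).
  move=> i; rewrite ltnS leq_eqVlt mulrA actM => /orP[/eqP e|lt]; last by rewrite ht // hs.
  by have -> : i = kk by apply: val_inj.
have key (y : V) : (exists2 j, ~~ P j & (j != kk) && (y 0 j != 0)) ->
    exists2 sg, Tg sg & (forall i, P i -> e_ i *m sg = e_ i) /\ (y *m sg = e_ kk).
  move=> [l nPl /andP[ne nz]].
  have [psi [w [h0 h1 h2]]] := gauss_step nPk nPl ne nz.
  by exists (1 + rk psi w); [apply: Tg_tv|].
case: (eqVneq j kk) => [ej|ne]; last by apply: key; exists j => //; rewrite ne.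
(* The only nonzero free coordinate may be the current one; a transvection then first copies it into
   coordinate k + 1, which exists because the last row is not treated. *)
have ltk1 : (k.+1 < N)%N by [].
pose l : 'I_N := Ordinal ltk1.
have nlk : l != kk by apply/eqP => /(congr1 val) /= /eqP; rewrite eqn_leq ltnn.
have nPl : ~~ P l by rewrite /= -leqNgt.
case: (eqVneq ((e_ kk *m g1) 0 l) 0) => [z|nz]; last by apply: key; exists l => //; rewrite nlk.
set y := e_ kk *m g1 in nzj z *.
have p0 : pr (e_ l) (c_ kk) = 0 by rewrite e_c (negbTE nlk).
have [|sg Ts [hs ys]] := key (y *m (1 + rk (c_ kk) (e_ l))).
  exists l => //; rewrite nlk actD act1 act_rk mxE z add0r pr_c mxE [X in _ * X]mxE !eqxx mulr1.
  by rewrite -ej.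
exists ((1 + rk (c_ kk) (e_ l)) * sg); first exact: Tgm.
split; last by rewrite actM.
move=> i Pi; rewrite actM actD act1 act_rk e_c.
have -> : i == kk = false by apply: contraNF nPk => /eqP <-.
by rewrite scale0r addr0 hs.
Qed.

Lemma gauss_dil g : g \is a GRing.unit ->
  exists d tau, [/\ d \is a GRing.unit, Tg tau & g = dil d ord_max * tau].
Proof.
move=> ug; have [tau Tt ht] := gauss ug (leqnn _).
set g1 := g * tau in ht.
have ug1 : g1 \is a GRing.unit by rewrite /g1 unitrMl ?(grpU Tg_grp Tt).
pose P := [pred i : 'I_N | (i < n.+1)%N].
have Pm (i : 'I_N) : ~~ P i -> i = ord_max.
  by rewrite /= -leqNgt => le; apply: val_inj; apply/eqP; rewrite eqn_leq le -ltnS ltn_ord.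
have [j nPj nzj] := gauss_coord (P := P) ug1 ht (k := ord_max) (negbT (ltnn _)).
rewrite (Pm j nPj) in nzj.
set y := e_ ord_max *m g1 in nzj; set d := y 0 ord_max in nzj.
have ud := dD nzj.
pose z := d^-1 *: y - e_ ord_max.
have pz : pr z (c_ ord_max) = 0.
  by rewrite prBl prZl e_c eqxx pr_c mulVr // subrr.
exists d, ((1 + rk (c_ ord_max) z) * tau^-1); split=> //.
  by apply: Tgm => //; apply: (grpV Tg_grp).
rewrite mulrA; apply: (mulIr (grpU Tg_grp Tt)); rewrite mulrVK ?(grpU Tg_grp) //.
apply: act_ext => i; rewrite actM.
case: (eqVneq i ord_max) => [->|ne].
  rewrite ee_dil -scalemxAl actD act1 act_rk e_c eqxx scale1r addrCA subrr addr0.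
  by rewrite scalerA mulrV // scale1r.
rewrite e_dil // actD act1 act_rk e_c (negbTE ne) scale0r addr0 ht //.
by rewrite ltn_neqAle -ltnS ltn_ord andbT; apply: contra ne => /eqP e; apply/eqP/val_inj.
Qed.

(** Modulo T both factors are dilations of the last basis vector. Some diag(d, d^-1) moves one of
    them to the first basis vector, where it commutes with the other. *)
Lemma comm_GL_Tg g h : g \is a GRing.unit -> h \is a GRing.unit -> Tg (comm g h).
Proof.
move=> ug uh.
have TgU := grpU Tg_grp; have TgM := grpM Tg_grp; have TgV := grpV Tg_grp.
have cl a b nu : a \is a GRing.unit -> b \is a GRing.unit -> Tg nu ->
    Tg (comm a b) -> Tg (comm (a * nu) b).
  move=> ua ub Tn Tc.
  have -> : comm (a * nu) b = nu^-1 * comm a b * (b^-1 * nu * b).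
    by rewrite /comm invrM ?(TgU nu) // !mulrA mulrK.
  by apply: (TgM); [apply: (TgM) => //; apply: (TgV)|apply: Tg_norm].
have cr a b nu : a \is a GRing.unit -> b \is a GRing.unit -> Tg nu ->
    Tg (comm a b) -> Tg (comm a (b * nu)).
  move=> ua ub Tn Tc.
  have -> : comm a (b * nu) = (a^-1 * nu^-1 * a) * comm a b * nu.
    by rewrite /comm invrM ?(TgU nu) // !mulrA mulrK.
  by apply: (TgM) => //; apply: (TgM) => //; apply: Tg_norm => //; apply: (TgV).
have [d [tau [ud Tt ->]]] := gauss_dil ug.
have [d' [tau' [ud' Tt' ->]]] := gauss_dil uh.
apply: (cl); rewrite ?dilU ?unitrMl ?dilU ?TgU //.
apply: (cr); rewrite ?dilU //.
have fr : frame (e_ ord_max) (e_ ord0) (c_ ord_max) (c_ ord0).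
  by split; rewrite e_c ?eqxx.
have Th := hh_Tg fr ud'.
have e : dil d' ord_max = dil d' ord0 * ((dil d' ord0)^-1 * hh (e_ ord_max) (e_ ord0) (c_ ord_max) (c_ ord0) d' * dil d' ord0).
  rewrite !mulrA mulrV ?dilU // mul1r.
  apply: act_ext => i; rewrite actM.
  rewrite act_hh !pr_c !e_E.
  case: (eqVneq i ord_max) => [->|nm].
    by rewrite ee_dil ?eqxx mul1r mul0r scale0r addr0 -{2}[e_ _]scale1r -scalerDl addrCA subrr addr0 -scalemxAl e_dil.
  rewrite mul0r scale0r addr0.
  case: (eqVneq i ord0) => [->|n0].
    rewrite e_dil // mul1r -{2}[e_ _]scale1r -scalerDl addrCA subrr addr0.
    by rewrite -scalemxAl ee_dil scalerA mulVr // scale1r.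
  by rewrite mul0r scale0r addr0 !e_dil.
rewrite e; apply: (cr); rewrite ?dilU //; first by apply: Tg_norm => //; rewrite dilU.
have -> : comm (dil d ord_max) (dil d' ord0) = 1.
  rewrite /comm -mulrA dil_comm // mulrA mulrVK ?dilU // mulVr ?dilU //.
exact: Tg1.
Qed.

End Transvections.

(** * Subgroups and subrings normalised by the transvections *)

Section CommMod.
Variable R : unitRingType.
Implicit Types (x y a b nu : R) (H : R -> Prop).

Lemma comm_mod_l H a b nu : grp H -> a \is a GRing.unit -> b \is a GRing.unit ->
  H nu -> H (b^-1 * nu * b) -> H (comm a b) -> H (comm (a * nu) b).
Proof.
move=> gH ua ub Hn Hc Hab; have un := grpU gH Hn.
have -> : comm (a * nu) b = nu^-1 * comm a b * (b^-1 * nu * b).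
  by rewrite /comm invrM // !mulrA mulrK.
apply: (grpM gH) => //; apply: (grpM gH) => //; exact: (grpV gH).
Qed.

Lemma comm_mod_r H a b nu : grp H -> a \is a GRing.unit -> b \is a GRing.unit ->
  H nu -> H (a^-1 * nu^-1 * a) -> H (comm a b) -> H (comm a (b * nu)).
Proof.
move=> gH ua ub Hn Hc Hab; have un := grpU gH Hn.
have -> : comm a (b * nu) = (a^-1 * nu^-1 * a) * comm a b * nu.
  by rewrite /comm invrM // !mulrA mulrK.
by apply: (grpM gH) => //; apply: (grpM gH).
Qed.

Lemma comm1 a b : a \is a GRing.unit -> b \is a GRing.unit -> a * b = b * a -> comm a b = 1.
Proof. by move=> ua ub e; rewrite /comm -mulrA e mulrA mulrVK // mulVr. Qed.

Lemma comm_mulr x y z : x \is a GRing.unit -> y \is a GRing.unit -> z \is a GRing.unit ->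
  comm x (y * z) = comm x z * (z^-1 * comm x y * z).
Proof. by move=> ux uy uz; rewrite /comm invrM // !mulrA mulrK // mulrK. Qed.

Record subring_over_center (S : R -> Prop) : Prop := SubringOC {
  srZ : forall z, central z -> S z;
  srB : forall x y, S x -> S y -> S (x - y);
  srM : forall x y, S x -> S y -> S (x * y) }.

Lemma central1 : central (1 : R). Proof. by move=> y; rewrite mulr1 mul1r. Qed.
Lemma central0 : central (0 : R). Proof. by move=> y; rewrite mulr0 mul0r. Qed.

Variable S : R -> Prop.
Hypothesis hS : subring_over_center S.
Lemma sr0 : S 0. Proof. by apply: (srZ hS); apply: central0. Qed.
Lemma sr1 : S 1. Proof. by apply: (srZ hS); apply: central1. Qed.
Lemma srN x : S x -> S (- x).
Proof. by move=> h; rewrite -sub0r; apply: (srB hS) => //; apply: sr0. Qed.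
Lemma srD x y : S x -> S y -> S (x + y).
Proof. by move=> ? ?; rewrite -[y]opprK; apply: (srB hS) => //; apply: srN. Qed.
Lemma srX x n : S x -> S (x ^+ n).
Proof. by move=> h; elim: n => [|n ih]; [apply: sr1|rewrite exprS; apply: (srM hS)]. Qed.
Lemma sr_sum (I : Type) (r : seq I) (P : pred I) F :
  (forall i, P i -> S (F i)) -> S (\sum_(i <- r | P i) F i).
Proof. by move=> h; apply: big_ind => //; [apply: sr0|apply: srD]. Qed.
End CommMod.

Section Iwasawa.
Variables (D : unitRingType) (n : nat).
Hypothesis dD : forall x : D, x != 0 -> x \is a GRing.unit.
Local Notation N := n.+2.
Local Notation L := (clu 'M[D]_N).
Local Notation V := 'rV[D]_N.
Local Notation C := 'cV[D]_N.
Implicit Types (u v w : V) (x y z g : L) (W : V -> Prop) (phi psi : C).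
Local Notation e_ := (@e_ D n).
Local Notation Tg := (@Tg D n).

(** Comparing the eigenvalues of [e_ i], [e_ j] and [e_ i + d *: e_ j] gives la_i d = d la_j for
    every d, so that all eigenvalues equal one central scalar. *)
Lemma eigen_central x : (forall w, w != 0 -> exists a, w *m x = a *: w) -> central x.
Proof.
move=> h.
have e0 i : e_ i != 0.
  by apply/eqP => /(congr1 (fun v : V => v 0 i)); rewrite e_E eqxx mxE => /eqP; rewrite oner_eq0.
have /choice[la hla] : forall i, exists a, e_ i *m x = a *: e_ i by move=> i; apply: h.
have key i j d : i != j -> la i * d = d * la j.
  move=> ne; have nij := negbTE ne; have nji : j == i = false by rewrite eq_sym.
  have nz : e_ i + d *: e_ j != 0.
    apply/eqP => /(congr1 (fun v : V => v 0 i)).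
    by rewrite !(e_E, mxE) ?(nij, nji, eqxx) /= mulr0 addr0 => /eqP; rewrite oner_eq0.
  have [mu] := h _ nz; rewrite mulmxDl -scalemxAl !hla => E.
  have Ei := congr1 (fun v : V => v 0 i) E; have Ej := congr1 (fun v : V => v 0 j) E.
  move: Ei Ej; rewrite !(e_E, mxE) ?(nij, nji, eqxx) /=.
  by rewrite !(mulr0, mulr1, addr0, add0r) => -> ->.
have lac i d : la i * d = d * la i.
  have [j ne] : exists j, i != j.
    by case: (eqVneq i ord0) => [->|ne]; [exists (lift ord0 ord0)|exists ord0].
  by have e := key i j 1 ne; rewrite mul1r mulr1 in e; rewrite (key i j d ne) -e.
have las i j : la i = la j.
  by case: (eqVneq i j) => [->//|ne]; have := key i j 1 ne; rewrite mul1r mulr1.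
have vx v : v *m x = la ord0 *: v.
  rewrite {1}(e_sum v) mulmx_suml [in RHS](e_sum v) scaler_sumr.
  by apply: eq_bigr => i _; rewrite -scalemxAl hla !scalerA -lac (las i ord0).
by move=> y; apply: act_extV => v; rewrite !actM !vx -scalemxAl.
Qed.

Lemma central_scalar x : central x ->
  exists la : D, (forall d, la * d = d * la) /\ forall v, v *m x = la *: v.
Proof.
move=> cx.
have h w : w != 0 -> exists a, w *m x = a *: w.
  move=> nz; have [psi hp] := ex_dual dD nz.
  exists (pr (w *m x) psi).
  have := congr1 (fun y : L => w *m y) (cx (rk psi w)).
  by rewrite !actM !act_rk hp scale1r => ->.
have [a ha] : exists a, e_ ord0 *m x = a *: e_ ord0.
  by apply: h; apply/eqP => /(congr1 (fun v : V => v 0 ord0)); rewrite e_E eqxx mxE => /eqP; rewrite oner_eq0.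
have vx v : v *m x = a *: v.
  apply/rowP => j; have := congr1 (fun y : L => e_ ord0 *m y) (cx (rk (c_ D ord0) v)).
  by rewrite !actM ha -scalemxAl !act_rk e_c eqxx scale1r => <-.
exists a; split=> // d.
have := vx (d *: e_ ord0); rewrite -scalemxAl vx !scalerA => /(congr1 (fun v : V => v 0 ord0)).
by rewrite !mxE !eqxx !mulr1.
Qed.

Lemma act_scalar (la : D) v : (forall d, la * d = d * la) -> v *m la%:M = la *: v.
Proof.
move=> cl; apply/rowP => j; rewrite !mxE (bigD1 j) //= mxE eqxx mulr1n.
by rewrite big1 ?addr0 ?cl // => k ne; rewrite mxE (negbTE ne) mulr0.
Qed.
Lemma scalar_central (la : D) : (forall d, la * d = d * la) -> central (la%:M : L).
Proof.
by move=> cl; apply: eigen_central => w _; exists la; apply: act_scalar.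
Qed.

Lemma central_unit x : central x -> x != 0 -> x \is a GRing.unit.
Proof.
move=> /central_scalar[la [cl hl]] nz; apply: (unit_of_ker dD) => v; rewrite hl => e.
have ula : la \is a GRing.unit.
  apply: dD; apply: contra nz => /eqP la0; apply/eqP; apply: act_extV => w.
  by rewrite hl la0 scale0r act0.
by rewrite -[v]scale1r -(mulVr ula) -scalerA e scaler0.
Qed.

Lemma nc_separate x : ~ central x ->
  exists w psi, [/\ w != 0, pr w psi = 0 & pr (w *m x) psi = 1].
Proof.
move=> nc; apply: contrapT => nex; apply: nc; apply: eigen_central => w nz.
apply: contrapT => na; apply: nex.
have [psi [h1 h2]] := ex_separate dD nz (v := w *m x) (fun a => introN eqP (fun e => na (ex_intro _ a e))).
by exists w, psi.
Qed.

Variable t : D.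
Hypotheses (ct : forall d, t * d = d * t) (t0 : t != 0) (t1 : t * t != 1).

Section NormalSubgroup.
Variable H : L -> Prop.
Hypotheses (gH : grp H) (nH : normalized_by Tg H).

(** Conjugating [s] by a transvection that fixes [w0] moves only the image of [w0]; it suffices to
    send that image to a multiple of [w]. *)
Lemma transitive_points s w0 psi0 : H s -> w0 != 0 -> pr w0 psi0 = 0 -> pr (w0 *m s) psi0 = 1 ->
  forall w, w != 0 -> exists g a, [/\ H g, a != 0 & w0 *m g = a *: w].
Proof.
move=> Hs nz0 p0 p1 w nz.
have [[b hb]|nb] := pselect (exists b, w = b *: w0).
  have b0 : b != 0 by apply: contra nz => /eqP e; rewrite hb e scale0r.
  have ub := dD b0.
  exists 1, b^-1; split; [exact: (grp1 gH)|by rewrite invr_eq0|].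
  by rewrite act1 hb scalerA mulVr ?scale1r.
have [psi2 [q0 q1]] : exists psi, pr w0 psi = 0 /\ pr w psi = 1.
  by apply: ex_separate => // a; apply/eqP => e; apply: nb; exists a.
set w2 := w0 *m s in p1.
(* A functional vanishing at [w0] and at neither [w2] nor [w]: one of [psi0] and [psi2], or their
   sum when each kills the other vector. *)
have [psi [r0 r1 r2]] : exists psi, [/\ pr w0 psi = 0, pr w2 psi != 0 & pr w psi != 0].
  case: (eqVneq (pr w psi0) 0) => [z1|]; last by exists psi0; split=> //; rewrite p1 oner_neq0.
  case: (eqVneq (pr w2 psi2) 0) => [z2|]; last by exists psi2; split=> //; rewrite q1 oner_neq0.
  by exists (psi0 + psi2); rewrite !prDr p0 q0 p1 q1 z1 z2 !add0r addr0 oner_neq0.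
set al := pr w2 psi in r1; set be := pr w psi in r2.
have [ual ube] := (dD r1, dD r2).
pose y := (al * be^-1) *: w - w2.
have py : pr y psi = 0 by rewrite prBl prZl mulrVK // subrr.
pose psi' := colZ psi al^-1.
have py' : pr y psi' = 0 by rewrite prZr py mul0r.
pose u : L := 1 + rk psi' y.
have Tu : Tg u by apply: Tg_tv.
have uu := tvU py'.
exists (u^-1 * s * u), (al * be^-1); split.
- exact: nH.
- apply/eqP => z; have : (al * be^-1) \is a GRing.unit by rewrite unitrMl ?unitrV.
  by rewrite z unitr0.
- have w0u : w0 *m u = w0 by rewrite actD act1 act_rk prZr r0 mul0r scale0r addr0.
  have w0V : w0 *m u^-1 = w0 by rewrite -{1}w0u -actM mulrV // act1.
  by rewrite !actM w0V -/w2 actD act1 act_rk prZr mulrV // scale1r addrCA subrr addr0.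
Qed.

Hypothesis ncH : exists2 s, H s & ~ central s.

(** Iwasawa's criterion: the transvections in the fixed direction [w0] commute with each other and,
    together with [H], produce all transvections; hence commutators of transvections lie in [H]. *)
Lemma tv_factor : exists w0, forall psi w, pr w psi = 0 ->
  exists psi' h, [/\ pr w0 psi' = 0, H h & 1 + rk psi w = (1 + rk psi' w0) * h].
Proof.
have [s Hs /nc_separate[w0 [psi0 [nz p0 p1]]]] := ncH.
exists w0 => psi w pw.
case: (eqVneq w 0) => [->|nzw].
  exists 0, 1; split; [by rewrite pr0r|exact: (grp1 gH)|].
  by rewrite rk0 /rk mul0mx mulr1.
have [g [a [Hg a0 e]]] := transitive_points Hs nz p0 p1 nzw.
have ug := grpU gH Hg; have ua := dD a0.
pose psi' := colZ ((g : 'M[D]_N) *m psi) a^-1.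
have p' : pr w0 psi' = 0 by rewrite prZr -pr_act e prZl pw mulr0 mul0r.
have E : 1 + rk psi w = g^-1 * (1 + rk psi' w0) * g.
  rewrite mulrDr mulr1 mulrDl mulVr // /psi' -rkZ -rk_mul mulKr // mul_rk.
  by rewrite -scalemxAl e scalerA mulVr // scale1r.
have u0U := tvU p'; have T0 := Tg_tv p'.
exists psi', (comm (1 + rk psi' w0) g); split=> //.
  by rewrite /comm; apply: (grpM gH) => //; apply: nH => //; apply: (grpV gH).
by rewrite E /comm !mulrA mulrV // mul1r.
Qed.

Lemma comm_tv_in psi w psi2 w2 : pr w psi = 0 -> pr w2 psi2 = 0 ->
  H (comm (1 + rk psi w) (1 + rk psi2 w2)).
Proof.
move=> p p2; have [w0 fac] := tv_factor.
have [q [h [q0 Hh E]]] := fac _ _ p; have [q2 [h2 [q20 Hh2 E2]]] := fac _ _ p2.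
have Tu2 := Tg_tv p2; have Tq := Tg_tv q0; have Tq2 := Tg_tv q20.
have tU := tvU; have Th := grpU gH Hh2.
rewrite E; apply: comm_mod_l => //; rewrite ?(tvU q0) ?(tvU p2) //; first exact: nH.
rewrite E2; apply: comm_mod_r => //; rewrite ?(tvU q0) ?(tvU q20) //.
  by apply: nH => //; apply: (grpV gH).
rewrite comm1 ?(tvU q0) ?(tvU q20) //; first exact: (grp1 gH).
by rewrite !(mulrDl, mulrDr, mul1r, mulr1) !rkM q0 q20 !scale0r !rk0; zmod.
Qed.

Lemma comm_tv_Tg psi w x : pr w psi = 0 -> Tg x -> H (comm (1 + rk psi w) x).
Proof.
move=> p; have uU := tvU p.
elim=> [|psi2 w2 y p2 Ty ih].
  by rewrite comm1 ?unitr1 ?mulr1 ?mul1r //; apply: (grp1 gH).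
rewrite comm_mulr ?(tvU p2) ?(grpU (Tg_grp D n) Ty) //; apply: (grpM gH) => //.
by apply: nH => //; apply: comm_tv_in.
Qed.

(** T is perfect: conjugation by diag(t, t^-1) multiplies the direction by t^2, and [c] solves t^2 c
    - c = 1, so the transvection is a commutator. *)
Lemma normal_contains_tv psi w : pr w psi = 0 -> H (1 + rk psi w).
Proof.
move=> p.
case: (eqVneq w 0) => [->|nzw]; first by rewrite rk0 addr0; apply: (grp1 gH).
case: (eqVneq psi 0) => [->|nzp]; first by rewrite /rk mul0mx addr0; apply: (grp1 gH).
have [v [phi fr]] := ex_frame_wpsi dD nzw nzp p.
have ut := dD t0.
have uc : (t * t - 1) \is a GRing.unit by apply: dD; rewrite subr_eq0.
set c := (t * t - 1)^-1.
have pc a : pr (a *: w) psi = 0 by rewrite prZl p mulr0.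
set h := hh w v phi psi t.
have Th : Tg h by apply: hh_Tg.
have uh := grpU (Tg_grp D n) Th.
suff -> : 1 + rk psi w = comm (1 + rk psi (c *: w)) h by apply: comm_tv_Tg.
have [wf wp vf vp] := fr.
have ctt : c * t = t * c.
  apply: (mulrI uc); apply: (mulIr uc); rewrite /c mulVKr // -!mulrA mulVr // mulr1 mulrBl mulrBr mulr1 mul1r mulrA //.
have E : (1 + rk psi (c *: w)) * h = h * (1 + rk psi ((t * t * c) *: w)).
  apply: act_extV => y; rewrite !actM [in RHS]actD act1 [y *m (1 + _)]actD act1 mulmxDl.
  congr (_ + _); rewrite !act_rk !scalerA -scalemxAl.
  have -> : w *m h = t *: w.
    by rewrite act_hh wf wp mul0r scale0r addr0 mul1r scalerBl scale1r addrC subrK.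
  have -> : pr (y *m h) psi = pr y psi * t^-1.
    by rewrite act_hh !prDl !prZl wp vp mulr0 addr0 mulr1 mulrBr mulr1 addrCA subrr addr0.
  by rewrite scalerA -!mulrA mulKr // ctt.
rewrite /comm tvV // -!mulrA E mulKr // !(mulrDl, mulrDr, mul1r, mulr1, mulNr).
rewrite rkM pc scale0r rk0 oppr0 addr0.
suff -> : (t * t * c) *: w = c *: w + w by rewrite rkD; zmod.
have -> : t * t * c = c + 1.
  by have := mulrV uc; rewrite -/c mulrBl mul1r => <-; zmod.
by rewrite scalerDl scale1r.
Qed.

Lemma normal_contains_Tg x : Tg x -> H x.
Proof.
elim=> [|psi w y p _ ih]; first exact: (grp1 gH).
by apply: (grpM gH) => //; apply: normal_contains_tv.
Qed.
End NormalSubgroup.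

Section SubringPrinciple.
Variable S : L -> Prop.
Hypotheses (hS : subring_over_center S) (nS : normalized_by Tg S).

(** For e = [rk phi v] of square zero, conjugation by 1 + e puts xe - ex - exe into [S]. Replacing e
    by te separates the two degrees, as t and 1 - t are invertible; so exe is in [S]. For a
    non-central x some exe is nonzero of rank one, and frames spread it to all rank one elements. *)
Lemma subring_dichotomy : (forall x, S x -> central x) \/ (forall x, S x).
Proof.
have [|nc] := pselect (forall x, S x -> central x); [by left|right].
have [s Ss ncs] : exists2 s, S s & ~ central s.
  by apply: contrapT => h; apply: nc => x Sx; apply: contrapT => ncx; apply: h; exists x.
have [w [psi [nzw p0 p1]]] := nc_separate ncs.
have nzp : psi != 0 by apply/eqP => z; move/eqP: p1; rewrite z pr0r eq_sym oner_eq0.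
have ctL := scalar_central ct.
have hconj x phi v : S x -> pr v phi = 0 ->
   S (x * rk phi v - rk phi v * x) /\ S (rk phi v * x * rk phi v).
  move=> Sx pv.
  have base v' : pr v' phi = 0 -> S (x * rk phi v' - rk phi v' * x - rk phi v' * x * rk phi v').
    move=> pv'; have := nS (Tg_tv pv') Sx; rewrite tvV // => h.
    have := srB hS h Sx; congr (S _).
    by rewrite !(mulrDl, mulrDr, mulr1, mul1r, mulNr); zmod.
  have tv : t *: v = v *m (t%:M : L) by rewrite act_scalar.
  have E : rk phi (t *: v) = t%:M * rk phi v by rewrite tv -mul_rk -ctL.
  have b1 := base _ pv; have := base (t *: v); rewrite prZl pv mulr0 => /(_ erefl).
  rewrite {}E; set e := rk phi v in b1 *; set T : L := t%:M.
  have cT : central T by [].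
  have -> : x * (T * e) - T * e * x - T * e * x * (T * e) = T * (x * e - e * x - T * (e * x * e)).
    have q1 : x * (T * e) = T * (x * e) by rewrite mulrA -(cT x) mulrA.
    have q2 : T * e * x * (T * e) = T * (T * (e * x * e)).
      by rewrite mulrA -(cT (T * e * x)) !mulrA.
    by rewrite q1 q2 !mulrBr !mulrA.
  move=> b2.
  have uT : T \is a GRing.unit.
    apply: central_unit => //; apply/eqP => /(congr1 (fun y : L => e_ ord0 *m y)).
    rewrite act_scalar // act0 => /(congr1 (fun v : V => v 0 ord0)); rewrite !mxE !eqxx mulr1 => /eqP.
    by rewrite (negbTE t0).
  have cV y : central y -> central y^-1.
    move=> cy z; have [uy|nu] := boolP (y \is a GRing.unit); last by rewrite invr_out.
    by apply: (mulrI uy); apply: (mulIr uy); rewrite mulVKr // -!mulrA mulVr // mulr1 cy.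
  have b3 : S (x * e - e * x - T * (e * x * e)).
    by rewrite -[X in S X](mulKr uT); apply: (srM hS) => //; apply: (srZ hS); apply: cV.
  have b4 := srB hS b3 b1.
  have {b4} b4 : S ((1 - T) * (e * x * e)).
    by move: b4; congr (S _); rewrite mulrBl mul1r; zmod.
  have c1T : central (1 - T) by move=> y; rewrite mulrBl mulrBr mul1r mulr1 cT.
  have u1T : 1 - T \is a GRing.unit.
    apply: central_unit => //; rewrite subr_eq0 eq_sym; apply/eqP.
    move=> /(congr1 (fun y : L => e_ ord0 *m y)).
    rewrite act_scalar // act1 => /(congr1 (fun v : V => v 0 ord0)); rewrite !mxE !eqxx mulr1 => e1.
    by move: t1; rewrite e1 mulr1 eqxx.
  have b5 : S (e * x * e).
    by rewrite -[X in S X](mulKr u1T); apply: (srM hS) => //; apply: (srZ hS); apply: cV.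
  split=> //.
  have := srD hS b1 b5; congr (S _); zmod.
have Se : S (rk psi w).
  have [_] := hconj _ _ _ Ss p0; rewrite mul_rk rkM pr_act.
  by rewrite -pr_act p1 scale1r.
have span1 v phi d : frame w v phi psi -> [/\ S (rk psi (d *: w)), S (rk psi (d *: v)), S (rk phi (d *: w)) & S (rk phi (d *: v))].
  move=> [wf wp vf vp].
  have gen c : S (rk psi (c *: v) - rk phi (c *: w)).
    have [] := hconj _ phi (c *: v) Se; first by rewrite prZl vf mulr0.
    by rewrite !rkM wf prZl vp mulr1 scale1r.
  have w1 c : S (rk psi (c *: w)).
    have := srM hS (gen c) Se.
    by rewrite mulrBl !rkM !prZl vp wp !mulr0 mulr1 scale0r rk0 subr0.
  have fv c : S (rk phi (c *: v)).
    have [_] := hconj _ phi v (w1 c) vf.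
    by rewrite rkM vp scale1r rkM prZl wf mulr1.
  split=> //.
  - have := srM hS (w1 d) (fv 1); rewrite rkM prZl wf mulr1 scale1r //.
  - have := srM hS (fv d) (w1 1); rewrite rkM prZl vp mulr1 scale1r //.
have [v0 [phi0 fr0]] := ex_frame_wpsi dD nzw nzp p0.
have [wf0 _ vf0 vp0] := fr0.
(* A vector of [psi]-value 1 completes [w] to a frame, and every vector is a combination of two such
   vectors, one of them [v0]. *)
have Srow (y : V) d : S (rk psi (d *: y)).
  have good (y' : V) c : pr y' psi = 1 -> S (rk psi (c *: y')).
    move=> yp; pose phi := phi0 - colZ psi (pr y' phi0).
    have fr : frame w y' phi psi.
      by split=> //; rewrite prBr prZr ?p0 ?mul0r ?subr0 // yp mul1r subrr.
    by case: (span1 _ _ c fr).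
  pose b := 1 - pr y psi.
  have -> : rk psi (d *: y) = rk psi (d *: (y + b *: v0)) - rk psi ((d * b) *: v0).
    by rewrite -rkN -rkD scalerDr scalerA addrK.
  apply: (srB hS); apply: good => //.
  by rewrite prDl prZl vp0 mulr1 /b addrC subrK.
have Scol xi d : S (rk xi (d *: w)).
  have good xi' c : pr w xi' = 1 -> S (rk xi' (c *: w)).
    move=> wx; have fr : frame w (v0 - pr v0 xi' *: w) xi' psi.
      split=> //; first by rewrite prBl prZl wx mulr1 subrr.
      by rewrite prBl prZl p0 mulr0 subr0.
    by case: (span1 _ _ c fr).
  pose b := 1 - pr w xi.
  have -> : rk xi (d *: w) = rk (xi + colZ phi0 b) (d *: w) - rk phi0 ((b * d) *: w).
    by rewrite rkDc -rkZ scalerA addrK.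
  apply: (srB hS); apply: good => //.
  by rewrite prDr prZr wf0 mul1r /b addrC subrK.
have Sv xi : S (rk xi v0).
  have := srM hS (Scol xi 1) (_ : S (rk phi0 v0)).
  rewrite scale1r rkM wf0 scale1r; apply.
  by have [_ _ _ h] := span1 _ _ 1 fr0; rewrite scale1r in h.
have Sall xi (y : V) : S (rk xi y).
  have := srM hS (Sv xi) (Srow y 1); rewrite scale1r rkM vp0 scale1r //.
move=> x; have -> : x = \sum_i rk (c_ D i) (e_ i *m x).
  apply: act_ext => j; rewrite act_sum (bigD1 j) //= act_rk e_c eqxx scale1r big1 ?addr0 // => i ne.
  by rewrite act_rk e_c eq_sym (negbTE ne) scale0r.
by apply: (sr_sum hS) => i _; apply: Sall.
Qed.
End SubringPrinciple.
End Iwasawa.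

(** * Solvability, and Hua's theorem for division rings *)

Section Derived.
Variable R : unitRingType.
Implicit Types (x y a b : R) (H K S X : R -> Prop).

Definition ggen S x := forall K, grp K -> (forall y, S y -> K y) -> K x.

Fixpoint der k H : R -> Prop :=
  if k is j.+1 then ggen (fun x => exists a b, [/\ der j H a, der j H b & x = comm a b]) else H.

Lemma units_grp : grp (fun x : R => x \is a GRing.unit).
Proof. by split=> // [|x y ux uy|x ux]; rewrite ?unitr1 ?unitrV // unitrMl. Qed.

Lemma comm_unit a b : a \is a GRing.unit -> b \is a GRing.unit -> comm a b \is a GRing.unit.
Proof. by move=> ua ub; rewrite /comm !(unitrMl, unitrV). Qed.

Lemma ggen_grp S : (forall x, S x -> x \is a GRing.unit) -> grp (ggen S).
Proof.
move=> uS; split.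
- by move=> x /(_ _ units_grp uS).
- by move=> K gK _; apply: (grp1 gK).
- by move=> x y hx hy K gK SK; apply: (grpM gK); [apply: hx|apply: hy].
- by move=> x hx K gK SK; apply: (grpV gK); apply: hx.
Qed.

Lemma der_grp k H : grp H -> grp (der k H).
Proof.
move=> gH; elim: k => //= k IH; apply: ggen_grp => x [a [b [ha hb ->]]].
by apply: comm_unit; apply: (grpU IH).
Qed.

Lemma der_comm k H a b : der k H a -> der k H b -> der k.+1 H (comm a b).
Proof. by move=> ha hb K gK SK; apply: SK; exists a, b. Qed.

Lemma der_mono k H H' : (forall x, H x -> H' x) -> forall x, der k H x -> der k H' x.
Proof.
move=> sub; elim: k => //= k IH x hx K gK SK; apply: hx => // y [a [b [ha hb ->]]].
by apply: SK; exists a, b; split=> //; apply: IH.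
Qed.

Lemma der_sub k H : grp H -> forall x, der k H x -> H x.
Proof.
move=> gH; elim: k => //= k IH x hx; apply: hx => // y [a [b [/IH ha /IH hb ->]]].
by rewrite /comm; do !apply: (grpM gH) => //; apply: (grpV gH).
Qed.

Lemma der_shift k H H' : grp H -> (forall a b, H' a -> H' b -> H (comm a b)) ->
  forall x, der k.+1 H' x -> der k H x.
Proof.
move=> gH hc; elim: k => [|k IH] x hx.
  by apply: hx => // y [a [b [ha hb ->]]]; apply: hc.
move=> K gK SK; apply: hx => // y [a [b [ha hb ->]]]; apply: SK.
by exists a, b; split=> //; apply: IH.
Qed.

Lemma conj_grp K x : grp K -> x \is a GRing.unit -> grp (fun z => K (x^-1 * z * x)).
Proof.
move=> gK ux; split.
- by move=> z /(grpU gK); rewrite unitrMl // unitrMr // unitrV.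
- by rewrite mulr1 mulVr //; apply: (grp1 gK).
- move=> y z Ky Kz; have := grpM gK Ky Kz; by rewrite !mulrA mulrK.
- move=> z Kz; have uz : z \is a GRing.unit.
    by move: (grpU gK Kz); rewrite unitrMl // unitrMr // unitrV.
  by have := grpV gK Kz; rewrite !invrM ?invrK ?unitrV ?unitrMl ?unitrV // mulrA.
Qed.

Lemma conj_comm x a b : x \is a GRing.unit -> a \is a GRing.unit -> b \is a GRing.unit ->
  x^-1 * comm a b * x = comm (x^-1 * a * x) (x^-1 * b * x).
Proof.
move=> ux ua ub; rewrite /comm !invrM ?invrK ?unitrMl ?unitrV //.
by rewrite !mulrA !mulrK.
Qed.

Lemma der_norm k H X : grp H -> (forall x, X x -> x \is a GRing.unit) ->
  normalized_by X H -> normalized_by X (der k H).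
Proof.
move=> gH uX nX; elim: k => //= k IH x y Xx hy K gK SK.
have ux := uX _ Xx.
apply: (hy (fun z => K (x^-1 * z * x))); first exact: conj_grp.
move=> z [a [b [ha hb ->]]]; apply: SK.
have gD := der_grp k gH.
rewrite conj_comm ?(grpU gD ha) ?(grpU gD hb) //.
by exists (x^-1 * a * x), (x^-1 * b * x); split=> //; apply: IH.
Qed.

Definition solvable_in M := exists k, forall x, der k M x -> x = 1.

(** [N'] is the last term of the derived series of [N] that is not inside [A]. *)
Lemma solvable_abelian_section M N A : solvable_in M -> grp N -> (forall x, N x -> M x) ->
  (forall x, M x -> x \is a GRing.unit) ->
  normalized_by M N -> A 1 -> ~ (forall x, N x -> A x) ->
  exists N', [/\ grp N', forall x, N' x -> N x, normalized_by M N', ~ (forall x, N' x -> A x) &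
    forall x y, N' x -> N' y -> A (comm x y)].
Proof.
move=> [K hK] gN sub uM nN A1 nNA.
have ex : exists k, `[< forall x, der k N x -> A x >].
  by exists K; apply/asboolP => x /(der_mono sub) /hK ->.
case: (ex_minnP ex) => [[|k] /asboolP hk mink]; first by case: nNA.
exists (der k N); split.
- exact: der_grp.
- exact: der_sub.
- exact: der_norm.
- by move=> h; have := mink k; rewrite ltnn => /(_ (asboolT h)).
- by move=> x y hx hy; apply: hk; apply: der_comm.
Qed.
End Derived.

Section Hua.
Variable R : unitRingType.
Variable Q : R -> Prop.
Hypothesis hQ : division_subring Q.
Variable t : R.
Hypotheses (Qt : Q t) (ct : forall q, Q q -> t * q = q * t) (t0 : t != 0) (t1 : t * t != 1).
Variable N : nat -> R -> Prop.
Hypothesis N_all : forall x, Q x -> x != 0 -> N 0 x.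
Hypothesis N_sub : forall k x, N k x -> Q x.
Hypothesis N_grp : forall k, grp (N k).
Hypothesis N_norm : forall k, normalized_by (fun q => Q q /\ q != 0) (N k).
Hypothesis N_comm : forall k x y, N k x -> N k y -> N k.+1 (comm x y).
Variable K : nat.
Hypothesis N_last : forall x, N K x -> forall q, Q q -> x * q = q * x.

Local Notation C := (fun x => forall q, Q q -> x * q = q * x).

(** The last non-central term of the series has central commutators, and is shown not to exist. The
    series [N] is abstract because it is used both for derived groups of a division ring and for the
    scalars that derived groups of [M] induce on a vector. *)
Lemma division_solvable_comm x y : Q x -> Q y -> x * y = y * x.
Proof.
move=> Qx Qy; apply: contrapT => nxy.
have ex : exists k, `[< forall x, N k x -> C x >] by exists K; apply/asboolP.
case: (ex_minnP ex) => [[|k] /asboolP hk mink].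
  have x0 : x != 0 by apply/eqP => e; apply: nxy; rewrite e mul0r mulr0.
  by apply: nxy; apply: hk => //; apply: N_all.
have {mink} [a Na nCa] : exists2 a, N k a & ~ C a.
  apply: contrapT => h; suff /mink : `[< forall x, N k x -> C x >] by rewrite ltnn.
  apply/asboolP => z Nz.
  by apply: contrapT => nCz; apply: h; exists z.
have comC u v : N k u -> N k v -> C (comm u v) by move=> ? ?; apply: hk; apply: N_comm.
have NU u : N k u -> u \is a GRing.unit by apply: (grpU (N_grp k)).
have uQ u : Q u -> u != 0 -> u \is a GRing.unit by apply: dsU.
(* If the term is abelian, the conjugates b and c of a by z and 1 + z satisfy z (c - b) = a - c; so
   z commutes with a, also when c = b. *)
have [ab|nab] := pselect (forall u v, N k u -> N k v -> u * v = v * u).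
  apply: nCa => z Qz; apply: contrapT => naz.
  have Qa := N_sub Na.
  have z0 : z != 0 by apply/eqP => e; apply: naz; rewrite e mul0r mulr0.
  have z1 : 1 + z != 0.
    by apply/eqP => /addr0_eq e; apply: naz; rewrite -e mulrN mulNr mulr1 mul1r.
  have Q1z : Q (1 + z) by apply: dsD => //; apply: ds1.
  have [uz u1z] := (uQ _ Qz z0, uQ _ Q1z z1).
  set b := z^-1 * a * z; set c := (1 + z)^-1 * a * (1 + z).
  have Nb : N k b by apply: N_norm.
  have Nc : N k c by apply: N_norm.
  have zb : z * b = a * z by rewrite /b !mulrA mulrV // mul1r.
  have zc : (1 + z) * c = a * (1 + z) by rewrite /c !mulrA mulrV // mul1r.
  have E : z * (c - b) = a - c.
    have := zc; rewrite mulrDl mulrDr mul1r mulr1 -zb mulrBr => e.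
    apply/eqP; rewrite subr_eq.
    have -> : a - c + z * b = a + z * b - c by zmod.
    by rewrite -e; apply/eqP; zmod.
  case: (eqVneq c b) => [ecb|ncb].
    by move: E; rewrite ecb subrr mulr0 => /esym/subr0_eq e; apply: naz; rewrite -zb -e.
  have ucb : c - b \is a GRing.unit.
    by apply: uQ; [apply: (dsB hQ); apply: N_sub; eassumption|rewrite subr_eq0].
  apply: naz; apply: (mulIr ucb).
  rewrite -[a * z * _]mulrA E mulrBr (ab a c) // -mulrBl -E.
  by rewrite -!mulrA; congr (_ * _); rewrite mulrBl mulrBr !(ab a).
have {nab} [a' [g [Na' Ng nag]]] : exists a g, [/\ N k a, N k g & a * g <> g * a].
  apply: contrapT => h; apply: nab => u v Nu Nv; apply: contrapT => huv.
  by apply: h; exists u, v.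
move: a' Na' nag => {a Na nCa} a Na nag.
have [ua ug] := (NU _ Na, NU _ Ng).
have [Qa Qg] := (N_sub Na, N_sub Ng).
set la := comm a g.
have Cla : C la by apply: comC.
have Ela : a * g = g * a * la by apply: commE.
have Qla : Q la.
  by apply: (@N_sub k.+1); apply: N_comm.
have la1 : la <> 1 by move=> e; apply: nag; rewrite Ela e mulr1.
clearbody la.
have CM p q : C p -> C q -> C (p * q).
  by move=> Cp Cq z Qz; rewrite -mulrA Cq // mulrA Cp // -mulrA.
have CD p q : C p -> C q -> C (p + q).
  by move=> Cp Cq z Qz; rewrite mulrDl mulrDr Cp // Cq.
have CN p : C p -> C (- p) by move=> Cp z Qz; rewrite mulNr mulrN Cp.
have C1 : C 1 by move=> z _; rewrite mulr1 mul1r.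
have CV p : C p -> p \is a GRing.unit -> C p^-1.
  by move=> Cp up z Qz; apply: (mulrI up); apply: (mulIr up); rewrite mulVKr // -!mulrA mulVr // mulr1 Cp.
(* For central s the commutator y1 of s + a with g lies in [N k], so ze = [y1, g] is central.
   Conjugating (s + a) y1 = s + a la by g gives a quadratic equation for a over the center. *)
have key s : Q s -> C s -> s != 0 -> exists2 e, C e & a * a * (la * la) = - (s * s) + s * e * a.
  move=> Qs Cs s0.
  have us := uQ _ Qs s0.
  have sa0 : s + a != 0.
    by apply/eqP => e; apply: nag; rewrite -[a](addKr s) e addr0 mulNr mulrN Cs.
  have Qsa : Q (s + a) by apply: dsD.
  set u := s + a in sa0 Qsa; have uu := uQ _ Qsa sa0.
  set y1 := comm u g.
  have Ny : N k y1.
    by rewrite /y1 /comm; apply: (grpM (N_grp k)) => //; apply: N_norm => //; apply: (grpV (N_grp k)).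
  have uy : u * y1 = s + a * la.
    rewrite /y1 /comm !mulrA mulrV // mul1r mulrDr mulrDl -(Cs g^-1) ?mulrVK //; last exact: (dsV hQ).
    by rewrite -[g^-1 * a * g]mulrA Ela -[g * a * la]mulrA mulKr.
  have [uuy Qy1] := (NU _ Ny, N_sub Ny).
  set ze := comm y1 g.
  have Cze : C ze by apply: comC.
  have Qze : Q ze by apply: (@N_sub k.+1); apply: N_comm.
  have Eze : y1 * g = g * y1 * ze by apply: commE.
  clearbody ze y1.
  have cola : u * a = a * u by rewrite mulrDl mulrDr Cs.
  have Eu : u = s + a by [].
  clearbody u.
  have usla : u * (s + a * la) = (s + a * la) * u.
    rewrite mulrDr mulrDl (Cs u) //; congr (_ + _).
    by rewrite mulrA cola -!mulrA (Cla u).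
  have ga : g^-1 * a * g = a * la by rewrite -mulrA Ela -mulrA mulKr.
  have gs p : C p -> g^-1 * p * g = p by move=> Cp; rewrite -mulrA Cp // mulKr.
  have gy : g^-1 * y1 * g = y1 * ze by rewrite -mulrA Eze -mulrA mulKr.
  have gM p z : g^-1 * (p * z) * g = (g^-1 * p * g) * (g^-1 * z * g).
    by rewrite !mulrA mulrK.
  have gD p z : g^-1 * (p + z) * g = g^-1 * p * g + g^-1 * z * g.
    by rewrite mulrDr mulrDl.
  have E1 : (s + a * la) * (y1 * ze) = s + a * (la * la).
    have gu : g^-1 * u * g = s + a * la by rewrite Eu gD ga gs.
    have gw : g^-1 * (s + a * la) * g = s + a * (la * la) by rewrite gD gM ga !gs // mulrA.
    by rewrite -gw -[in RHS]uy gM gu gy.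
  have E2 : (s + a * la) * (s + a * la) * ze = u * (s + a * (la * la)).
    by rewrite -E1 mulrA usla -{2}uy !mulrA.
  have r1 : la * a = a * la by apply: Cla.
  have r2 : s * a = a * s by apply: Cs.
  have r3 : ze * a = a * ze by apply: Cze.
  have r4 : la * s = s * la by apply: Cla.
  have r5 : ze * s = s * ze by apply: Cze.
  have r6 : ze * la = la * ze by apply: Cze.
  have r1' p : p * la * a = p * a * la by rewrite -mulrA r1 mulrA.
  have r2' p : p * s * a = p * a * s by rewrite -mulrA r2 mulrA.
  have r3' p : p * ze * a = p * a * ze by rewrite -mulrA r3 mulrA.
  have r4' p : p * la * s = p * s * la by rewrite -mulrA r4 mulrA.
  have r5' p : p * ze * s = p * s * ze by rewrite -mulrA r5 mulrA.
  have r6' p : p * ze * la = p * la * ze by rewrite -mulrA r6 mulrA.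
  pose rr := (r1', r2', r3', r4', r5', r6', r1, r2, r3, r4, r5, r6).
  pose m := 1 + la * la - la * ze - la * ze.
  have E3 : a * a * (la * la) * (ze - 1) = - (s * s) * (ze - 1) + s * m * a.
    apply: subr0_eq; rewrite -(subrr (u * (s + a * (la * la)))) -[in RHS]E2 E2.
    transitivity ((s + a * la) * (s + a * la) * ze - u * (s + a * (la * la))); last by rewrite E2.
    rewrite Eu /m !(mulrDl, mulrDr, mulNr, mulrN, mulr1, mul1r, mulrA, opprK).
    by rewrite !rr; zmod.
  have ze1 : ze - 1 != 0.
    rewrite subr_eq0; apply/eqP => z1.
    have sm : s * m * a = 0 by rewrite -[RHS](mulr0 (a * a * (la * la))) -[in RHS](subrr 1) -{1}z1 E3 z1 subrr mulr0 add0r.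
    have m0 : m = 0.
      by apply: (mulrI us); apply: (mulIr ua); rewrite mulr0 mul0r.
    have m0' : (la - 1) * (la - 1) = 0.
      by rewrite -m0 /m z1 !mulr1; ncring.
    apply: la1; apply: subr0_eq; apply/eqP; apply: contrapT => /negP nz.
    have ul := uQ _ (dsB hQ Qla (ds1 hQ)) nz.
    by move/eqP: nz; apply; apply: (mulrI ul); rewrite m0' mulr0.
  have uz1 := uQ _ (dsB hQ Qze (ds1 hQ)) ze1.
  have Cz1 : C (ze - 1) by apply: (CD) => //; apply: (CN).
  exists (m * (ze - 1)^-1).
    apply: (CM); last by apply: (CV).
    by rewrite /m; do !(apply: (CD) || apply: (CN) || apply: (CM)).
  apply: (mulIr uz1); rewrite E3 mulrDl; congr (_ + _).
  by rewrite -!mulrA -(Cz1 a) // [(ze - 1)^-1 * _]mulrA mulVr // mul1r.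
(* The equations for s = 1 and s = t have the same left side; their difference is linear in a with
   constant term t^2 - 1, so a is central. *)
have [e1 Ce1 E1] := key 1 (ds1 hQ) C1 (oner_neq0 R).
have [et Cet Et] := key t Qt ct t0.
have E : (t * et - e1) * a = t * t - 1.
  have := E1; rewrite Et => /eqP; rewrite -subr_eq0 => /eqP.
  rewrite !mul1r => E; apply: subr0_eq; rewrite -[RHS]E; ncring.
have tt : t * t - 1 != 0 by rewrite subr_eq0.
have Qtt : Q (t * t - 1) by apply: (dsB hQ); [apply: (dsM hQ)|apply: (ds1 hQ)].
have utt := uQ _ Qtt tt.
have Cf : C (t * et - e1) by apply: (CD); [apply: (CM)|apply: (CN)].
have Ctt : C (t * t - 1) by apply: (CD); [apply: (CM)|apply: (CN)].
apply: nag.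
have uf : (t * et - e1) \is a GRing.unit.
  have := utt; rewrite -E unitrMl //.
by apply: (mulrI uf); rewrite [LHS]mulrA E Ctt // -E mulrA -Cf // mulrA.
Qed.
End Hua.

(** * Consequences of maximality *)

Section Maximal.
Variables (D : unitRingType) (n : nat).
Hypothesis dD : forall x : D, x != 0 -> x \is a GRing.unit.
Local Notation N := n.+2.
Local Notation L := (clu 'M[D]_N).
Local Notation V := 'rV[D]_N.
Local Notation C := 'cV[D]_N.
Implicit Types (u v w : V) (x y z g : L) (W : V -> Prop) (phi psi : C).
Local Notation e_ := (@e_ D n).
Local Notation Tg := (@Tg D n).

Lemma hhV w v phi psi a : frame w v phi psi -> a \is a GRing.unit ->
  hh w v phi psi a * hh w v phi psi a^-1 = 1.
Proof.
move=> [wf wp vf vp] ua; apply: act_extV => u; rewrite act1 actM act_hh.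
set al := pr u phi; set be := pr u psi.
have p1 : pr (u *m hh w v phi psi a) phi = al * a.
  by rewrite act_hh !prDl !prZl wf vf mulr0 addr0 mulr1 mulrBr mulr1 -/al addrC subrK.
have p2 : pr (u *m hh w v phi psi a) psi = be * a^-1.
  by rewrite act_hh !prDl !prZl wp vp mulr0 addr0 mulr1 mulrBr mulr1 -/be addrC subrK.
rewrite p1 p2 act_hh -/al -/be invrK !mulrBr !mulr1 mulrK // mulrVK //.
by rewrite !scalerBl; zmod.
Qed.

Lemma hh_inv w v phi psi a : frame w v phi psi -> a \is a GRing.unit ->
  (hh w v phi psi a)^-1 = hh w v phi psi a^-1.
Proof.
move=> fr ua; have uh := grpU (Tg_grp D n) (hh_Tg fr ua).
by apply: (mulrI uh); rewrite mulrV // hhV.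
Qed.

Lemma hh_w w v phi psi a : frame w v phi psi -> w *m hh w v phi psi a = a *: w.
Proof.
by move=> [wf wp _ _]; rewrite act_hh wf wp mul0r scale0r addr0 mul1r scalerBl scale1r addrC subrK.
Qed.

Variable t : D.
Hypotheses (ct : forall d, t * d = d * t) (t0 : t != 0) (t1 : t * t != 1).
Hypothesis ncD : exists a b : D, a * b <> b * a.
Variables G M : L -> Prop.
Hypotheses (gG : grp G) (TG : forall x, Tg x -> G x) (gM : grp M) (MG : forall x, M x -> G x).
Hypothesis maxM : forall H : L -> Prop, grp H -> (forall x, M x -> H x) -> (forall x, H x -> G x) ->
  (forall x, H x -> M x) \/ (forall x, G x -> H x).
Hypothesis solM : solvable_in M.

Lemma comm_G x y : x \is a GRing.unit -> y \is a GRing.unit -> G (comm x y).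
Proof. by move=> ux uy; apply: TG; apply: comm_GL_Tg. Qed.

Lemma grp_norm_self (R : unitRingType) (H : R -> Prop) : grp H -> normalized_by H H.
Proof.
by move=> gH x y Hx Hy; apply: (grpM gH) => //; apply: (grpM gH) => //; apply: (grpV gH).
Qed.

(** The scalars by which the k-th derived group of [M] acts on multiples of [w] form a series in the
    units of D. It ends in 1, so Hua's theorem would make D commutative. *)
Lemma no_dilation w : w != 0 -> (forall a, a != 0 -> exists2 g, M g & w *m g = a *: w) -> False.
Proof.
move=> nz h; have [a [b nab]] := ncD; apply: nab.
have [K hK] := solM.
pose Nk k (a : D) := a != 0 /\ exists2 g, der k M g & w *m g = a *: w.
have inv (g : L) c : c != 0 -> g \is a GRing.unit -> w *m g = c *: w -> w *m g^-1 = c^-1 *: w.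
  move=> c0 ug e; have : w *m g *m g^-1 = w by rewrite -actM mulrV // act1.
  by rewrite e -scalemxAl => e'; rewrite -{2}e' scalerA mulVr ?scale1r // dD.
apply: (@division_solvable_comm D (fun=> True) _ t I _ t0 t1 Nk _ _ _ _ _ K) => //.
- exact: dsD_full.
- by move=> c _ c0; split=> //; have [g Mg e] := h c c0; exists g.
- move=> k; have gk := der_grp k gM; split.
  + by move=> c [c0 _]; apply: dD.
  + by split; [apply: oner_neq0|exists 1; [apply: (grp1 gk)|rewrite act1 scale1r]].
  + move=> c d [c0 [g hg ec]] [d0 [g' hg' ed]]; split.
      by apply/eqP => z; have := dD c0; rewrite -(unitrMl _ (dD d0)) z unitr0.
    by exists (g * g'); [apply: (grpM gk)|rewrite actM ec -scalemxAl ed scalerA].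
  + move=> c [c0 [g hg ec]]; split; first by rewrite invr_eq0.
    by exists g^-1; [apply: (grpV gk)|apply: inv => //; apply: (grpU gk)].
- move=> k q c [_ q0] [c0 [g hg ec]].
  have [m Mm em] := h q q0.
  have um := grpU gM Mm.
  split.
    apply/eqP => z; have := dD c0; have uq := dD q0.
    by rewrite -(unitrMl _ uq) -(unitrMr _ (_ : q^-1 \is a GRing.unit)) ?unitrV // mulrA z unitr0.
  exists (m^-1 * g * m).
    by apply: (der_norm gM (grpU gM) (grp_norm_self gM)).
  by rewrite !actM (inv m q) // -scalemxAl ec scalerA -scalemxAl em scalerA.
- move=> k c d [c0 [g hg ec]] [d0 [g' hg' ed]].
  have gk := der_grp k gM.
  split.
    by apply/eqP => z; have := comm_unit (dD c0) (dD d0); rewrite z unitr0.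
  exists (comm g g'); first exact: der_comm.
  rewrite /comm !actM (inv g c) ?(grpU gk) // -!scalemxAl (inv g' d) ?(grpU gk) //.
  by rewrite -!scalemxAl ec -!scalemxAl ed !scalerA.
- move=> c [c0 [g /hK -> ]]; rewrite act1 => e q _.
  suff -> : c = 1 by rewrite mul1r mulr1.
  have [psi hp] := ex_dual dD nz.
  by have := prZl c w psi; rewrite -e hp mulr1.
Qed.

(* Maximality is applied to the normaliser of S in G: it equals M, and contains the units of S in G, or it equals G, and then T normalises S. *)
Lemma subring_trichotomy (S : L -> Prop) : subring_over_center S -> normalized_by M S ->
  [\/ forall x, S x -> central x, forall x, S x | forall x, S x -> S x^-1 -> G x -> M x].
Proof.
move=> hS nS.
pose H x := [/\ G x, forall s, S s -> S (x^-1 * s * x) & forall s, S s -> S (x * s * x^-1)].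
have gH : grp H.
  split.
  - by move=> x [/(grpU gG)].
  - by split; [apply: (grp1 gG)|move=> s; rewrite invr1 mulr1 mul1r|move=> s; rewrite invr1 mulr1 mul1r].
  - move=> x y [Gx hx hx'] [Gy hy hy'].
    have [ux uy] := (grpU gG Gx, grpU gG Gy).
    split; first exact: (grpM gG).
      by move=> s Ss; have := hy _ (hx _ Ss); rewrite invrM // !mulrA.
    by move=> s Ss; have := hx' _ (hy' _ Ss); rewrite invrM // !mulrA.
  - by move=> x [Gx hx hx']; split; rewrite ?invrK //; apply: (grpV gG).
have MH x : M x -> H x.
  move=> Mx; split; [exact: MG|by move=> s Ss; apply: nS|].
  by move=> s Ss; apply: (grp_conjV gM nS).
case: (maxM gH MH) => [x []//|HM|GH].
  apply: Or33 => x Sx SV Gx; apply: HM; split=> // s Ss.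
    by apply: (srM hS) => //; apply: (srM hS).
  by apply: (srM hS) => //; apply: (srM hS).
have nT : normalized_by Tg S.
  by move=> x s Tx Ss; have [_ + _] := GH _ (TG Tx); apply.
by have [h|h] := subring_dichotomy dD ct t0 t1 hS nT; [apply: Or31|apply: Or32].
Qed.

(** The stabiliser of [W] in [G] contains [M]. It is not [G], as a transvection leads out of a
    proper [W]; so it is inside [M]. But it contains all diag(a, a^-1) for a frame with [w] in [W],
    against [no_dilation]. *)
Lemma irreducible W : subsp W -> (forall v g, W v -> M g -> W (v *m g)) ->
  (exists2 v, W v & v != 0) -> forall v, W v.
Proof.
move=> sW sM [w Ww nzw] y; apply: contrapT => nWy.
have [W0 WD WZ] := sW.
pose H x := [/\ G x, forall v, W v -> W (v *m x) & forall v, W v -> W (v *m x^-1)].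
have gH : grp H.
  split.
  - by move=> x [/(grpU gG)].
  - by split; [apply: (grp1 gG)|move=> v; rewrite act1|move=> v; rewrite invr1 act1].
  - move=> x z [Gx hx hx'] [Gz hz hz'].
    have [ux uz] := (grpU gG Gx, grpU gG Gz).
    split; first exact: (grpM gG).
      by move=> v /hx/hz; rewrite actM.
    by move=> v /hz'/hx'; rewrite invrM // actM.
  - by move=> x [Gx hx hx']; split; rewrite ?invrK //; apply: (grpV gG).
have MH x : M x -> H x.
  move=> Mx; split; [exact: MG|by move=> v Wv; apply: sM|].
  by move=> v Wv; apply: sM => //; apply: (grpV gM).
case: (maxM gH MH) => [x []//|HM|GH]; last first.
  have ny a : y != a *: w by apply/eqP => e; apply: nWy; rewrite e; apply: WZ.
  have [phi [psi [wf wp yf yp]]] := ex_frame dD nzw ny.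
  have [_ h _] := GH _ (TG (Tg_tv yf)).
  have := h _ Ww; rewrite actD act1 act_rk wf scale1r => /(subspB sW) /(_ Ww).
  by rewrite addrC addKr.
suff [v [phi [psi [fr st]]]] : exists v phi psi, frame w v phi psi /\
    forall a u, W u -> W (u *m hh w v phi psi a).
  apply: (no_dilation nzw) => a a0; exists (hh w v phi psi a); last exact: hh_w.
  apply: HM; split; [by apply: TG; apply: hh_Tg => //; apply: dD|by move=> u; apply: st|].
  by move=> u; rewrite (hh_inv fr (dD a0)); apply: st.
(* The second vector of the frame is taken in [W] if possible; if [W] is the line of [w], any frame
   at [w] preserves it. *)
have [[v Wv indv]|nv] := pselect (exists2 v, W v & forall a, v != a *: w).
  have [phi [psi fr]] := ex_frame dD nzw indv.
  exists v, phi, psi; split=> // a u Wu; rewrite act_hh.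
  by apply: (WD); [apply: (WD) => //; apply: (WZ)|apply: (WZ)].
have [v [phi [psi fr]]] := ex_frame_w dD nzw.
exists v, phi, psi; split=> // a u Wu.
have [c ->] : exists c, u = c *: w.
  apply: contrapT => h; apply: nv; exists u => // c; apply/eqP => e.
  by apply: h; exists c.
by rewrite -scalemxAl hh_w // scalerA; apply: WZ.
Qed.

(** Common multiples make the vectors killed by some nonzero element of [S] a subspace, stable under
    [M]. If it were everything, a common multiple of annihilators of the basis vectors would be a
    nonzero element acting as 0. *)
Lemma ore_units (S : L -> Prop) : S 1 -> (forall x y, S x -> S y -> S (x * y)) ->
  normalized_by M S ->
  (forall x y, S x -> S y -> x != 0 -> y != 0 ->
     exists x' y', [/\ S x', S y', x * x' = y * y' & x * x' != 0]) ->
  forall x, S x -> x != 0 -> x \is a GRing.unit.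
Proof.
move=> S1 SM nS ore s0 Ss0 nz0.
pose W v := exists s, [/\ S s, s != 0 & v *m s = 0].
have W0 : W 0 by exists 1; split; [|apply: oner_neq0|rewrite mul0mx].
have sW : subsp W.
  split=> // [v v' [s [Ss nz e]] [s' [Ss' nz' e']]|a v [s [Ss nz e]]]; last first.
    by exists s; split=> //; rewrite -scalemxAl e scaler0.
  have [z [z' [Sz Sz' ez nzz]]] := ore _ _ Ss Ss' nz nz'.
  exists (s * z); split=> //; first exact: SM.
  by rewrite mulmxDl [in X in _ + X]ez !actM e e' !mul0mx addr0.
have WM v g : W v -> M g -> W (v *m g).
  move=> [s [Ss nz e]] Mg; have ug := grpU gM Mg.
  exists (g^-1 * s * g); split; first exact: nS.
    apply: contra nz => /eqP z; apply/eqP.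
    have : g * (g^-1 * s * g) * g^-1 = 0 by rewrite z mulr0 mul0r.
    by rewrite !mulrA mulrV // mul1r mulrK.
  by rewrite -actM !mulrA mulrV // mul1r actM e mul0mx.
have [[v Wv nzv]|nW] := pselect (exists2 v, W v & v != 0); last first.
  apply: (unit_of_ker dD) => v e; apply: contrapT => nzv; apply: nW.
  by exists v; [exists s0|apply/eqP].
have all := irreducible sW WM (ex_intro2 _ _ v Wv nzv).
have ex k : (k <= N)%N -> exists z, [/\ S z, z != 0 & forall i : 'I_N, (i < k)%N -> e_ i *m z = 0].
  elim: k => [_|k IH lek].
    by exists 1; split=> //; apply: oner_neq0.
  have [z [Sz nzz ez]] := IH (ltnW lek).
  have [s [Ss nzs es]] := all (e_ (Ordinal lek)).
  have [x' [y' [Sx' Sy' e nzx]]] := ore _ _ Ss Sz nzs nzz.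
  exists (s * x'); split=> //; first exact: SM.
  move=> i; rewrite ltnS leq_eqVlt => /orP[/eqP ei|lt].
    by rewrite (_ : i = Ordinal lek) ?actM ?es ?mul0mx //; apply: val_inj.
  by rewrite e actM ez // mul0mx.
have [z [_ nzz ez]] := ex _ (leqnn _).
by case/eqP: nzz; apply: act_ext => i; rewrite ez // act0.
Qed.

(** [e] projects onto the image of a high power of x along its kernel. The clause on commuting
    elements is what puts [e] into [KA] when x is there. *)
Lemma fitting x : exists e, [/\ e * e = e, forall c, c * x = x * c -> c * e = e * c,
  e = 0 -> exists k, x ^+ k = 0 & e = 1 -> x \is a GRing.unit].
Proof.
pose im k v := exists u, v = u *m (x ^+ k : L).
pose ke k v := v *m (x ^+ k : L) = 0.
have sim k : subsp (im k).
  split; first by exists 0; rewrite mul0mx.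
    by move=> _ _ [u ->] [u' ->]; exists (u + u'); rewrite mulmxDl.
  by move=> a _ [u ->]; exists (a *: u); rewrite scalemxAl.
have ske k : subsp (ke k).
  split; rewrite /ke; first by rewrite mul0mx.
    by move=> u v e e'; rewrite mulmxDl e e' addr0.
  by move=> a v e; rewrite -scalemxAl e scaler0.
have [_ [k1 ->] min1] := @subspace_dcc D n dD (fun W => exists k, W = im k) (im 0) (ex_intro _ 0%N erefl)
   (fun W h => let: ex_intro k e := h in eq_ind_r (@subsp D n) (sim k) e).
have [_ [k0 ->] max0] := @subspace_acc D n dD (fun W => exists k, W = ke k) (ke 0) (ex_intro _ 0%N erefl)
   (fun W h => let: ex_intro k e := h in eq_ind_r (@subsp D n) (ske k) e).
have him v j : (k1 <= j)%N -> im k1 v -> im j v.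
  move=> lej; apply: min1; first by exists j.
  by move=> _ [u ->]; exists (u *m (x ^+ (j - k1) : L)); rewrite -actM -exprD subnK.
have hke v j : (k0 <= j)%N -> ke j v -> ke k0 v.
  move=> lej; apply: max0; first by exists j.
  by move=> u e; rewrite /ke -(subnKC lej) exprD actM e mul0mx.
(* The successor makes k positive, so that invertibility of x^k passes to x. *)
pose k := (k0 + k1).+1; pose a : L := x ^+ k.
have /choice[f hf] : forall i, exists u, e_ i *m a = u *m (a * a).
  move=> i; have [||u hu] := @him (e_ i *m a) (k + k)%N.
  - by rewrite /k; apply: leq_trans (leq_addl _ _); rewrite leqW // leq_addl.
  - exists (e_ i *m (x ^+ k0.+1 : L)); rewrite -actM -exprD addSn //.
  - by exists u; rewrite hu -exprD.
pose y := rows_mx f.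
have ay : a = y * (a * a).
  by apply: act_ext => i; rewrite actM rows_mxE hf.
have kera v : v *m (a * a) = 0 -> v *m a = 0.
  rewrite -exprD => /hke h; rewrite /a /k -addnS exprD actM.
  have -> : v *m (x ^+ k0 : L) = 0.
    by apply: h; apply: leq_trans (leq_addr _ _); rewrite leqW // leq_addr.
  by rewrite mul0mx.
have kerL z : z * (a * a) = 0 -> z * a = 0.
  move=> e; apply: act_ext => i; rewrite actM kera ?act0 // -actM e act0 //.
pose e := y * a.
have ea : e * a = a by rewrite /e -mulrA -ay.
(* Image and kernel of [a] meet in 0, so an identity between left multiples of [a] may be checked
   after one more multiplication by [a]. *)
have zero z z' : z = z' * a -> z * a = 0 -> z = 0.
  by move=> -> ; rewrite -mulrA => /kerL.
exists e; split.
- apply: subr0_eq; apply: (zero _ (y * a * y - y)).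
    by rewrite mulrBl /e !mulrA.
  have eea : e * e * a = e * a by rewrite -[e * e * a]mulrA ea.
  by rewrite mulrBl eea subrr.
- move=> c cx.
  have ca : c * a = a * c.
    by apply: commrX.
  apply: subr0_eq; apply: (zero _ (c * y - y * c)).
    by rewrite mulrBl /e -!mulrA ca.
  have cea : c * e * a = c * a by rewrite -[c * e * a]mulrA ea.
  have eca : e * c * a = c * a by rewrite -[e * c * a]mulrA ca mulrA ea.
  by rewrite mulrBl cea eca subrr.
- by move=> e0; exists k; rewrite -/a -ea e0 mul0r.
- move=> e1; rewrite -(@unitrX_pos _ x k) //; apply: (unit_of_ker dD) => v va.
  have ya : v *m (y : L) *m a = v by rewrite -actM -/e e1 act1.
  by rewrite -ya; apply: kera; rewrite actM ya.
Qed.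

(** * The center of the centraliser of an abelian normal subgroup *)

Section AbelianNormal.
Variable A : L -> Prop.
Hypotheses (gA : grp A) (nA : normalized_by M A) (abA : forall a b, A a -> A b -> a * b = b * a).

Definition cent x := forall a, A a -> x * a = a * x.
Definition KA x := cent x /\ forall c, cent c -> x * c = c * x.

Lemma cent_sub : subring_over_center cent.
Proof.
split.
- by move=> z cz a _; apply: cz.
- by move=> x y hx hy a Aa; rewrite mulrBl mulrBr hx // hy.
- by move=> x y hx hy a Aa; rewrite -mulrA hy // mulrA hx // -mulrA.
Qed.

Lemma cent_norm : normalized_by M cent.
Proof.
move=> g x Mg hx a Aa; have ug := grpU gM Mg.
have h := hx _ (grp_conjV gM nA Mg Aa).
apply: (mulrI ug); apply: (mulIr (_ : g^-1 \is a GRing.unit)); rewrite ?unitrV //.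
by move: h; rewrite !mulrA mulrV // mul1r => ->; rewrite mulrK.
Qed.

Lemma cent_inv x : cent x -> x \is a GRing.unit -> cent x^-1.
Proof.
move=> hx ux a Aa; apply: (mulrI ux); apply: (mulIr ux).
by rewrite mulVKr // -!mulrA mulVr // mulr1 hx.
Qed.

Lemma KA_sub : subring_over_center KA.
Proof.
have hc := cent_sub; split.
- by move=> z cz; split; [apply: (srZ hc)|move=> c _; apply: cz].
- move=> x y [hx hx'] [hy hy']; split; first exact: (srB hc).
  by move=> a Aa; rewrite mulrBl mulrBr hx' // hy'.
- move=> x y [hx hx'] [hy hy']; split; first exact: (srM hc).
  by move=> a Aa; rewrite -mulrA hy' // mulrA hx' // -mulrA.
Qed.

Lemma KA_comm x y : KA x -> KA y -> x * y = y * x.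
Proof. by move=> [_ h] [h' _]; apply: h. Qed.

Lemma KA_A a : A a -> KA a.
Proof. by move=> Aa; split; [move=> b Ab; apply: abA|move=> c hc; rewrite hc]. Qed.

Lemma KA_norm : normalized_by M KA.
Proof.
move=> g x Mg [hx hx']; split; first exact: cent_norm.
have ug := grpU gM Mg.
move=> c hc; have h := hx' _ (grp_conjV gM cent_norm Mg hc).
apply: (mulrI ug); apply: (mulIr (_ : g^-1 \is a GRing.unit)); rewrite ?unitrV //.
by move: h; rewrite !mulrA mulrV // mul1r => ->; rewrite mulrK.
Qed.

Lemma KA_inv x : KA x -> x \is a GRing.unit -> KA x^-1.
Proof.
move=> [hx hx'] ux; split; first exact: cent_inv.
move=> c hc; apply: (mulrI ux); apply: (mulIr ux).
by rewrite mulVKr // -!mulrA mulVr // mulr1 hx'.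
Qed.

(** The vectors killed by all nilpotent elements of [KA] form an [M]-stable subspace. It contains
    every minimal nonzero [KA]-stable U: for y in [KA], U y is [KA]-stable, and if it were nonzero
    it would be U, against nilpotency of y. *)
Lemma KA_nilpotent x k : KA x -> x ^+ k = 0 -> x = 0.
Proof.
move=> Kx xk.
pose W v := forall y, KA y -> (exists j, y ^+ j = 0) -> v *m y = 0.
have sW : subsp W.
  split.
  - by move=> y _ _; rewrite mul0mx.
  - by move=> u v hu hv y Ky ny; rewrite mulmxDl hu // hv // addr0.
  - by move=> a v hv y Ky ny; rewrite -scalemxAl hv // scaler0.
have WM v g : W v -> M g -> W (v *m g).
  move=> hv Mg y Ky [j ny]; have ug := grpU gM Mg.
  have := hv (g * y * g^-1) (grp_conjV gM KA_norm Mg Ky).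
  have -> : v *m (g * y * g^-1) = v *m g *m y *m g^-1 by rewrite !actM.
  move=> h; apply: (@unit_ker _ _ g^-1); rewrite ?unitrV //; apply: h.
  exists j; have -> : (g * y * g^-1) ^+ j = g * y ^+ j * g^-1.
    elim: j {ny} => [|j ih]; first by rewrite !expr0 mulr1 mulrV.
    by rewrite !exprS ih !mulrA mulrVK.
  by rewrite ny mulr0 mul0r.
pose Fam W := [/\ subsp W, exists2 v, W v & v != 0 & forall v y, W v -> KA y -> W (v *m y)].
have F0 : Fam (fun=> True).
  split=> //; exists (e_ ord0) => //; apply/eqP => /(congr1 (fun v : V => v 0 ord0)).
  by rewrite e_E eqxx mxE => /eqP; rewrite oner_eq0.
have [U [sU [v Uv nzv] UK] minU] := @subspace_dcc D n dD Fam _ F0 (fun W h => let: And3 h _ _ := h in h).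
suff UW : forall u, U u -> W u.
  have all := irreducible sW WM (ex_intro2 _ _ v (UW _ Uv) nzv).
  by apply: act_extV => u; rewrite act0; apply: all => //; exists k.
move=> u Uu y Ky [j ny]; apply: contrapT => nz.
pose Uy v := exists2 u, U u & v = u *m y.
have FUy : Fam Uy.
  have [U0 UD UZ] := sU.
  split; first split.
  - by exists 0; rewrite ?mul0mx.
  - by move=> _ _ [a Ua ->] [b Ub ->]; exists (a + b); [apply: (UD)|rewrite mulmxDl].
  - by move=> c _ [a Ua ->]; exists (c *: a); [apply: (UZ)|rewrite scalemxAl].
  - by exists (u *m y); [exists u|apply/eqP].
  - move=> _ z [a Ua ->] Kz; exists (a *m z); first exact: UK.
    by rewrite -!actM (KA_comm Ky Kz).
have sub : forall v, U v -> Uy v.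
  by apply: minU => // _ [a Ua ->]; apply: UK.
have chain i : forall v, U v -> exists2 u, U u & v = u *m (y ^+ i : L).
  elim: i => [|i ih] z Uz; first by exists z => //; rewrite expr0 act1.
  have [a Ua ->] := sub _ Uz; have [b Ub ->] := ih _ Ua.
  by exists b => //; rewrite -actM exprSr.
by have [b _] := chain j v Uv; rewrite ny act0 => e; move: nzv; rewrite e eqxx.
Qed.

Definition idemK e := KA e /\ e * e = e.

Lemma idemK_min e : idemK e -> e != 0 ->
  exists e1, [/\ idemK e1, e1 != 0, e1 * e = e1 & forall g, idemK g -> e1 * g = 0 \/ e1 * g = e1].
Proof.
move=> ie nz.
pose im e v := v *m (e : L) = v.
pose Fam W := exists f, [/\ idemK f, f != 0, f * e = f & W = im f].
have sF W : Fam W -> subsp W.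
  move=> [f [_ _ _ ->]]; split; rewrite /im.
  - by rewrite mul0mx.
  - by move=> u v hu hv; rewrite mulmxDl hu hv.
  - by move=> a v hv; rewrite -scalemxAl hv.
have F0 : Fam (im e) by exists e; split=> //; case: ie.
have [_ [e1 [i1 nz1 e1e ->]] min1] := @subspace_dcc D n dD Fam _ F0 sF.
exists e1; split=> // g ig.
have [[K1 ii1] [Kg iig]] := (i1, ig).
have cm := KA_comm K1 Kg.
case: (eqVneq (e1 * g) 0) => [|nzf]; [by left|right].
have iF : idemK (e1 * g).
  split; first exact: (srM KA_sub).
  by rewrite -mulrA [g * _]mulrA -cm -[e1 * g * g]mulrA iig mulrA ii1.
have h : forall v, im e1 v -> im (e1 * g) v.
  apply: min1.
    exists (e1 * g); split=> //.
    have Ke := ie.1.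
    by rewrite -mulrA (KA_comm Kg Ke) mulrA e1e.
  move=> v; rewrite /im => hv; rewrite -{1}hv -actM -mulrA -cm mulrA ii1 //.
apply: act_extV => v; have := h (v *m e1); rewrite /im -!actM ii1 mulrA ii1; exact.
Qed.

(** Minimal idempotents below e and 1 - e provide a frame with [w] and [v] in their images. By
    minimality diag(a, a^-1) on this frame commutes with all idempotents of [KA]. If their
    centraliser had its units of [G] in [M], [no_dilation] would apply; the other alternatives make
    e central. *)
Lemma idemK_trivial e : idemK e -> e = 0 \/ e = 1.
Proof.
move=> ie; apply: contrapT => /not_orP[ne0 ne1].
have [Ke iie] := ie.
have ie' : idemK (1 - e).
  split; first by apply: (srB KA_sub) => //; apply: (sr1 KA_sub).
  by rewrite mulrBl mulrBr mulr1 mul1r mulrBr mulr1 iie subrr subr0.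
have [e1 [i1 nz1 e1e min1]] := idemK_min ie (introN eqP ne0).
have [|e2 [i2 nz2 e2e min2]] := idemK_min ie'.
  by rewrite subr_eq0; apply/eqP => h; apply: ne1.
have [[K1 ii1] [K2 ii2]] := (i1, i2).
have e12 : e1 * e2 = 0.
  by rewrite -e1e -mulrA -(KA_comm K2 Ke) -{1}e2e -mulrA mulrBl mul1r iie subrr !mulr0.
have e21 : e2 * e1 = 0 by rewrite (KA_comm K2 K1).
pose S x := forall g, idemK g -> x * g = g * x.
have hS : subring_over_center S.
  split.
  - by move=> z cz g _; apply: cz.
  - by move=> x y hx hy g ig; rewrite mulrBl mulrBr hx // hy.
  - by move=> x y hx hy g ig; rewrite -mulrA hy // mulrA hx // -mulrA.
have nS : normalized_by M S.
  move=> m x Mm hx g [Kg iig]; have um := grpU gM Mm.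
  have h := hx (m * g * m^-1) _.
  apply: (mulrI um); apply: (mulIr (_ : m^-1 \is a GRing.unit)); rewrite ?unitrV //.
  move: h; rewrite !mulrA mulrV // mul1r => ->; first by rewrite mulrK.
  split; first exact: (grp_conjV gM KA_norm).
  by rewrite !mulrA mulrVK // -[m * g * g]mulrA iig.
have nce : ~ central e.
  move=> /central_unit h.
  have ue := h dD (introN eqP ne0); apply: ne1.
  by apply: (mulrI ue); rewrite iie mulr1.
have [h|h|h] := subring_trichotomy hS nS.
- by apply: nce; apply: h => g [Kg _]; apply: KA_comm.
- by apply: nce => x; rewrite (h x e ie).
have exv (f : L) : f != 0 -> f * f = f -> exists2 v : V, v != 0 & v *m f = v.
  move=> nz ff; apply: contrapT => nv; case/eqP: nz; apply: act_extV => v; rewrite act0.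
  apply: contrapT => nzv; apply: nv; exists (v *m f); first by apply/eqP.
  by rewrite -actM ff.
have [w nzw we] := exv _ nz1 ii1; have [v nzv ve] := exv _ nz2 ii2.
have [psi1 h1] := ex_dual dD nzw; have [psi2 h2] := ex_dual dD nzv.
pose phi : C := (e1 : 'M[D]_N) *m psi1; pose psi : C := (e2 : 'M[D]_N) *m psi2.
have fr : frame w v phi psi.
  split; rewrite -pr_act ?we ?ve //.
    by rewrite -we -actM e12 act0 pr0l.
  by rewrite -ve -actM e21 act0 pr0l.
have Shh a : S (hh w v phi psi a).
  have aux f g (chi : C) (u : V) : KA f -> (f * g = 0 \/ f * g = f) -> idemK g -> u *m f = u ->
     rk ((f : 'M[D]_N) *m chi) u * g = g * rk ((f : 'M[D]_N) *m chi) u.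
    move=> Kf fg [Kg _] uf; have cm := KA_comm Kf Kg.
    have E : rk ((f : 'M[D]_N) *m chi) u = f * rk chi u * f.
      by rewrite -mulrA mul_rk uf rk_mul.
    rewrite E; transitivity (f * rk chi u * (f * g)); first by rewrite mulrA.
    by rewrite [RHS]mulrA [g * (f * _)]mulrA -cm; case: fg => ->; rewrite ?mulr0 ?mul0r.
  move=> g ig.
  have A1 : rk phi ((a - 1) *: w) * g = g * rk phi ((a - 1) *: w).
    by apply: aux => //; [apply: min1|rewrite -scalemxAl we].
  have A2 : rk psi ((a^-1 - 1) *: v) * g = g * rk psi ((a^-1 - 1) *: v).
    by apply: aux => //; [apply: min2|rewrite -scalemxAl ve].
  by rewrite /hh !mulrDl !mulrDr mul1r mulr1 A1 A2.
apply: (no_dilation nzw) => a a0; exists (hh w v phi psi a); last exact: hh_w.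
apply: h => //; first by rewrite (hh_inv fr (dD a0)).
by apply: TG; apply: hh_Tg => //; apply: dD.
Qed.

Lemma KA_unit x : KA x -> x != 0 -> x \is a GRing.unit.
Proof.
move=> Kx nz; have [e [ee ce e0 e1]] := fitting x.
have [|/e0[k hk]|/e1 //] := @idemK_trivial e.
  split=> //; have [hx hx'] := Kx; split.
    by move=> a Aa; apply/esym; apply: ce; rewrite hx.
  by move=> c hc; apply/esym; apply: ce; rewrite hx'.
by case/eqP: nz; apply: (KA_nilpotent Kx hk).
Qed.

Lemma KA_division : division_subring KA.
Proof.
split; [exact: (sr1 KA_sub)|exact: (srB KA_sub)|exact: (srM KA_sub)|exact: KA_unit|].
move=> x Kx; have [ux|nu] := boolP (x \is a GRing.unit); first exact: KA_inv.
by rewrite invr_out.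
Qed.
End AbelianNormal.
End Maximal.

(** * Spans of groups over a field *)

Section Span.
Variables (L : unitRingType) (K : L -> Prop).
Hypotheses (hK : division_subring K) (cK : forall x y, K x -> K y -> x * y = y * x).
Implicit Types (P B : L -> Prop) (x y b k : L).

(** The index counts terms, with repetitions and zero coefficients allowed; inductions on the length
    of a relation run on it. *)
Inductive spn P : nat -> L -> Prop :=
| spn0 : spn P 0 0
| spnS n b k x : P b -> K k -> spn P n x -> spn P n.+1 (b * k + x).

Definition kspan P x := exists n, spn P n x.

Lemma span_ind' P (F : L -> Prop) : F 0 -> (forall b k x, P b -> K k -> kspan P x -> F x -> F (b * k + x)) ->
  forall x, kspan P x -> F x.
Proof.
move=> F0 FS x [n sx]; elim: sx => // m b k y Pb Kk sy Fy.
by apply: FS => //; exists m.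
Qed.

Lemma kspan0 P : kspan P 0. Proof. by exists 0%N; apply: spn0. Qed.
Lemma spanS P b k x : P b -> K k -> kspan P x -> kspan P (b * k + x).
Proof. by move=> Pb Kk [n sx]; exists n.+1; apply: spnS. Qed.
Lemma kspan1 P b k : P b -> K k -> kspan P (b * k).
Proof. by move=> Pb Kk; rewrite -[_ * _]addr0; apply: spanS => //; apply: kspan0. Qed.
Lemma spanb P b : P b -> kspan P b.
Proof. by move=> Pb; rewrite -[b]mulr1; apply: kspan1 => //; apply: (ds1 hK). Qed.
Lemma spanD P x y : kspan P x -> kspan P y -> kspan P (x + y).
Proof.
move=> sx sy; elim/span_ind': sx => [|b k z Pb Kk _ ih]; first by rewrite add0r.
by rewrite -addrA; apply: spanS.
Qed.
Lemma spanZ P x k : kspan P x -> K k -> kspan P (x * k).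
Proof.
move=> sx Kk; elim/span_ind': sx => [|b k' z Pb Kk' _ ih]; first by rewrite mul0r; apply: kspan0.
by rewrite mulrDl -mulrA; apply: spanS => //; apply: (dsM hK).
Qed.
Lemma spanN P x : kspan P x -> kspan P (- x).
Proof. by rewrite -[- x]mulrN1 => sx; apply: spanZ => //; apply: dsN => //; apply: (ds1 hK). Qed.
Lemma spanB P x y : kspan P x -> kspan P y -> kspan P (x - y).
Proof. by move=> sx sy; apply: spanD => //; apply: spanN. Qed.
Lemma kspan_sum P (I : Type) (r : seq I) (Q : pred I) F :
  (forall i, Q i -> kspan P (F i)) -> kspan P (\sum_(i <- r | Q i) F i).
Proof. by move=> h; apply: big_ind => //; [apply: kspan0|apply: spanD]. Qed.
Lemma span_mono P P' x : (forall b, P b -> P' b) -> kspan P x -> kspan P' x.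
Proof.
move=> sub; elim/span_ind' => [|b k z Pb Kk _ ih]; first exact: kspan0.
by apply: spanS => //; apply: sub.
Qed.

Variables (A B : L -> Prop).
Hypotheses (gA : grp A) (gB : grp B) (AK : forall a, A a -> K a) (AB : forall a, A a -> B a).
Hypothesis nBK : normalized_by B K.

Lemma K_conjV b k : B b -> K k -> K (b * k * b^-1).
Proof. exact: (grp_conjV gB nBK). Qed.

Lemma span_mul x y : kspan B x -> kspan B y -> kspan B (x * y).
Proof.
move=> sx sy; elim/span_ind': sx => [|b k z Bb Kk _ ih]; first by rewrite mul0r; apply: kspan0.
rewrite mulrDl; apply: spanD => //.
elim/span_ind': sy {ih} => [|b' k' w Bb' Kk' _ ih]; first by rewrite mulr0; apply: kspan0.
rewrite mulrDr; apply: spanD => //.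
have ub := grpU gB Bb'.
have -> : b * k * (b' * k') = (b * b') * ((b'^-1 * k * b') * k').
  by rewrite !mulrA mulrK.
by apply: kspan1; [apply: (grpM gB)|apply: (dsM hK) => //; apply: nBK].
Qed.

Lemma span_K k : K k -> kspan B k.
Proof. by move=> Kk; rewrite -[k]mul1r; apply: kspan1 => //; apply: (grp1 gB). Qed.

Lemma span_sub : (forall z, central z -> K z) -> subring_over_center (kspan B).
Proof.
move=> ZK; split; [by move=> z /ZK; apply: span_K|exact: spanB|exact: span_mul].
Qed.

Lemma span_norm (M : L -> Prop) : (forall m, M m -> m \is a GRing.unit) ->
  normalized_by M B -> normalized_by M K -> normalized_by M (kspan B).
Proof.
move=> uM nB nK m x Mm; have um := uM _ Mm.
elim/span_ind' => [|b k z Bb Kk _ ih]; first by rewrite mulr0 mul0r; apply: kspan0.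
have -> : m^-1 * (b * k + z) * m = (m^-1 * b * m) * (m^-1 * k * m) + m^-1 * z * m.
  by rewrite mulrDr mulrDl !mulrA mulrK.
by apply: spanS => //; [apply: nB|apply: nK].
Qed.

Definition unit_in (S : L -> Prop) x := [/\ S x, x \is a GRing.unit & S x^-1].

Lemma unit_in_span u s d : kspan B u -> kspan B s -> K d -> d != 0 ->
  u * s = d -> s * u = d -> unit_in (kspan B) u.
Proof.
move=> su ss Kd d0 e1 e2; have ud := dsU hK Kd d0.
have r1 : u * (s * d^-1) = 1 by rewrite mulrA e1 mulrV.
have r2 : (d^-1 * s) * u = 1 by rewrite -mulrA e2 mulVr.
have eq : d^-1 * s = s * d^-1.
  by rewrite -[LHS]mulr1 -r1 mulrA r2 mul1r.
have uu : u \is a GRing.unit by apply/unitrP; exists (s * d^-1); rewrite r1 -{1}eq r2.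
split=> //; have -> : u^-1 = s * d^-1.
  by apply: (mulrI uu); rewrite mulrV // r1.
by apply: spanZ => //; apply: (dsV hK).
Qed.

Lemma unit_in_K k : K k -> k != 0 -> unit_in (kspan B) k.
Proof.
move=> Kk k0; split; [exact: span_K|exact: (dsU hK)|apply: span_K; exact: (dsV hK)].
Qed.
Lemma unit_in_B b : B b -> unit_in (kspan B) b.
Proof.
by move=> Bb; split; [exact: spanb|exact: (grpU gB)|apply: spanb; exact: (grpV gB)].
Qed.

(* The map y |-> y a - x^-1 y x with a = [b, x] is K-linear, preserves every coset component and kills exactly those multiplied by a: this is what separates the cosets of A in the K-span of B. *)
Definition twisting := forall b, B b -> ~ A b -> exists x,
  [/\ x \is a GRing.unit, forall k, K k -> x * k = k * x, forall b', B b' -> A (comm b' x) & comm b x <> 1].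
Hypothesis tw : twisting.

(** The map just described shortens the relation by one term and turns [k] into [k * (a - 1)], where
    a - 1 is invertible. *)
Lemma spn_coset_ind n : forall k, spn (fun b => B b /\ ~ A b) n k -> K k -> k = 0.
Proof.
elim: n => [|n IH] k s Kk; first by inversion s.
inversion s as [|m b k1 x [Bb nAb] Kk1 sx em ek]; subst m.
have [y [uy yK yB c1]] := tw Bb nAb.
set a := comm b y in c1; have Aa : A a by apply: yB.
have Ka := AK Aa.
have conj1 b' : B b' -> y^-1 * b' * y = b' * comm b' y.
  by move=> Bb'; rewrite /comm !mulrA mulrV ?mul1r // (grpU gB).
have sx' : spn (fun b => B b /\ ~ A b) n (x * a - y^-1 * x * y).
  elim: sx => [|j b' k' z [Bb' nAb'] Kk' _ ih].
    by rewrite mul0r mulr0 mul0r subrr; apply: spn0.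
  have -> : (b' * k' + z) * a - y^-1 * (b' * k' + z) * y = b' * (k' * (a - comm b' y)) + (z * a - y^-1 * z * y).
    have e : y^-1 * (b' * k') * y = b' * (comm b' y * k').
      rewrite [RHS]mulrA -conj1 // -!mulrA; congr (_ * (_ * _)); exact/esym/yK.
    rewrite mulrDl mulrDr mulrDl e mulrBr (cK Kk' (AK (yB _ Bb'))) mulrBr !mulrA; zmod.
  apply: spnS => //; apply: (dsM hK) => //; apply: (dsB hK) => //; apply: AK; exact: yB.
have Kka : K (k * (a - 1)) by apply: (dsM hK) => //; apply: (dsB hK) => //; apply: (ds1 hK).
have E : k * (a - 1) = x * a - y^-1 * x * y.
  have kx : y^-1 * k * y = k by rewrite -mulrA -yK // mulKr.
  have k1y : y^-1 * (b * k1) * y = b * (a * k1).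
    rewrite [RHS]mulrA -conj1 // -!mulrA; congr (_ * (_ * _)); exact/esym/yK.
  rewrite mulrBr mulr1 -[X in _ - X]kx -ek mulrDl mulrDr mulrDl k1y (cK Ka Kk1) !mulrA; zmod.
have := IH (k * (a - 1)); rewrite {1}E => /(_ sx' Kka) z.
have a1 : a - 1 != 0 by rewrite subr_eq0; apply/eqP.
have ua : a - 1 \is a GRing.unit by apply: (dsU hK) => //; apply: (dsB hK) => //; apply: (ds1 hK).
by rewrite ek; apply: (mulIr ua); rewrite z mul0r.
Qed.

(** Translation by [c^-1] brings the coset of [c] to [A]. Coefficients are compared through this
    lemma: one coset stays on the left, and all other terms of the identity are collected in [y]. *)
Lemma coset_coef c k y : B c -> K k -> c * k = y ->
  kspan (fun b => B b /\ ~ A (c^-1 * b)) y -> k = 0.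
Proof.
move=> Bc Kk e sy; have uc := grpU gB Bc.
suff [n s] : kspan (fun b => B b /\ ~ A b) k by apply: spn_coset_ind s Kk.
have -> : k = c^-1 * y by rewrite -e mulKr.
elim/span_ind': sy {e} => [|b k' z [Bb nA] Kk' _ ih]; first by rewrite mulr0; apply: kspan0.
rewrite mulrDr mulrA; apply: spanS => //; split=> //.
by apply: (grpM gB) => //; apply: (grpV gB).
Qed.

Lemma span_homogeneous m : B m -> forall P, (forall b, P b -> B b) -> kspan P m ->
   exists2 b, P b & A (m^-1 * b).
Proof.
move=> Bm P PB sm; apply: contrapT => nex.
have : (1 : L) = 0.
  apply: (coset_coef Bm (ds1 hK) (mulr1 m)); apply: span_mono sm => b Pb; split; first exact: PB.
  by move=> h; apply: nex; exists b.
by move/eqP; rewrite oner_eq0.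
Qed.
End Span.

(** * Torsion modulo A when A is its own centraliser *)

Section Powers.
Variables (L : unitRingType) (A : L -> Prop).
Hypothesis gA : grp A.

Lemma grpX (H : L -> Prop) x n : grp H -> H x -> H (x ^+ n).
Proof. by move=> gH Hx; elim: n => [|n ih]; [apply: (grp1 gH)|rewrite exprS; apply: (grpM gH)]. Qed.

Lemma pow_notin b p i : prime p -> b \is a GRing.unit -> A (b ^+ p) -> ~ A b ->
  (0 < i < p)%N -> ~ A (b ^+ i).
Proof.
move=> pp ub Abp nAb /andP[i0 ip] Abi; apply: nAb.
have cop : coprime i p.
  by rewrite coprime_sym prime_coprime // gtnNdvd.
have [[|u] v e _] := egcdnP p i0.
  by move: e; rewrite mul0n (eqP cop) addn1.
have := grpX u.+1 gA Abi; rewrite -exprM mulnC e (eqP cop) exprD expr1 mulnC exprM => h.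
have h2 := grpX v gA Abp.
rewrite -[b](mulKr (grpU gA h2)); apply: (grpM gA) => //; exact: (grpV gA).
Qed.

Lemma conjX (x b : L) n : x \is a GRing.unit -> x^-1 * b ^+ n * x = (x^-1 * b * x) ^+ n.
Proof.
move=> ux; elim: n => [|n ih]; first by rewrite !expr0 mulr1 mulVr.
by rewrite !exprS -ih !mulrA mulrK.
Qed.

Lemma square_second_diff (x d : L) : x * d = d * x ->
  (x + d + d) * (x + d + d) - (x + d) * (x + d) = (x + d) * (x + d) - x * x ->
  d * d + d * d = 0.
Proof.
by move=> c h; apply: (eq_by_diff h); rewrite !(mulrDl, mulrDr) c; zmod.
Qed.

Lemma sq0_inv (x : L) : x * x = 0 -> (1 + x) * (1 - x) = 1 /\ (1 - x) * (1 + x) = 1.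
Proof.
by move=> xx; split; rewrite !(mulrDl, mulrDr, mulrN, mulNr, mulr1, mul1r) xx; zmod.
Qed.
End Powers.

Section Alpha.
Variables (L : unitRingType) (K A B M : L -> Prop).
Hypotheses (hK : division_subring K) (cK : forall x y, K x -> K y -> x * y = y * x).
Hypothesis ZK : forall z, central z -> K z.
Hypotheses (gA : grp A) (gB : grp B) (gM : grp M).
Hypotheses (AK : forall a, A a -> K a) (AB : forall a, A a -> B a) (BM : forall a, B a -> M a).
Hypotheses (nA : normalized_by M A) (nK : normalized_by M K).
Hypothesis alpha : forall m, M m -> (forall a, A a -> a * m = m * a) -> A m.

Lemma alpha_witness m : M m -> ~ A m -> exists2 a, A a & a * m <> m * a.
Proof.
move=> Mm nA'; apply: contrapT => h; apply: nA'; apply: alpha => // a Aa.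
by apply: contrapT => ne; apply: h; exists a.
Qed.

Lemma alpha_twisting (B' : L -> Prop) : (forall b, B' b -> M b) -> twisting K A B'.
Proof.
move=> B'M b Bb nAb; have [a Aa ne] := alpha_witness (B'M _ Bb) nAb.
have ua := grpU gA Aa.
exists a; split=> //.
- by move=> k Kk; apply: cK => //; apply: AK.
- move=> b' /B'M Mb; rewrite /comm; apply: (grpM gA) => //; apply: nA => //; exact: (grpV gA).
- by move=> c1; apply: ne; rewrite [RHS]commE ?c1 ?mulr1 //; apply: (grpU gM); apply: B'M.
Qed.

Let nBK : normalized_by B K.
Proof. by move=> b k /BM; apply: nK. Qed.

Local Notation R := (kspan K B).

(** In case alpha the cosets of [A] in the whole of [M] are independent, not only those in [B]; this
    identifies the intersection of [M] with R. *)
Lemma alpha_homogeneous m : M m -> R m -> B m.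
Proof.
move=> Mm Rm.
have [b Bb Ab] := span_homogeneous hK cK gM AK (alpha_twisting (fun _ h => h)) Mm BM Rm.
rewrite -[m](mulrK (grpU gA Ab)) -mulrA; have um := grpU gM Mm.
have -> : m * (m^-1 * b * (m^-1 * b)^-1) = b * (m^-1 * b)^-1 by rewrite !mulrA mulrV // mul1r.
by apply: (grpM gB) => //; apply: AB; apply: (grpV gA).
Qed.

Local Notation coef := (coset_coef hK cK gB AK (alpha_twisting BM)).

Hypothesis HX : forall u v, unit_in R u -> unit_in R v -> M (comm u v).
Variables (p : nat) (b : L).
Hypotheses (pp : prime p) (Bb : B b) (nAb : ~ A b) (Abp : A (b ^+ p)).
Variable t : L.
Hypotheses (ct : central t) (t0 : t != 0) (t1 : t * t != 1).

Let ub : b \is a GRing.unit. Proof. exact: (grpU gB). Qed.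
Let Rb : R b. Proof. exact: spanb. Qed.
Let K1 : K 1. Proof. exact: (ds1 hK). Qed.
Let RB := span_sub hK gB nBK ZK.

Let nAbV : ~ A (b^-1 * 1).
Proof. by rewrite mulr1 => h; apply: nAb; rewrite -[b]invrK; apply: (grpV gA). Qed.

(** The commutator y of 1 + b with some a in [A] lies in [B], hence in one coset, and 1 + b w = y +
    b y. For p > 2 the cosets of 1, b and b^2 differ, and the coefficients match only if y = 1 and w
    = 1. *)
Lemma alpha_unit_plus1 : (2 < p)%N -> unit_in R (1 + b) -> False.
Proof.
move=> p2 Xu; have [a Aa ne] := alpha_witness (BM Bb) nAb.
have Ka := AK Aa; have ua := grpU gA Aa.
have Xa : unit_in R a by apply: unit_in_B => //; apply: AB.
set y := comm (1 + b) a.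
have By : B y.
  apply: alpha_homogeneous; first exact: HX.
  have [R1 _ RV] := Xu; have [Ra _ RaV] := Xa.
  by rewrite /y /comm; do !apply: (srM RB).
set w := comm b a.
have Kw : K w.
  by rewrite /w /comm; apply: (dsM hK) => //; apply: nBK => //; apply: (dsV hK).
have w1 : w <> 1 by move=> e; apply: ne; rewrite [RHS]commE // -/w e mulr1.
have E : 1 + b * w = y + b * y.
  have -> : y + b * y = (1 + b) * y by rewrite mulrDl mul1r.
  have [_ uu _] := Xu.
  by rewrite /y /w /comm !mulrA !mulrV // !mul1r mulrDr mulrDl mulr1 mulVr.
have uw : w \is a GRing.unit by apply: comm_unit.
clearbody y w.
have nAb2 : ~ A (b * b) by rewrite -expr2; apply: (pow_notin gA pp).
have [Ay|nAy] := pselect (A y).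
  have y1 : 1 - y = 0.
    have Ky := AK Ay.
    apply: (coef (c := 1) (y := b * y - b * w)); [exact: (grp1 gB)|exact: (dsB hK)| |].
      by rewrite mul1r; apply: (eq_by_diff E); zmod.
    have P1 : B b /\ ~ A (1^-1 * b) by rewrite invr1 mul1r.
    by apply: (spanB hK); apply: kspan1.
  have {}y1 : y = 1 by apply/esym/subr0_eq.
  apply: w1; apply/subr0_eq.
  apply: (coef (c := b) (y := 0)) => //; [exact: (dsB hK)| |exact: kspan0].
  by rewrite mulrBr mulr1; move: E; rewrite y1 mulr1 => /addrI ->; rewrite subrr.
have By' : B (b * y) by apply: (grpM gB).
have [Aby|nAby] := pselect (A (b * y)).
  suff w0 : w = 0 by move: uw; rewrite w0 unitr0.
  apply: (coef (c := b) (y := y + b * y - 1)) => //.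
    by apply: (eq_by_diff E); zmod.
  apply: (spanB hK); last by apply: (spanb hK); split=> //; exact: (grp1 gB).
  apply: spanD; apply: (spanb hK); split=> //.
    move=> h; apply: nAb2; have uy := grpU gB By.
    have -> : b * b = (b * y) * (b^-1 * y)^-1.
      by rewrite invrM ?unitrV // invrK !mulrA mulrK.
    by apply: (grpM gA) => //; apply: (grpV gA).
  by rewrite mulKr.
have /eqP : (1 : L) = 0.
  apply: (coef (c := 1) (y := y + b * y - b * w)); [exact: (grp1 gB)|exact: K1| |].
    by rewrite mulr1; apply: (eq_by_diff E); zmod.
  apply: (spanB hK); first by apply: spanD; apply: (spanb hK); rewrite invr1 mul1r.
  by apply: kspan1 => //; rewrite invr1 mul1r.
by rewrite oner_eq0.
Qed.

Lemma geom_unit (c s : L) : K c -> R s -> (1 - c) != 0 -> forall x, R x ->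
  x * s = s * x -> x * s = 1 - c -> unit_in R x.
Proof.
move=> Kc Rs c1 x Rx cx e; apply: (unit_in_span hK Rx Rs (d := 1 - c)) => //.
  by apply: (dsB hK).
by rewrite -cx.
Qed.

(** Now (1 + b) e = 0 for e the sum of the powers of -b, so another unit is needed: u = 1 + (k - s
    k) e, where s is conjugation by b and the added term has square zero. Its commutator with b is 1
    + de e, with de a second difference of k under s, and this lies in one coset only if de = 0. *)
Lemma alpha_nonunit_plus1 : (2 < p)%N -> (- b) ^+ p = 1 -> False.
Proof.
move=> p2 bp1; have [x Ax nex] := alpha_witness (BM Bb) nAb.
have Kx := AK Ax.
set b1 := - b in bp1.
have RbB := RB.
have Rb1 : R b1 by apply: (srN RB).
have ub1 : b1 \is a GRing.unit by rewrite unitrN.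
pose e := \sum_(i < p) b1 ^+ i.
have Re : R e by apply: (sr_sum RB) => i _; apply: (srX RB).
have b1e : b1 * e = e.
  have := subrX1 b1 p; rewrite bp1 subrr mulrBl mul1r => /esym/subr0_eq.
  by rewrite -/e.
have eb1 : e * b1 = e.
  rewrite -{2}b1e /e mulr_suml mulr_sumr; apply: eq_bigr => i _.
  by rewrite -exprS -exprSr.
pose s k := b * k * b^-1; pose s' k := b^-1 * k * b.
have Ks k : K k -> K (s k) by move=> Kk; apply: (K_conjV gB nBK).
have Ks' k : K k -> K (s' k) by move=> Kk; apply: nBK.
have ss' k : s (s' k) = k by rewrite /s /s' !mulrA mulrV // mul1r mulrK.
have s's k : s' (s k) = k by rewrite /s /s' !mulrA mulVr // mul1r mulrVK.
have sD k l : s (k + l) = s k + s l by rewrite /s mulrDr mulrDl.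
have sM k l : s (k * l) = s k * s l by rewrite /s !mulrA mulrVK.
have sN k : s (- k) = - s k by rewrite /s mulrN mulNr.
have be : b * e = - e by rewrite -[in RHS]b1e /b1 mulNr opprK.
have eb : e * b = - e by rewrite -[in RHS]eb1 /b1 mulrN opprK.
have bVe : b^-1 * e = - e by apply: (mulrI ub); rewrite mulVKr // mulrN be opprK.
have ebV : e * b^-1 = - e by apply: (mulIr ub); rewrite mulrVK // mulNr eb opprK.
have eke k : e * (k - s k) * e = 0.
  rewrite mulrBr mulrBl /s !mulrA eb !mulNr -[_ * b^-1 * e]mulrA bVe.
  by rewrite mulrN opprK subrr.
pose kap k := k - s k.
have Kkap k : K k -> K (kap k) by move=> Kk; apply: (dsB hK) => //; apply: Ks.
have inB k : K k -> s' k - k - k + s k = 0.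
  move=> Kk; set de := s' k - k - k + s k.
  have Kde : K de.
    by apply: (dsD hK); [apply: (dsB hK); [apply: (dsB hK)|]|]; rewrite ?Ks ?Ks' //; [apply: Ks'|apply: Ks].
  pose u := 1 + kap k * e; pose v := 1 - kap k * e.
  have N2 : kap k * e * (kap k * e) = 0.
    by rewrite -[kap k * e * _]mulrA [e * (_ * _)]mulrA eke mulr0.
  have [uv vu] : u * v = 1 /\ v * u = 1 by apply: sq0_inv.
  have RN : R (kap k * e) by apply: (srM RB) => //; apply: (span_K gB); apply: Kkap.
  have Xu : unit_in R u.
    apply: (unit_in_span hK (s := v) (d := 1)) => //.
    - by apply: (srD RB) => //; apply: (sr1 RB).
    - by apply: (srB RB) => //; apply: (sr1 RB).
    - exact: oner_neq0.
  have Xb : unit_in R b by apply: unit_in_B.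
  have uu : u \is a GRing.unit by case: Xu.
  have uV : u^-1 = v by apply: (mulrI uu); rewrite mulrV // uv.
  set y := comm u b.
  have Ey : y = 1 + de * e.
    rewrite /y /comm uV.
    have -> : v * b^-1 * u * b = v * (b^-1 * u * b) by rewrite !mulrA.
    have -> : b^-1 * u * b = 1 + (s' k - k) * e.
      rewrite /u mulrDr mulrDl mulr1 mulVr //; congr (_ + _).
      rewrite /kap mulrA -[_ * e * b]mulrA eb mulrN mulrBr mulrBl [(s' k - k) * e]mulrBl.
      have -> : b^-1 * s k * e = - (k * e).
        by rewrite /s !mulrA mulVr // mul1r -[k * b^-1 * e]mulrA bVe mulrN.
      have -> : b^-1 * k * e = - (s' k * e).
        by rewrite /s' -[b^-1 * k * b * e]mulrA be mulrN opprK.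
      zmod.
    have e0 : kap k * e * ((s' k - k) * e) = 0.
      have := eke (s' k); rewrite ss' => h.
      by rewrite -mulrA [e * (_ * _)]mulrA h mulr0.
    have aux (X Y : L) : X * Y = 0 -> (1 - X) * (1 + Y) = 1 + (Y - X).
      by move=> XY; rewrite !(mulrDl, mulrDr, mulNr, mulr1, mul1r) XY; zmod.
    by rewrite /v (aux _ _ e0) -mulrBl /de /kap; congr (1 + _ * e); zmod.
  have Ry : R y.
    by rewrite Ey; apply: (srD RB); [apply: (sr1 RB)|apply: (srM RB) => //; apply: (span_K gB)].
  have By : B y by apply: alpha_homogeneous => //; apply: HX.
  have term i : exists2 k', K k' & de * b1 ^+ i = b ^+ i * k' /\ (k' = 0 -> de = 0).
    have ubi : b ^+ i \is a GRing.unit by rewrite unitrX.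
    have Bbi : B (b ^+ i) by apply: grpX.
    exists ((b ^+ i)^-1 * de * b ^+ i * (-1) ^+ i).
      by apply: (dsM hK); [apply: nBK|apply: (dsX hK); apply: (dsN hK)].
    split.
      by rewrite /b1 (exprNn b) -(commr_sign (b ^+ i) i) !mulrA mulrV // mul1r.
    move=> z; apply: (mulrI (_ : (b ^+ i)^-1 \is a GRing.unit)); rewrite ?unitrV //.
    apply: (mulIr ubi); rewrite mulr0 mul0r.
    by apply: (mulIr (_ : (-1) ^+ i \is a GRing.unit)); rewrite ?unitrX ?unitrN1 // z mul0r.
  (* [e] has a component in every coset of b^j; p > 2 leaves two values j > 0, and y misses one of
     these cosets. *)
  have fin (j : 'I_p) : (0 < j)%N -> ~ A ((b ^+ j)^-1 * y) -> de = 0.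
    move=> j0 nAj; have [k' Kk' [ek' k0]] := term j.
    apply: k0; have Bbj : B (b ^+ j) by apply: grpX.
    apply: (coef (y := y - 1 - \sum_(i < p | i != j) de * b1 ^+ i) Bbj) => //.
      by rewrite -ek' Ey /e mulr_sumr (bigD1 j) //=; zmod.
    have ubj := grpU gB Bbj.
    have nAj1 : ~ A (b ^+ j) by apply: (pow_notin gA pp) => //; rewrite j0 ltn_ord.
    apply: (spanB hK); [apply: (spanB hK); apply: (spanb hK); split=> //|].
    - exact: (grp1 gB).
    - by rewrite mulr1 => h; apply: nAj1; rewrite -[b ^+ j]invrK; apply: (grpV gA).
    apply: kspan_sum => i ne; have [k2 Kk2 [-> _]] := term i.
    apply: kspan1 => //; split; first exact: grpX.
    case: (ltngtP i j) => [lt|lt|e']; last by case/eqP: ne; apply: val_inj.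
      rewrite -(subnKC (ltnW lt)) exprD invrM ?unitrX // mulrVK ?unitrX // => h.
      have : ~ A (b ^+ (j - i)).
        by apply: (pow_notin gA pp) => //; rewrite subn_gt0 lt /= (leq_ltn_trans (leq_subr _ _) (ltn_ord j)).
      by apply; rewrite -[b ^+ _]invrK; apply: (grpV gA).
    rewrite -(subnKC (ltnW lt)) exprD mulrA mulVr ?unitrX // mul1r.
    by apply: (pow_notin gA pp) => //; rewrite subn_gt0 lt /= (leq_ltn_trans (leq_subr _ _) (ltn_ord i)).
  have p1 : (1 < p)%N by apply: ltnW.
  have [h1|h1] := pselect (A (b^-1 * y)); last by apply: (fin (Ordinal p1)) => //=; rewrite expr1.
  apply: (fin (Ordinal p2)) => //=; rewrite expr2 => h2; apply: nAb.
  have uy := grpU gB By.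
  have -> : b = (b^-1 * y) * ((b * b)^-1 * y)^-1.
    have ubb : (b * b)^-1 \is a GRing.unit by rewrite unitrV unitrMl.
    have -> : ((b * b)^-1 * y)^-1 = y^-1 * (b * b) by rewrite invrM // invrK.
    by rewrite mulrA mulrK // mulKr.
  by apply: (grpM gA) => //; apply: (grpV gA).
(* Vanishing second differences mean that s fixes d k. Applied to x^2 this gives 2 (d x)^2 = 0,
   hence d x + d x = 0 and s (s x) = x, while the p-th iterate of s fixes x and p is odd. *)
pose d k := s k - k.
have sd k : K k -> s (d k) = d k.
  move=> Kk; have := inB _ (Ks _ Kk); rewrite s's => h.
  by rewrite /d sD sN; apply: (eq_by_diff h); zmod.
set dx := d x.
have sx : s x = x + dx by rewrite /dx /d; zmod.
have dx0 : dx != 0.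
  rewrite subr_eq0; apply/eqP => e'; apply: nex.
  by rewrite -{1}e' /s mulrVK.
have Kdx : K dx by apply: (dsB hK) => //; apply: Ks.
have sdx : s dx = dx by apply: sd.
have two : dx * dx + dx * dx = 0.
  have h : s (d (x * x)) = d (x * x) by apply: sd; apply: (dsM hK).
  have dxx : d (x * x) = (x + dx) * (x + dx) - x * x by rewrite /d sM sx.
  have sx2 : s (x + dx) = x + dx + dx by rewrite sD sx sdx.
  rewrite dxx sD sN !sM sx2 sx in h.
  exact: square_second_diff (cK Kx Kdx) h.
have udx := dsU hK Kdx dx0.
have dd0 : dx + dx = 0 by apply: (mulrI udx); rewrite mulrDr two mulr0.
have ssx : s (s x) = x by rewrite sx sD sx sdx -addrA dd0 addr0.
have iters m : iter m s x = b ^+ m * x * (b ^+ m)^-1.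
  elim: m => [|m ih]; first by rewrite expr0 invr1 mulr1 mul1r.
  by rewrite iterS ih /s exprS invrM ?unitrX // !mulrA.
have : iter p s x = x.
  rewrite iters (cK (AK Abp) Kx) mulrK // unitrX //.
have odd_p : odd p by case: (even_prime pp) => [p2'|//]; move: p2; rewrite p2'.
rewrite -(odd_double_half p) odd_p addnC iterD /=.
have -> : iter (p./2).*2 s (s x) = s x.
  by elim: (p./2) => // m ih; rewrite doubleS !iterS ih ssx.
by move/eqP; rewrite sx -subr_eq0 addrAC subrr add0r (negbTE dx0).
Qed.

(** c + b is invertible, with inverse a multiple of c - b by c^2 - b^2. Comparing cosets in its
    commutator with x shows that the commutator of b with x is c^2 / b^2, the same for all x in [K]
    not commuting with b. *)
Lemma alpha_two c : p = 2%N -> central c -> c != 0 -> c * c != b * b -> False.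
Proof.
move=> p2 cc c0 cb; have Abb : A (b * b) by move: Abp; rewrite p2 expr2.
set be := b * b in Abb cb; have Kbe := AK Abb.
have Kc := ZK cc; have uc := dsU hK Kc c0.
have ube := grpU gA Abb.
have Xc : unit_in R (c + b).
  apply: (unit_in_span hK (s := c - b) (d := c * c - be)).
  - by apply: (srD RB) => //; apply: (srZ RB).
  - by apply: (srB RB) => //; apply: (srZ RB).
  - by apply: (dsB hK) => //; apply: (dsM hK).
  - by rewrite subr_eq0.
  - by rewrite /be !(mulrDl, mulrDr, mulrN) (cc b); zmod.
  - by rewrite /be !(mulrDl, mulrDr, mulNr) (cc b); zmod.
have key x : K x -> b * x <> x * b -> comm b x = be^-1 * (c * c).
  move=> Kx ne.
  have x0 : x != 0 by apply/eqP => e; apply: ne; rewrite e mulr0 mul0r.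
  have ux := dsU hK Kx x0.
  have Xx : unit_in R x by apply: (unit_in_K hK gB).
  set y := comm (c + b) x.
  have By : B y.
    apply: alpha_homogeneous; first exact: HX.
    have [R1 _ RV] := Xc; have [Ra _ RaV] := Xx.
    by rewrite /y /comm; do !apply: (srM RB).
  set w := comm b x.
  have Kw : K w.
    by rewrite /w /comm; apply: (dsM hK) => //; apply: nBK => //; apply: (dsV hK).
  have w1 : w <> 1 by move=> e; apply: ne; rewrite [LHS]commE // -/w e mulr1.
  have E : c + b * w = c * y + b * y.
    have -> : c * y + b * y = (c + b) * y by rewrite mulrDl.
    have [_ uu _] := Xc.
    rewrite /y /w /comm !mulrA !mulrV // !mul1r mulrDr mulrDl; congr (_ + _).
    by rewrite -mulrA cc mulrA mulVr // mul1r.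
  clearbody y w.
  have [Ay|nAy] := pselect (A y).
    have Ky := AK Ay.
    have Kcy : K (c - c * y) by apply: (dsB hK) => //; apply: (dsM hK).
    have y1 : c - c * y = 0.
      apply: (coef (c := 1) (y := b * y - b * w)) => //; [exact: (grp1 gB)| |].
        by rewrite mul1r; apply: (eq_by_diff E); zmod.
      have P1 : B b /\ ~ A (1^-1 * b) by rewrite invr1 mul1r.
      by apply: (spanB hK); apply: kspan1.
    have {}y1 : y = 1 by apply: (mulrI uc); rewrite mulr1; apply/esym/subr0_eq.
    case: w1; apply/subr0_eq.
    apply: (coef (c := b) (y := 0)) => //; [exact: (dsB hK)| |exact: kspan0].
    by rewrite mulrBr mulr1; move: E; rewrite y1 !mulr1 => /addrI ->; rewrite subrr.
  have By' : B (b * y) by apply: (grpM gB).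
  have [Aby|nAby] := pselect (A (b * y)); last first.
    have /eqP : c = 0.
      apply: (coef (c := 1) (y := y * c + b * y - b * w)) => //; [exact: (grp1 gB)| |].
        by rewrite mul1r -(cc y); apply: (eq_by_diff E); zmod.
      apply: (spanB hK); first apply: spanD.
      - by apply: kspan1 => //; rewrite invr1 mul1r.
      - by apply: (spanb hK); rewrite invr1 mul1r.
      - by apply: kspan1 => //; rewrite invr1 mul1r.
    by rewrite (negbTE c0).
  have Kby := AK Aby.
  have c_by : c - b * y = 0.
    apply: (coef (c := 1) (y := y * c - b * w)); [exact: (grp1 gB)|exact: (dsB hK)| |].
      by rewrite mul1r -(cc y); apply: (eq_by_diff E); zmod.
    by apply: (spanB hK); apply: kspan1 => //; rewrite invr1 mul1r.
  have yE : y = b * (be^-1 * (b * y)).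
    have cbe : b * be^-1 = be^-1 * b.
      by apply: (mulrI ube); apply: (mulIr ube); rewrite mulVKr // -!mulrA mulVr // mulr1 /be mulrA.
    by rewrite mulrA cbe -!mulrA [b * (b * y)]mulrA mulKr.
  have E0 : c = b * y := subr0_eq c_by.
  have yE' : y = b * (be^-1 * c) by rewrite E0.
  have Kw' : K (w - be^-1 * (c * c)).
    by apply: (dsB hK) => //; do !apply: (dsM hK) => //; apply: (dsV hK).
  apply/subr0_eq; apply: (coef (c := b) (y := 0)) => //; last exact: kspan0.
  have -> : b * (w - be^-1 * (c * c)) = b * w - c * y.
    by rewrite mulrBr (cc y) [in RHS]yE' !mulrA.
  by apply: (eq_by_diff E); rewrite -E0; zmod.
have [x Ax nex] := alpha_witness (BM Bb) nAb.
have Kx := AK Ax.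
have nx : b * x <> x * b by move=> e; apply: nex.
have nx1 : b * (1 + x) <> (1 + x) * b.
  by rewrite mulrDr mulrDl mulr1 mul1r => /addrI.
have K1x : K (1 + x) by apply: (dsD hK).
have x1 : 1 + x != 0 by apply/eqP => e; apply: nx1; rewrite e mulr0 mul0r.
have ux := grpU gA Ax; have ux1 := dsU hK K1x x1.
(* The same value rho for x and for 1 + x forces b = b rho. *)
have := key _ Kx nx; have := key _ K1x nx1; set rho := be^-1 * _ => e1 e2.
have h1 : b * (1 + x) = (1 + x) * b * rho by rewrite -e1; apply: commE.
have h2 : b * x = x * b * rho by rewrite -e2; apply: commE.
have : b = b * rho.
  by move: h1; rewrite mulrDr mulr1 h2 !mulrDl mul1r => /addIr.
move=> h; apply: nx; rewrite h2 -mulrA -h //.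
Qed.

Lemma alpha_false : False.
Proof.
have [p2|p2] := eqVneq p 2%N.
  have c1 : central (1 : L) by move=> z; rewrite mul1r mulr1.
  (* Either 1 or t has a square different from b^2. *)
  have [e|ne] := eqVneq (1 * 1) (b * b); last exact: (alpha_two p2 c1 (oner_neq0 _) ne).
  by apply: (alpha_two p2 ct t0); rewrite -e mulr1.
have {}p2 : (2 < p)%N by rewrite ltn_neqAle eq_sym p2 prime_gt1.
have [e|ne] := eqVneq ((- b) ^+ p) 1; first exact: alpha_nonunit_plus1.
apply: alpha_unit_plus1 => //.
have Kbp : K ((- b) ^+ p).
  rewrite exprNn; apply: (dsM hK); last exact: AK.
  by apply: (dsX hK); apply: (dsN hK).
have e := subrX1 (- b) p.
apply: (@geom_unit ((- b) ^+ p) (\sum_(i < p) (- b) ^+ i)) => //.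
- by apply: (sr_sum RB) => i _; apply: (srX RB); apply: (srN RB).
- by rewrite subr_eq0 eq_sym.
- by apply: (srD RB) => //; apply: (sr1 RB).
- rewrite mulr_sumr mulr_suml; apply: eq_bigr => i _.
  by apply: commrX; rewrite /GRing.comm; ncring.
- have -> : 1 + b = - (- b - 1) by zmod.
  by rewrite mulNr -e opprB.
Qed.
End Alpha.

(** * Torsion modulo A when B centralises K *)

Section Beta.
Variables (L : unitRingType) (K A B M : L -> Prop).
Hypotheses (hK : division_subring K) (cK : forall x y, K x -> K y -> x * y = y * x).
Hypothesis ZK : forall z, central z -> K z.
Hypotheses (gA : grp A) (gB : grp B) (gM : grp M).
Hypothesis AK : forall a, A a -> K a.
Hypothesis nB : normalized_by M B.
Hypothesis bK : forall b k, B b -> K k -> b * k = k * b.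
Hypothesis BA : forall x y, B x -> B y -> A (comm x y).
Hypothesis zB : forall b, B b -> ~ A b -> exists2 x, B x & comm b x <> 1.

Lemma beta_norm : normalized_by B K.
Proof.
move=> b k Bb Kk; have ub := grpU gB Bb.
by rewrite -mulrA -(bK Bb Kk) mulKr.
Qed.

Lemma beta_twisting : twisting K A B.
Proof.
move=> b Bb nAb; have [x Bx c1] := zB Bb nAb.
exists x; split=> //; [exact: (grpU gB)|by move=> k; apply: bK|].
by move=> b' Bb'; apply: BA.
Qed.

Local Notation R := (kspan K B).
Local Notation coef := (coset_coef hK cK gB AK beta_twisting).
Let RB := span_sub hK gB beta_norm ZK.
Let K1 : K 1. Proof. exact: (ds1 hK). Qed.
Let B1 : B 1. Proof. exact: (grp1 gB). Qed.

Variables (b x : L).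
Hypotheses (Bb : B b) (Bx : B x) (c1 : comm b x <> 1).
Let ub : b \is a GRing.unit. Proof. exact: (grpU gB). Qed.
Let ux : x \is a GRing.unit. Proof. exact: (grpU gB). Qed.
Local Notation w := (comm b x).
Let Aw : A w. Proof. exact: BA. Qed.
Let Kw : K w. Proof. exact: AK. Qed.
Let uw : w \is a GRing.unit. Proof. exact: (grpU gA). Qed.
Let bx : b * x = x * b * w. Proof. exact: commE. Qed.
Let xVbx : x^-1 * b * x = b * w. Proof. by rewrite -mulrA bx -mulrA mulKr. Qed.

Let Acent a b' : A a -> B b' -> b'^-1 * a * b' = a.
Proof. by move=> Aa Bb'; rewrite -mulrA -(bK Bb' (AK Aa)) mulKr // (grpU gB). Qed.

Let nAb : ~ A b.
Proof.
by move=> Ab; apply: c1; apply: comm1 => //; rewrite (bK Bx (AK Ab)).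
Qed.
Let nAx : ~ A x.
Proof.
by move=> Ax; apply: c1; apply: comm1 => //; apply: (bK Bb (AK Ax)).
Qed.
Let w1 : w - 1 \is a GRing.unit.
Proof. by apply: (dsU hK); [apply: (dsB hK)|rewrite subr_eq0; apply/eqP]. Qed.

Let AV a : A a^-1 -> A a. Proof. by move=> h; rewrite -[a]invrK; apply: (grpV gA). Qed.
Let AMr a y : A a -> A (y * a) -> A y.
Proof. by move=> Aa Ay; rewrite -[y](mulrK (grpU gA Aa)); apply: (grpM gA) => //; apply: (grpV gA). Qed.

Section Prime.
Variable p : nat.
Hypotheses (pp : prime p) (Abp : A (b ^+ p)).

Lemma root_pow : w ^+ p = 1.
Proof.
have ubp := grpU gA Abp.
have : x^-1 * b ^+ p * x = b ^+ p by apply: Acent.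
rewrite conjX // xVbx exprMn_comm; last by rewrite /GRing.comm bK.
by move=> e; apply: (mulrI ubp); rewrite mulr1.
Qed.

Lemma root_sum : \sum_(i < p) w ^+ i = 0.
Proof.
have := subrX1 w p; rewrite root_pow subrr => /esym e.
by apply: (mulrI w1); rewrite e mulr0.
Qed.

Lemma rootV_sum : \sum_(i < p) w^-1 ^+ i = 0.
Proof.
have := subrX1 w^-1 p; rewrite exprVn root_pow invr1 subrr => /esym e.
have u : w^-1 - 1 \is a GRing.unit.
  have -> : w^-1 - 1 = - (w - 1) * w^-1 by rewrite mulNr mulrBl mulrV // mul1r opprB.
  by rewrite unitrMl ?unitrV // unitrN.
by apply: (mulrI u); rewrite e mulr0.
Qed.

Hypothesis HX : forall u v, unit_in R u -> unit_in R v -> M (comm u v).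

(** With e the sum of the powers of b / g, the element X = e x has square zero. The commutator of 1
    + X with b is known only to normalise [B], but it conjugates b to b + X mu, which has nonzero
    components in p cosets and so is not in [B]. *)
Lemma beta_power g : K g -> b ^+ p = g ^+ p -> False.
Proof.
move=> Kg bg.
have g0 : g != 0.
  apply/eqP => g0; have := grpU gA Abp; rewrite bg g0 expr0n.
  by rewrite eqn0Ngt (prime_gt0 pp) /= unitr0.
have ug := dsU hK Kg g0.
have KgV := dsV hK Kg.
pose b1 := b * g^-1.
have b1p : b1 ^+ p = 1.
  rewrite exprMn_comm; last by rewrite /GRing.comm bK.
  by rewrite exprVn bg mulrV // unitrX.
have Rb1 : R b1 by apply: kspan1.
pose e := \sum_(i < p) b1 ^+ i.
have Re : R e by apply: (sr_sum RB) => i _; apply: (srX RB).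
have b1e : b1 * e = e.
  have := subrX1 b1 p; rewrite b1p subrr mulrBl mul1r => /esym/subr0_eq.
  by rewrite -/e.
have eb1 : e * b1 = e.
  rewrite -{2}b1e /e mulr_suml mulr_sumr; apply: eq_bigr => i _.
  by rewrite -exprS -exprSr.
have Rcom y k : R y -> K k -> y * k = k * y.
  move=> Ry Kk; elim/span_ind': Ry => [|b' k' z Bb' Kk' _ ih]; first by rewrite mulr0 mul0r.
  by rewrite mulrDl mulrDr ih; congr (_ + _); rewrite -mulrA (cK Kk' Kk) !mulrA (bK Bb' Kk).
have be : b * e = g * e.
  by rewrite -{2}b1e /b1 (bK Bb KgV) !mulrA mulrV // mul1r.
have eb : e * b = e * g.
  have -> : b = b1 * g by rewrite /b1 mulrVK.
  by rewrite mulrA eb1.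
pose X := e * x.
have RX : R X by apply: (srM RB) => //; apply: (spanb hK).
have xb : x * b = b * x * w^-1 by rewrite bx mulrK.
have Xb : X * b = X * (g * w^-1).
  rewrite /X -!mulrA xb !mulrA eb -!mulrA; congr (_ * _).
  by rewrite [g * (x * _)]mulrA -(bK Bx Kg) -!mulrA.
have bX : b * X = g * X by rewrite /X !mulrA be.
have Xb1 : X * b1 = X * w^-1.
  by rewrite /b1 mulrA Xb (cK Kg (dsV hK Kw)) -!mulrA mulrV // mulr1.
(* Right multiplication by b1 acts on [X] as w^-1, so X e contains the vanishing sum of the powers
   of w^-1. *)
have Xe : X * e = 0.
  have -> : X * e = X * \sum_(i < p) w^-1 ^+ i.
    rewrite /e !mulr_sumr; apply: eq_bigr => i _.
    elim: (nat_of_ord i) => [|j ih]; first by rewrite !expr0.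
    have cj : b1 ^+ j * w^-1 = w^-1 * b1 ^+ j by apply: Rcom; [apply: (srX RB)|apply: (dsV hK)].
    by rewrite [b1 ^+ _]exprS mulrA Xb1 -mulrA -cj mulrA ih -mulrA -exprSr.
  by rewrite rootV_sum mulr0.
have XX : X * X = 0 by rewrite {2}/X mulrA Xe mul0r.
have [uv vu] := sq0_inv XX.
have RE1 : R 1 by apply: (sr1 RB).
have Xu : unit_in R (1 + X).
  apply: (unit_in_span hK (s := 1 - X) (d := 1)) => //.
  - exact: (srD RB).
  - exact: (srB RB).
  - exact: oner_neq0.
have Xbu : unit_in R b by apply: unit_in_B.
have uu : 1 + X \is a GRing.unit by case: Xu.
have uV : (1 + X)^-1 = 1 - X by apply: (mulrI uu); rewrite mulrV // uv.
pose ka := w^-1 - 1.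
have Kka : K ka by apply: (dsB hK) => //; apply: (dsV hK).
have My := HX Xu Xbu.
have Ey : comm (1 + X) b = 1 + X * ka.
  rewrite /comm uV.
  have -> : (1 - X) / b * (1 + X) * b = (1 - X) * (b^-1 * (1 + X) * b) by rewrite !mulrA.
  have -> : b^-1 * (1 + X) * b = 1 + X * w^-1.
    rewrite mulrDr mulrDl mulr1 mulVr //; congr (_ + _).
    rewrite -mulrA Xb mulrA.
    have -> : b^-1 * X = g^-1 * X by apply: (mulrI ub); rewrite mulVKr // mulrA (bK Bb KgV) -mulrA bX mulKr.
    by rewrite -(Rcom X) // -!mulrA mulKr.
  have aux : X * (X * w^-1) = 0 by rewrite mulrA XX mul0r.
  have aux' (Y Z : L) : Y * Z = 0 -> (1 - Y) * (1 + Z) = 1 + (Z - Y).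
    by move=> YZ; rewrite !(mulrDl, mulrDr, mulNr, mulr1, mul1r) YZ; zmod.
  by rewrite (aux' _ _ aux) /ka mulrBr mulr1.
have Bb'' := nB My Bb.
pose mu := - (g * (ka * ka)).
have ug' : ka \is a GRing.unit.
  have -> : ka = - (w - 1) * w^-1 by rewrite /ka mulNr mulrBl mulrV // mul1r opprB.
  by rewrite unitrMl ?unitrV // unitrN.
have umu : mu \is a GRing.unit by rewrite unitrN !unitrMl.
have Kmu : K mu by apply: (dsN hK); do !apply: (dsM hK).
set b2 := (comm (1 + X) b)^-1 * b * comm (1 + X) b in Bb''.
have Eb2 : b2 = b + X * mu.
  have Xk2 : X * ka * (X * ka) = 0.
    by rewrite mulrA (Rcom X ka) // -[ka * X * X]mulrA XX mulr0 mul0r.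
  have [q1 q2] := sq0_inv Xk2.
  rewrite /b2 Ey.
  have -> : (1 + X * ka)^-1 = 1 - X * ka.
    have uk : 1 + X * ka \is a GRing.unit by apply/unitrP; exists (1 - X * ka).
    by apply: (mulrI uk); rewrite mulrV // q1.
  have t1 : b * (X * ka) = X * (g * ka) by rewrite mulrA bX -(Rcom X) // -mulrA.
  have t2 : X * ka * b = X * (g * w^-1 * ka).
    by rewrite -mulrA -(bK Bb Kka) mulrA Xb -!mulrA.
  have t3 : X * ka * (X * (g * ka)) = 0.
    by rewrite [LHS]mulrA (Rcom X ka) // -[ka * X * X]mulrA XX mulr0 mul0r.
  have t4 : g * ka - g * w^-1 * ka = mu.
    by rewrite /mu /ka !(mulrDl, mulrDr, mulNr, mulrN, mulr1, mul1r, mulrA, opprK, opprD); zmod.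
  have aux (Y Z : L) : Y * b = Y * b -> (1 - Y) * b * (1 + Z) = b + (b * Z - Y * b) - Y * (b * Z).
    by move=> _; rewrite !(mulrDl, mulrDr, mulNr, mulr1, mul1r, mulrA); zmod.
  by rewrite aux // t1 t2 -mulrBr t4 t3 subr0.
clearbody b2.
have Bxi i : B (b ^+ i * x) by apply: (grpM gB) => //; apply: grpX.
have EX : X * mu = \sum_(i < p) (b ^+ i * x) * (g^-1 ^+ i * mu).
  rewrite /X /e !mulr_suml; apply: eq_bigr => i _.
  rewrite exprMn_comm; last by rewrite /GRing.comm bK.
  have ck : g^-1 ^+ i * x = x * g^-1 ^+ i by rewrite (bK Bx (dsX hK i KgV)).
  by rewrite -!mulrA; congr (_ * _); rewrite mulrA ck -mulrA.
have Aconj y : A (x^-1 * y * x) -> A y.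
  move=> h; suff -> : y = x^-1 * y * x by [].
  by apply: (mulIr ux); rewrite -(bK Bx (AK h)) !mulrA mulrV // mul1r.
have fin (j : 'I_p) : ~ A ((b ^+ j * x)^-1 * b2) -> False.
  move=> nAj.
  have ubj : b ^+ j \is a GRing.unit by rewrite unitrX.
  have Kgm i : K (g^-1 ^+ i * mu) by apply: (dsM hK) => //; apply: (dsX hK).
  have : g^-1 ^+ j * mu = 0.
    apply: (coef (c := b ^+ j * x) (y := b2 - b - \sum_(i < p | i != j) (b ^+ i * x) * (g^-1 ^+ i * mu))) => //.
      by rewrite Eb2 EX (bigD1 j) //=; zmod.
    apply: (spanB hK); [apply: (spanB hK); apply: (spanb hK); split=> //|].
      rewrite invrM // => h.
      set a := x^-1 / _ * b in h; have ua := grpU gA h.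
      have Ex : x = (b ^+ j)^-1 * b * a^-1.
        by apply: (mulIr ua); rewrite mulrVK // /a !mulrA mulrV // mul1r.
      have cb : GRing.comm b ((b ^+ j)^-1 * b).
        by apply: commrM => //; apply: commrV; apply: commrX.
      apply: c1; apply: comm1 => //; rewrite Ex mulrA cb -!mulrA; congr (_ * (_ * _)).
      by apply: bK => //; apply: AK; apply: (grpV gA).
    apply: kspan_sum => i ne; apply: kspan1 => //.
    split=> //; rewrite invrM // [_ * (b ^+ i * x)]mulrA => /=.
    have -> : x^-1 / b ^+ j * b ^+ i * x = x^-1 * ((b ^+ j)^-1 * b ^+ i) * x by rewrite !mulrA.
    move=> /Aconj; case: (ltngtP i j) => [lt|lt|e']; last by case/eqP: ne; apply: val_inj.
      rewrite -(subnKC (ltnW lt)) exprD invrM ?unitrX // mulrVK ?unitrX // => /AV.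
      by apply: (pow_notin gA pp) => //; rewrite subn_gt0 lt /= (leq_ltn_trans (leq_subr _ _) (ltn_ord j)).
    rewrite -(subnKC (ltnW lt)) exprD mulrA mulVr ?unitrX // mul1r.
    by apply: (pow_notin gA pp) => //; rewrite subn_gt0 lt /= (leq_ltn_trans (leq_subr _ _) (ltn_ord i)).
  move=> z; have := umu; have ugj : g^-1 ^+ j \is a GRing.unit by rewrite unitrX ?unitrV.
  by rewrite -(unitrMr _ ugj) z unitr0.
apply: (fin (Ordinal (prime_gt0 pp))) => /= h0.
apply: (fin (Ordinal (prime_gt1 pp))) => /= h1.
apply: nAb; apply: Aconj.
move: h0 h1; rewrite expr0 expr1 mul1r invrM // => h0 h1.
have ub2 := grpU gB Bb''.
have -> : x^-1 * b * x = (x^-1 * b2) * (x^-1 / b * b2)^-1.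
  have uxb : x^-1 / b \is a GRing.unit by rewrite unitrMl ?unitrV.
  have e1 : (x^-1 / b)^-1 = b * x by apply: (mulrI uxb); rewrite mulrV // !mulrA mulrVK // mulVr.
  by rewrite (invrM uxb ub2) e1 !mulrA mulrK.
by apply: (grpM gA) => //; apply: (grpV gA).
Qed.

(** y = [comm (1 + b) x] need not lie in [B], but z = x^-1 (y^-1 x y) does, and (1 + b o)^2 = (1 +
    b) (1 + b o^2) z with o = [comm b x]. Comparing cosets leaves z = 1, or p = 3 with 3 o = 0; both
    lead to (o - 1)^2 = 0. *)
Lemma beta_p3 : (2 < p)%N -> 1 + b \is a GRing.unit -> M (comm (1 + b) x) -> False.
Proof.
move=> p2 uu My.
have uy : comm (1 + b) x \is a GRing.unit by apply: comm_unit.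
move: (Aw) (Kw) (uw) (xVbx) (w1) root_pow root_sum.
generalize (comm b x) => o Ao Ko uo xVbo o1u ro so.
have uyE : (1 + b) * comm (1 + b) x = 1 + b * o.
  by rewrite /comm !mulrA mulrV // mul1r mulrDr mulrDl mulr1 mulVr // xVbo.
move: My uy uyE; generalize (comm (1 + b) x) => y My uy uyE.
have bo : b * o = o * b by apply: bK.
have yb : y * b = b * y.
  apply: (mulrI uu); rewrite !mulrA uyE.
  have -> : (1 + b) * b = b * (1 + b) by rewrite mulrDl mulrDr mul1r mulr1.
  by rewrite -mulrA uyE mulrDl mulrDr mul1r mulr1 -mulrA -bo.
have yo : y * o = o * y.
  apply: (mulrI uu); rewrite !mulrA uyE.
  have -> : (1 + b) * o = o * (1 + b) by rewrite mulrDl mulrDr mul1r mulr1 bo.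
  by rewrite -mulrA uyE mulrDl mulrDr mul1r mulr1 [o * (b * o)]mulrA -bo.
have xVo : x^-1 * o * x = o by rewrite -mulrA -(bK Bx Ko) mulKr.
set y' := x^-1 * y * x.
have E1 : (1 + b * o) * y' = 1 + b * (o * o).
  have cM q r : x^-1 * (q * r) * x = (x^-1 * q * x) * (x^-1 * r * x).
    by rewrite !mulrA mulrK.
  have cD q r : x^-1 * (q + r) * x = x^-1 * q * x + x^-1 * r * x.
    by rewrite mulrDr mulrDl.
  have cg1 : x^-1 * 1 * x = 1 by rewrite mulr1 mulVr.
  have := congr1 (fun q => x^-1 * q * x) uyE.
  by rewrite /= cM !cD cg1 xVbo cM xVbo xVo => e; rewrite /y' e mulrA.
set z := y'^-1 * y.
have uy' : y' \is a GRing.unit by rewrite unitrMl // unitrMr // unitrV.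
have yz : y = y' * z by rewrite /z mulVKr.
have Bz : B z.
  have -> : z = x^-1 * (y^-1 * x * y).
    by rewrite /z /y' !invrM ?invrK ?unitrV // ?unitrMr ?unitrV // !mulrA.
  by apply: (grpM gB); [apply: (grpV gB)|apply: nB].
have E : (1 + b * o) * (1 + b * o) = (1 + b) * (1 + b * (o * o)) * z.
  rewrite -{1}uyE -[(1 + b) * y * _]mulrA.
  have -> : y * (1 + b * o) = (1 + b * o) * y by rewrite mulrDr mulrDl mulr1 mul1r mulrA yb -mulrA yo mulrA.
  by rewrite yz -E1 !mulrA.
clearbody z => {uyE E1 yz uy'}.
have zo : o * z = z * o by rewrite (bK Bz Ko).
have Koo : K (o * o) by apply: (dsM hK).
have zoo : (o * o) * z = z * (o * o) by rewrite (bK Bz Koo).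
have E2 : 1 + b * (o + o) + b * b * (o * o) = z + b * z * (1 + o * o) + b * b * z * (o * o).
  move: E; rewrite !(mulrDl, mulrDr, mulr1, mul1r) => E.
  have e1 : b * o * (b * o) = b * b * (o * o) by rewrite -!mulrA [o * (b * o)]mulrA -bo !mulrA.
  have e2 : b * (o * o) * z = b * z * (o * o) by rewrite -mulrA zoo mulrA.
  have e3 : b * (b * (o * o)) * z = b * b * z * (o * o).
    by rewrite mulrA -mulrA zoo mulrA.
  by rewrite e1 e2 e3 in E; apply: (eq_by_diff E); zmod.
move=> {E}.
have nA i : (0 < i < p)%N -> ~ A (b ^+ i) by apply: (pow_notin gA pp).
have nAb2 : ~ A (b * b) by rewrite -expr2; apply: nA.
have K1oo : K (1 + o * o) by apply: (dsD hK).
have Koo2 : K (o + o) by apply: (dsD hK).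
have Bbb : B (b * b) by apply: (grpM gB).
have Bbz : B (b * z) by apply: (grpM gB).
have Bbbz : B (b * b * z) by apply: (grpM gB).
have uz := grpU gB Bz.
have o1 : o - 1 != 0 by apply/eqP => e; move: o1u; rewrite e unitr0.
have sq0 : (o - 1) * (o - 1) = 0 -> False.
  by move=> e; move/eqP: o1; apply; apply: (mulrI o1u); rewrite e mulr0.
have finish3 : p = 3%N -> o + o + o = 0 -> False.
  move=> p3; have := so; rewrite p3 !big_ord_recr big_ord0 /= expr0 expr1 expr2 add0r => s3 h.
  apply: sq0; have h2 : (o - 1) * (o - 1) = (1 + o + o * o) - (o + o + o).
    by rewrite !(mulrDl, mulrDr, mulNr, mulrN, mulr1, mul1r, opprK); zmod.
  by rewrite h2 s3 h subr0.
have oo3 : p = 3%N -> 1 + o * o = - o.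
  by move=> p3; have := so; rewrite p3 !big_ord_recr big_ord0 /= expr0 expr1 expr2 add0r => s3; apply: (eq_by_diff s3); zmod.
have p3 : A (b ^+ 3) -> p = 3%N.
  move=> h; apply/eqP; rewrite eqn_leq p2 andbT leqNgt; apply/negP => lt.
  by apply: (nA 3%N _ h).
have [Az|nAz] := pselect (A z).
  have Kz := AK Az.
  have z1 : 1 - z = 0.
    apply: (coef (c := 1) (y := b * (z * (1 + o * o) - (o + o)) + b * b * (z * (o * o) - o * o))) => //; first exact: (dsB hK).
      by rewrite mul1r; apply: (eq_by_diff E2); rewrite !mulrBr !mulrA; zmod.
    by apply: spanD; apply: kspan1; rewrite ?invr1 ?mul1r //; apply: (dsB hK) => //; apply: (dsM hK).
  have {}z1 : z = 1 by apply/esym/subr0_eq.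
  apply: sq0; rewrite -oppr0; apply/eqP; rewrite -subr_eq0 opprK; apply/eqP.
  have h : (o + o) - (1 + o * o) = 0.
    apply: (coef (c := b) (y := 0)) => //; [exact: (dsB hK)| |exact: kspan0].
    by move: E2; rewrite z1 !mulr1 mulrBr => E2; apply: (eq_by_diff E2); zmod.
  by rewrite addr0 -oppr0 -h !(mulrDl, mulrDr, mulNr, mulrN, mulr1, mul1r, opprK); zmod.
have [Abz|nAbz] := pselect (A (b * z)).
  have Ka := AK Abz; set a := b * z in Abz Ka Bbz E2 *.
  have E3 : 1 + b * (o + o) + b * b * (o * o) = z + a * (1 + o * o) + b * (a * (o * o)).
    by rewrite E2 -!mulrA.
  have h1 c : A (z^-1 * c) -> A (b * c).
    move=> h; have -> : b * c = a * (z^-1 * c) by rewrite /a mulrA mulrK.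
    exact: (grpM gA).
  have h1V c : A (c^-1 * z) -> A (b * c).
    move=> h; have -> : b * c = a * (c^-1 * z)^-1.
      have [uc|nu] := boolP (c \is a GRing.unit).
        by rewrite invrM ?unitrV // invrK /a mulrA mulrK.
      by move: (grpU gA h); rewrite invr_out // unitrMl // (negbTE nu).
    by apply: (grpM gA) => //; apply: (grpV gA).
  have [Ab3|nAb3] := pselect (A (b ^+ 3)); last first.
    have /eqP : (1 : L) = 0.
      apply: (coef (c := z) (y := 1 * (1 - a * (1 + o * o)) + b * (o + o - a * (o * o)) + b * b * (o * o))) => //.
        by rewrite mulr1 mul1r; apply: (eq_by_diff (esym E3)); rewrite mulrBr; zmod.
      apply: spanD; first apply: spanD; apply: kspan1; try (split=> // /h1).
      - by rewrite mulr1.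
      - by apply: (dsB hK) => //; apply: (dsM hK).
      - by [].
      - by apply: (dsB hK) => //; apply: (dsM hK).
      - by rewrite mulrA -expr2 -exprSr.
      - by [].
    by rewrite oner_eq0.
  have e1 : 1 - a * (1 + o * o) = 0.
    apply: (coef (c := 1) (y := z + b * (a * (o * o) - (o + o)) - b * b * (o * o))) => //.
    - by apply: (dsB hK) => //; apply: (dsM hK).
    - by rewrite mul1r; apply: (eq_by_diff E3); rewrite mulrBr; zmod.
    apply: (spanB hK); [apply: spanD|]; [apply: (spanb hK)|apply: kspan1|apply: kspan1]; rewrite ?invr1 ?mul1r //.
    by apply: (dsB hK) => //; apply: (dsM hK).
  have e2 : o + o - a * (o * o) = 0.
    apply: (coef (c := b) (y := z + 1 * (a * (1 + o * o) - 1) - b * b * (o * o))) => //.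
    - by apply: (dsB hK) => //; apply: (dsM hK).
    - by rewrite mul1r mulrBr; apply: (eq_by_diff E3); zmod.
    apply: (spanB hK); [apply: spanD|].
    - by apply: (spanb hK); split=> // /h1V.
    - apply: kspan1; last by apply: (dsB hK) => //; apply: (dsM hK).
      by split=> //; rewrite mulr1 => /AV.
    - by apply: kspan1 => //; split=> //; rewrite mulKr.
  have p3' := p3 Ab3; apply: (finish3 p3').
  have ao : a * o = 1 + 1.
    by apply: (mulIr uo); rewrite mulrDl mul1r -mulrA; apply/esym/subr0_eq.
  have -> : o + o + o = (1 - a * (1 + o * o)) * o + ((1 + 1) * o + a * o * (1 + o * o)).
    have coo : (1 + o * o) * o = o * (1 + o * o) by rewrite mulrDl mulrDr mul1r mulr1 mulrA.
    by rewrite mulrBl mul1r -[a * (1 + o * o) * o]mulrA coo [a * (o * _)]mulrA mulrDl mul1r; zmod.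
  by rewrite e1 ao oo3 // mul0r add0r mulrN subrr.
have [Abbz|nAbbz] := pselect (A (b * b * z)); last first.
  have /eqP : (1 : L) = 0.
    apply: (coef (c := 1) (y := z + b * z * (1 + o * o) + b * b * z * (o * o) - b * (o + o) - b * b * (o * o))) => //.
      by rewrite mulr1; apply: (eq_by_diff E2); zmod.
    by apply: (spanB hK); [apply: (spanB hK); [apply: spanD; [apply: spanD; [apply: (spanb hK)|apply: kspan1]|apply: kspan1]|apply: kspan1]|apply: kspan1]; rewrite ?invr1 ?mul1r.
  by rewrite oner_eq0.
have Ka := AK Abbz; set a := b * b * z in Abbz Ka Bbbz E2 *.
have h1 c : A (z^-1 * c) -> A (b * b * c).
  move=> h; have -> : b * b * c = a * (z^-1 * c) by rewrite /a mulrA mulrK.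
  exact: (grpM gA).
have b3 : b * b * b = b ^+ 3 by rewrite -expr2 -exprSr.
have [Ab3|nAb3] := pselect (A (b ^+ 3)); last first.
  have nAb4 : ~ A (b ^+ 4).
    apply: nA => /=; rewrite ltn_neqAle; apply/andP; split.
      by apply/eqP => p4; move: pp; rewrite -p4.
    rewrite ltn_neqAle p2 andbT; apply/eqP => p3'; apply: nAb3; by rewrite p3'.
  have /eqP : (1 : L) = 0.
    apply: (coef (c := z) (y := 1 * (1 - a * (o * o)) + b * (o + o) + b * b * (o * o) - b * z * (1 + o * o))) => //.
      by rewrite mulr1 mul1r; apply: (eq_by_diff (esym E2)); zmod.
    apply: (spanB hK); [apply: spanD; [apply: spanD|]|]; apply: kspan1 => //.
    - by split=> // /h1; rewrite mulr1.
    - by apply: (dsB hK) => //; apply: (dsM hK).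
    - by split=> // /h1; rewrite b3.
    - by split=> // /h1; rewrite mulrA b3 -exprSr.
    - split=> // /h1; rewrite mulrA b3 => h.
      apply: nAb; have e4 : b * a = b ^+ 3 * z by rewrite /a !mulrA -b3.
      by apply: (AMr Abbz); rewrite e4.
  by rewrite oner_eq0.
have Ko1 : K (b ^+ 3) := AK Ab3.
have p3' := p3 Ab3; apply: (finish3 p3').
set be := b ^+ 3 in b3 Ab3 Ko1.
have ube := grpU gA Ab3.
set k1 := be^-1 * a.
have Kk1 : K k1 by apply: (dsM hK) => //; apply: (dsV hK).
have zE : z = b * k1.
  have cb : b * be^-1 = be^-1 * b by apply: bK => //; apply: (dsV hK).
  have ba : b * a = be * z by rewrite -b3 /a !mulrA.
  by rewrite /k1 mulrA cb -mulrA ba mulKr.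
have E4 : 1 + b * (o + o) + b * b * (o * o) = b * k1 + b * b * (k1 * (1 + o * o)) + a * (o * o).
  by rewrite E2 {1 2}zE !mulrA.
have e2 : o + o - k1 = 0.
  apply: (coef (c := b) (y := 1 * (a * (o * o) - 1) + b * b * (k1 * (1 + o * o) - o * o))) => //.
  - exact: (dsB hK).
  - by rewrite mul1r !mulrBr; apply: (eq_by_diff E4); zmod.
  apply: spanD; apply: kspan1; try (by split=> //; rewrite ?mulr1 ?mulKr // => /AV).
  - by apply: (dsB hK) => //; apply: (dsM hK).
  - by apply: (dsB hK) => //; apply: (dsM hK).
have e3 : o * o - k1 * (1 + o * o) = 0.
  apply: (coef (c := b * b) (y := 1 * (a * (o * o) - 1) + b * (k1 - (o + o)))) => //.
  - by apply: (dsB hK) => //; apply: (dsM hK).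
  - by rewrite mul1r !mulrBr; apply: (eq_by_diff E4); zmod.
  apply: spanD; apply: kspan1.
  - by split=> //; rewrite mulr1 => /AV.
  - by apply: (dsB hK) => //; apply: (dsM hK).
  - by split=> //; rewrite invrM // mulrVK // => /AV.
  - exact: (dsB hK).
have k1E : k1 = o + o by apply/esym/subr0_eq.
apply: (mulrI uo); rewrite mulr0 -e3 k1E oo3 // mulrN mulrDl !mulrDr; zmod.
Qed.
End Prime.

(** The Cayley transform of z equals (c + z)^2 / (c^2 - z^2). Its two components are nonzero because
    c^2 != -z^2 and because 2 c != 0. *)
Lemma inv_plus_x2 (z ze c : L) : z * z = ze -> K ze -> z * ze = ze * z -> central c -> c != 0 -> c * c != - ze ->
  (1 + 1 : L) != 0 -> (c + z) \is a GRing.unit -> (c - z) \is a GRing.unit ->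
  exists q r, [/\ K q, K r, q != 0, r != 0 & (c - z)^-1 * (c + z) = q + z * r].
Proof.
move=> zz Kze zze cc c0 cze two up um.
have Kc := ZK cc; have uc := dsU hK Kc c0.
have K2 : K (1 + 1) by apply: (dsD hK).
have u2 := dsU hK K2 two.
pose d := c * c - ze.
have Ed : (c - z) * (c + z) = d.
  by rewrite /d -zz !(mulrDl, mulrDr, mulrN, mulNr) (cc z); zmod.
have Ed' : (c + z) * (c - z) = d.
  by rewrite /d -zz !(mulrDl, mulrDr, mulrN, mulNr) (cc z); zmod.
have ud : d \is a GRing.unit by rewrite -Ed unitrMl.
have Kd : K d by apply: (dsB hK) => //; apply: (dsM hK).
have dz : z * d = d * z by rewrite /d mulrBr mulrBl zze mulrA -(cc z) -mulrA -(cc z) mulrA.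
have dVz : z * d^-1 = d^-1 * z.
  by apply: (mulrI ud); apply: (mulIr ud); rewrite mulVKr // -!mulrA mulVr // mulr1 dz.
have inv : (c - z)^-1 = d^-1 * (c + z).
  by apply: (mulIr um); rewrite mulVr // -mulrA Ed' mulVr.
exists (d^-1 * (c * c + ze)), (d^-1 * (c + c)); split.
- by do !apply: (dsM hK) => //; [apply: (dsV hK)|apply: (dsD hK) => //; apply: (dsM hK)].
- by apply: (dsM hK); [apply: (dsV hK)|apply: (dsD hK)].
- apply/eqP => e; move: cze; rewrite -subr_eq0 opprK -[_ + ze](mulKr (_ : d^-1 \is a GRing.unit)) ?unitrV //.
  by rewrite e mulr0 eqxx.
- apply/eqP => e; have : (c + c) = 0 by rewrite -[c + c](mulKr (_ : d^-1 \is a GRing.unit)) ?unitrV // e mulr0.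
  have -> : c + c = (1 + 1) * c by rewrite mulrDl mul1r.
  by move=> e'; have : (1 + 1) * c \is a GRing.unit; [rewrite unitrMl|rewrite e' unitr0].
- rewrite inv -mulrA [z * (d^-1 * _)]mulrA dVz -[d^-1 * z * _]mulrA -mulrDr; congr (_ * _).
  by rewrite -zz !(mulrDl, mulrDr) (cc z); zmod.
Qed.

Lemma conjV (p q : L) : p \is a GRing.unit -> q \is a GRing.unit ->
  (p^-1 * q * p)^-1 = p^-1 * q^-1 * p.
Proof.
move=> up uq; have upq : p^-1 * q \is a GRing.unit by rewrite unitrMl ?unitrV.
by rewrite invrM // invrM ?unitrV // invrK mulrA.
Qed.

(** Conjugation by b inverts y = (c' + x)^-1 (c' - x), and also its conjugate m by c + b, so m^2 =
    b^-1 (m^-1 b m) lies in [B]. Yet two Cayley transforms give m^2 nonzero components in the cosets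
    of x and of x b. [X] is abstract, as it stands for the units of R and later for a group of
    similitudes. *)
Lemma beta_two (X : L -> Prop) c c' : grp X -> (forall u v, X u -> X v -> M (comm u v)) ->
  X b -> X x -> A (b * b) -> A (x * x) -> w = -1 -> (1 + 1 : L) != 0 ->
  central c -> c != 0 -> c * c != - (b * b) -> X (c + b) ->
  central c' -> c' != 0 -> c' * c' != - (x * x) -> X (c' + x) -> False.
Proof.
move=> gX HX Xb Xx Abb Axx wm two cc c0 cb Xu cc' c0' cx Xu'.
set u := c + b in Xu; set u' := c' + x in Xu'.
have [uu uu'] := (grpU gX Xu, grpU gX Xu').
have bxN : b * x = - (x * b) by rewrite bx wm mulrN1.
have xVb : x^-1 * b * x = - b by rewrite xVbx wm mulrN1.
have bVx : b^-1 * x * b = - x.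
  by rewrite -mulrA; apply: (mulrI ub); rewrite mulVKr // mulrN bxN opprK.
have xVu : x^-1 * u * x = c - b.
  by rewrite /u mulrDr mulrDl -(cc x^-1) mulrVK // xVb.
have bVu : b^-1 * u' * b = c' - x.
  by rewrite /u' mulrDr mulrDl -(cc' b^-1) mulrVK // bVx.
have um : c - b \is a GRing.unit by rewrite -xVu unitrMl // unitrMr // unitrV.
have um' : c' - x \is a GRing.unit by rewrite -bVu unitrMl // unitrMr // unitrV.
set y := comm u' b.
have My : M y by apply: HX.
have Xy : X y by rewrite /y /comm; do !apply: (grpM gX) => //; apply: (grpV gX).
have yE : y = u'^-1 * (c' - x) by rewrite /y /comm -bVu !mulrA.
set m := u^-1 * y * u.
have Mm : M m.
  have uy := grpU gX Xy.
  have -> : m = y * comm y u by rewrite /m /comm !mulrA mulrV // mul1r.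
  by apply: (grpM gM) => //; apply: HX.
have com_x : u' * (c' - x) = (c' - x) * u'.
  by rewrite /u' !(mulrDl, mulrDr, mulrN, mulNr) (cc' x); zmod.
have yV : b^-1 * y * b = y^-1.
  have uy := grpU gX Xy.
  have bVu2 : b^-1 * (c' - x) * b = u'.
    by rewrite mulrBr mulrBl -(cc' b^-1) mulrVK // bVx opprK.
  rewrite yE invrM ?unitrV // invrK.
  have -> : b^-1 * (u'^-1 * (c' - x)) * b = (b^-1 * u' * b)^-1 * (b^-1 * (c' - x) * b).
    by rewrite conjV // !mulrA mulrK.
  by rewrite bVu bVu2.
have ub' : u * b = b * u by rewrite /u mulrDl mulrDr cc.
have mV : b^-1 * m * b = m^-1.
  have uy := grpU gX Xy.
  have cbV : b^-1 * u^-1 = u^-1 * b^-1 by rewrite -!invrM // ub'.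
  have -> : b^-1 * m * b = u^-1 * (b^-1 * y * b) * u.
    have q : u^-1 * (b^-1 * y * b) * u = u^-1 * b^-1 * y * (b * u) by rewrite !mulrA.
    by rewrite q -ub' -cbV /m !mulrA.
  by rewrite yV /m conjV.
have um0 : m \is a GRing.unit by apply: (grpU gM).
have Bmm : B (m * m).
  have -> : m * m = b^-1 * (m^-1 * b * m).
    have e : b^-1 * m^-1 * b = m.
      by rewrite -conjV // mV invrK.
    by rewrite !mulrA e.
  by apply: (grpM gB); [apply: (grpV gB)|apply: nB].
have Kbb := AK Abb; have Kxx := AK Axx.
have K2 : K (1 + 1) by apply: (dsD hK).
have u2 := dsU hK K2 two.
have cNp : c * c != - (b * b) by [].
have [q1 [r1 [Kq1 Kr1 nq1 nr1 e1]]] := inv_plus_x2 erefl Kbb (mulrA _ _ _) cc c0 cNp two uu um.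
have zx1 : - x * - x = x * x by rewrite mulrNN.
have zx2 : - x * (x * x) = x * x * - x by rewrite mulrN mulNr mulrA.
have ux2 : c' - - x \is a GRing.unit by rewrite opprK.
have [q2 [r2 [Kq2 Kr2 nq2 nr2 e2]]] := inv_plus_x2 zx1 Kxx zx2 cc' c0' cx two um' ux2.
rewrite opprK in e2.
have ye : y = q2 - x * r2.
  have -> : y = (c' + x)^-1 * (c' - x) by rewrite yE.
  by rewrite e2 mulNr.
have bKx k : K k -> k * x = x * k by move=> Kk; rewrite (bK Bx Kk).
have yy : y * y = (q2 * q2 + x * x * (r2 * r2)) - x * ((1 + 1) * (q2 * r2)).
  rewrite ye !(mulrDl, mulrDr, mulrN, mulNr, mul1r, opprK, opprD).
  have t1 : q2 * (x * r2) = x * (q2 * r2) by rewrite mulrA bKx // mulrA.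
  have t2 : x * r2 * q2 = x * (q2 * r2) by rewrite -mulrA (cK Kr2 Kq2).
  have t3 : x * r2 * (x * r2) = x * x * (r2 * r2) by rewrite -!mulrA [r2 * (x * _)]mulrA bKx // !mulrA.
  by rewrite t1 t2 t3; zmod.
set P := q2 * q2 + _ in yy; set Q := (1 + 1) * _ in yy.
have KP : K P by apply: (dsD hK); apply: (dsM hK) => //; apply: (dsM hK).
have KQ : K Q by do !apply: (dsM hK).
have [uq2 ur2] := (dsU hK Kq2 nq2, dsU hK Kr2 nr2).
have uQ : Q \is a GRing.unit by rewrite /Q !unitrMl.
clearbody P Q.
have uK k : K k -> u^-1 * k * u = k.
  have uRk : K k -> u * k = k * u by move=> Kk; rewrite /u mulrDl mulrDr cc (bK Bb Kk).
  by move=> Kk; rewrite -mulrA -uRk // mulKr.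
have xu : u^-1 * x * u = x * (q1 + b * r1).
  have -> : u^-1 * x * u = x * ((x^-1 * u * x)^-1 * u).
    by rewrite conjV // !mulrA mulrV // mul1r.
  by rewrite xVu e1.
have mm : m * m = P - (x * (q1 * Q) + x * b * (r1 * Q)).
  have -> : m * m = u^-1 * (y * y) * u by rewrite /m !mulrA mulrK.
  rewrite yy mulrBr mulrBl uK //; congr (_ - _).
  have -> : u^-1 * (x * Q) * u = (u^-1 * x * u) * (u^-1 * Q * u) by rewrite !mulrA mulrK.
  by rewrite xu uK // mulrDr mulrDl !mulrA.
have Bxb : B (x * b) by apply: (grpM gB).
have [nAm|Am] := pselect (~ A (x^-1 * (m * m))).
  have z : q1 * Q = 0.
    apply: (coef (c := x) (y := P - m * m - x * b * (r1 * Q))) => //; first exact: (dsM hK).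
      by rewrite mm; zmod.
    apply: (spanB hK); [apply: (spanB hK)|].
    - by rewrite -[P]mul1r; apply: kspan1 => //; split=> //; rewrite mulr1 => /AV.
    - exact: (spanb hK).
    - by apply: kspan1; [split=> //; rewrite mulKr|apply: (dsM hK)].
  by have := dsU hK Kq1 nq1; rewrite -(unitrMl _ uQ) z unitr0.
have {}Am : A (x^-1 * (m * m)) by apply: contrapT.
have z : r1 * Q = 0.
  apply: (coef (c := x * b) (y := P - m * m - x * (q1 * Q))) => //; first exact: (dsM hK).
    by rewrite mm; zmod.
  apply: (spanB hK); [apply: (spanB hK)|].
  - rewrite -[P]mul1r; apply: kspan1 => //; split=> //; rewrite mulr1 => /AV h.
    apply: c1; apply: comm1 => //.
    have -> : x = x * b * b^-1 by rewrite mulrK.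
    by rewrite mulrA (bK Bb (AK h)) mulrVK // mulrK.
  - apply: (spanb hK); split=> // => h; apply: nAb; apply: AV.
    by apply: (AMr Am); rewrite mulrA -invrM.
  - apply: kspan1; last by apply: (dsM hK).
    by split=> //; rewrite invrM // mulrVK // => /AV.
by have := dsU hK Kr1 nr1; rewrite -(unitrMl _ uQ) z unitr0.
Qed.
End Beta.

Lemma unit_in_grp (L : unitRingType) (S : L -> Prop) : subring_over_center S -> grp (unit_in S).
Proof.
move=> hS; split.
- by move=> x [].
- by split; rewrite ?unitr1 ?invr1 //; apply: (sr1 hS).
- move=> x y [Sx ux SVx] [Sy uy SVy]; split; first exact: (srM hS).
    by rewrite unitrMl.
  by rewrite invrM //; apply: (srM hS).
- by move=> x [Sx ux SVx]; split; rewrite ?invrK ?unitrV.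
Qed.

Section BetaFalse.
Variables (L : unitRingType) (K A B M : L -> Prop).
Hypotheses (hK : division_subring K) (cK : forall x y, K x -> K y -> x * y = y * x).
Hypothesis ZK : forall z, central z -> K z.
Hypotheses (gA : grp A) (gB : grp B) (gM : grp M).
Hypothesis AK : forall a, A a -> K a.
Hypothesis nB : normalized_by M B.
Hypothesis bK : forall b k, B b -> K k -> b * k = k * b.
Hypothesis BA : forall x y, B x -> B y -> A (comm x y).
Hypothesis zB : forall b, B b -> ~ A b -> exists2 x, B x & comm b x <> 1.
Local Notation R := (kspan K B).
Hypothesis HX : forall u v, unit_in R u -> unit_in R v -> M (comm u v).
Variables (p : nat) (t : L).
Hypotheses (pp : prime p) (Bp : forall b, B b -> A (b ^+ p)).
Hypotheses (ct : central t) (t0 : t != 0) (t1 : t * t != 1).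

Lemma comm_sign b x : B b -> B x -> p = 2%N -> comm b x <> 1 -> comm b x = -1 /\ (1 + 1 : L) != 0.
Proof.
move=> Bb Bx p2 c1.
have := root_pow gA gB AK bK BA Bb Bx (Bp Bb); rewrite p2 expr2 => ww.
have Kw : K (comm b x) by apply: AK; apply: BA.
have u1 : comm b x - 1 \is a GRing.unit.
  by apply: (dsU hK); [apply: (dsB hK) => //; apply: (ds1 hK)|rewrite subr_eq0; apply/eqP].
have e : comm b x = -1.
  apply: subr0_eq; rewrite opprK; apply: (mulrI u1).
  by rewrite mulr0 mulrDr mulrBl ww mul1r mulr1; zmod.
split=> //; apply/eqP => two; apply: c1; rewrite e.
by apply: (eq_by_diff (esym two)); zmod.
Qed.

Lemma choose_square_ne (z : L) : exists c, [/\ central c, c != 0 & c * c != z].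
Proof.
case: (eqVneq (1 * 1) z) => [e|ne].
  by exists t; split=> //; rewrite -e mulr1.
by exists 1; split=> //; [apply: central1|apply: oner_neq0].
Qed.

(** The split on p-th powers of [K] decides invertibility: if b^p is none of them, then 1 + b for
    odd p, and d + b with d central for p = 2, is a unit of R. *)
Lemma beta_false : (exists2 b, B b & ~ A b) -> False.
Proof.
move=> [b Bb nAb]; have [x Bx c1] := zB Bb nAb.
have nBK := beta_norm gB bK.
have RB := span_sub hK gB nBK ZK.
have c2 : comm x b <> 1.
  move=> e; apply: c1; apply: comm1; rewrite ?(grpU gB) //.
  by rewrite [RHS]commE ?(grpU gB) // e mulr1.
have [[g Kg e]|ng] := pselect (exists2 g, K g & b ^+ p = g ^+ p).
  exact: (beta_power hK cK ZK gA gB AK nB bK BA zB Bb Bx c1 pp (Bp Bb) HX Kg e).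
have [[g Kg e]|ng'] := pselect (exists2 g, K g & x ^+ p = g ^+ p).
  exact: (beta_power hK cK ZK gA gB AK nB bK BA zB Bx Bb c2 pp (Bp Bx) HX Kg e).
have Rb : R b by apply: spanb.
have Rx : R x by apply: spanb.
have Xb : unit_in R b by apply: unit_in_B.
have Xx : unit_in R x by apply: unit_in_B.
have [p2|p2] := eqVneq p 2%N.
  have [w1 two] := comm_sign Bb Bx p2 c1.
  have Abb : A (b * b) by have := Bp Bb; rewrite p2 expr2.
  have Axx : A (x * x) by have := Bp Bx; rewrite p2 expr2.
  have [c [cc c0 cb]] := choose_square_ne (- (b * b)).
  have [c' [cc' c0' cx]] := choose_square_ne (- (x * x)).
  have key z d : R z -> A (z * z) -> central d -> ~ (exists2 g, K g & z ^+ p = g ^+ p) -> unit_in R (d + z).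
    move=> Rz Az cd nz; have Kd := ZK cd; have Rd := srZ RB cd.
    apply: (unit_in_span hK (s := d - z) (d := d * d - z * z)).
    - exact: (srD RB).
    - exact: (srB RB).
    - by apply: (dsB hK); [apply: (dsM hK)|apply: AK].
    - rewrite subr_eq0; apply/eqP => e; apply: nz; exists d => //.
      by rewrite p2 !expr2.
    - by rewrite !(mulrDl, mulrDr, mulrN) (cd z); zmod.
    - by rewrite !(mulrDl, mulrDr, mulNr) (cd z); zmod.
  apply: (beta_two hK cK ZK gA gB gM AK nB bK BA zB Bb Bx c1 (X := unit_in R) (c := c) (c' := c')) => //.
  - exact: unit_in_grp.
  - exact: key.
  - exact: key.
have {}p2 : (2 < p)%N by rewrite ltn_neqAle eq_sym p2 prime_gt1.
have X1b : unit_in R (1 + b).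
  have Kbp : K ((- b) ^+ p).
    rewrite exprNn; apply: (dsM hK); last by apply: AK; apply: Bp.
    by apply: (dsX hK); apply: (dsN hK); apply: (ds1 hK).
  have e := subrX1 (- b) p.
  have E : (1 + b) * (\sum_(i < p) (- b) ^+ i) = 1 - (- b) ^+ p.
    have -> : 1 + b = - (- b - 1) by zmod.
    by rewrite mulNr -e opprB.
  apply: (unit_in_span hK (s := \sum_(i < p) (- b) ^+ i) (d := 1 - (- b) ^+ p)) => //.
  - by apply: (srD RB) => //; apply: (sr1 RB).
  - by apply: (sr_sum RB) => i _; apply: (srX RB); apply: (srN RB).
  - by apply: (dsB hK) => //; apply: (ds1 hK).
  - rewrite subr_eq0; apply/eqP => e1; apply: ng; exists (-1).
      by apply: (dsN hK); apply: (ds1 hK).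
    have e2 : (-1) ^+ p * b ^+ p = 1 by rewrite -exprNn -e1.
    by rewrite -[LHS]mul1r -{1}(sqrr_sign L p) expr2 -mulrA e2 mulr1.
  - rewrite -E mulr_sumr mulr_suml; apply: eq_bigr => i _.
    by apply/esym; apply: commrX; rewrite /GRing.comm; ncring.
apply: (beta_p3 hK cK gA gB AK nB bK BA zB Bb Bx c1 pp (Bp Bb) p2) => //.
  by case: X1b.
exact: HX.
Qed.
End BetaFalse.

(** * Torsion-free case *)

Section Order.
Variables (L : unitRingType) (A B : L -> Prop).
Hypotheses (gA : grp A) (gB : grp B) (AB : forall a, A a -> B a).
Hypothesis BA : forall x y, B x -> B y -> A (comm x y).
Hypothesis tfree : forall b n, B b -> (0 < n)%N -> A (b ^+ n) -> A b.

(** The positive cone of a partial order on B / A, given as a union of cosets; its invariance under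
    conjugation follows from [B, B] being in [A]. *)
Record cone (P : L -> Prop) : Prop := Cone {
  coneB : forall x, P x -> B x;
  coneM : forall x y, P x -> P y -> P (x * y);
  coneA : forall x, P x -> ~ A x;
  coneMl : forall a x, A a -> P x -> P (a * x);
  coneMr : forall a x, A a -> P x -> P (x * a) }.

Lemma A_normal b a : B b -> A a -> A (b^-1 * a * b).
Proof.
move=> Bb Aa; have ua := grpU gA Aa; have ub := grpU gB Bb.
have -> : b^-1 * a * b = a * comm a b by rewrite /comm !mulrA mulrV // mul1r.
by apply: (grpM gA) => //; apply: BA => //; apply: AB.
Qed.
Lemma A_normal' b a : B b -> A a -> A (b * a * b^-1).
Proof.
by move=> Bb Aa; rewrite -{1}[b]invrK; apply: A_normal => //; apply: (grpV gB).
Qed.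

Lemma coneJ P b x : cone P -> B b -> P x -> P (b^-1 * x * b).
Proof.
move=> cP Bb Px; have Bx := coneB cP Px; have ux := grpU gB Bx; have ub := grpU gB Bb.
have -> : b^-1 * x * b = x * comm x b by rewrite /comm !mulrA mulrV // mul1r.
by apply: (coneMr cP) => //; apply: BA.
Qed.

Lemma coneX P x n : cone P -> P x -> (0 < n)%N -> P (x ^+ n).
Proof.
move=> cP Px; case: n => // n _; elim: n => [|n ih]; first by rewrite expr1.
by rewrite exprS; apply: (coneM cP).
Qed.

Definition extend_cone (P : L -> Prop) b x :=
  exists q i, x = q * b ^+ i /\ (P q \/ (A q /\ (0 < i)%N)).

Lemma extend_coneP P b : cone P -> B b -> ~ A b ->
  (forall i, (0 < i)%N -> ~ P (b ^+ i)^-1) -> cone (extend_cone P b).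
Proof.
move=> cP Bb nAb nP.
have ub := grpU gB Bb.
have Bbi i : B (b ^+ i) by apply: grpX.
have qB q i : P q \/ (A q /\ (0 < i)%N) -> B q.
  by case=> [/(coneB cP)//|[/AB]].
have AM a q i : A a -> P q \/ (A q /\ (0 < i)%N) -> P (a * q) \/ (A (a * q) /\ (0 < i)%N).
  by move=> Aa [Pq|[Aq i0]]; [left; apply: (coneMl cP)|right; split=> //; apply: (grpM gA)].
have MA a q i : A a -> P q \/ (A q /\ (0 < i)%N) -> P (q * a) \/ (A (q * a) /\ (0 < i)%N).
  by move=> Aa [Pq|[Aq i0]]; [left; apply: (coneMr cP)|right; split=> //; apply: (grpM gA)].
split.
- by move=> _ [q [i [-> h]]]; apply: (grpM gB) => //; apply: qB h.
- move=> _ _ [q [i [-> h]]] [q' [j [-> h']]].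
  have Bq := qB _ _ h; have Bq' := qB _ _ h'.
  have ubi := grpU gB (Bbi i); have uq' := grpU gB Bq'.
  set c := comm (b ^+ i) q'; have Ac : A c by apply: BA.
  set c' := b ^+ i * c * (b ^+ i)^-1; have Ac' : A c' by apply: A_normal'.
  exists (q * q' * c'), (i + j)%N; split.
    have e : b ^+ i * q' = q' * b ^+ i * c by apply: commE.
    have e' : b ^+ i * c = c' * b ^+ i by rewrite /c' mulrVK.
    have -> : q * b ^+ i * (q' * b ^+ j) = q * (b ^+ i * q') * b ^+ j by rewrite !mulrA.
    have -> : q * q' * c' * b ^+ (i + j) = q * q' * (c' * b ^+ i) * b ^+ j by rewrite exprD !mulrA.
    by rewrite e -e' !mulrA.
  case: h => [Pq|[Aq i0]].
    left; apply: (coneMr cP) => //; case: h' => [Pq'|[Aq' _]]; first exact: (coneM cP).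
    exact: (coneMr cP).
  case: h' => [Pq'|[Aq' _]]; first by left; apply: (coneMr cP) => //; apply: (coneMl cP).
  by right; split; [exact: (grpM gA (grpM gA Aq Aq') Ac')|rewrite addn_gt0 i0].
- move=> _ [q [i [-> h]]] Aqb; case: h => [Pq|[Aq i0]]; last first.
    apply: nAb; apply: (tfree Bb i0).
    by rewrite -[b ^+ i](mulKr (grpU gA Aq)); apply: (grpM gA) => //; apply: (grpV gA).
  case: i Aqb => [|i]; first by rewrite expr0 mulr1 => /(coneA cP).
  move=> Aqb; apply: (nP i.+1 isT).
  have uq := grpU gB (coneB cP Pq).
  have -> : (b ^+ i.+1)^-1 = (q * b ^+ i.+1)^-1 * q.
    by rewrite invrM ?unitrX // mulrVK.
  by apply: (coneMl cP) => //; apply: (grpV gA).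
- move=> a _ Aa [q [i [-> h]]]; exists (a * q), i; rewrite mulrA; split=> //; exact: AM.
- move=> a _ Aa [q [i [-> h]]].
  exists (q * (b ^+ i * a * (b ^+ i)^-1)), i; split.
    by rewrite !mulrA mulrVK // unitrX.
  by apply: MA => //; apply: A_normal'.
Qed.

(** If neither b nor its inverse could be adjoined to a maximal cone, the cone would contain b^-i
    and b^j for some i, j > 0, and hence 1. *)
Lemma exists_order : exists P, cone P /\ forall b, B b -> [\/ A b, P b | P b^-1].
Proof.
have [F HF HU|P [cP maxP]] := @Zorn_bigcup L cone.
  split.
  - by move=> x [P FP Px]; apply: (coneB (HF _ FP)).
  - move=> x y [P FP Px] [P' FP' Py].
    case: (HU _ _ FP FP') => sub.
      by exists P' => //; apply: (coneM (HF _ FP')) => //; apply: sub.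
    by exists P => //; apply: (coneM (HF _ FP)) => //; apply: sub.
  - by move=> x [P FP Px]; apply: (coneA (HF _ FP)).
  - by move=> a x Aa [P FP Px]; exists P => //; apply: (coneMl (HF _ FP)).
  - by move=> a x Aa [P FP Px]; exists P => //; apply: (coneMr (HF _ FP)).
exists P; split=> // b Bb.
have [Ab|nAb] := pselect (A b); first by apply: Or31.
have [Pb|nPb] := pselect (P b); first by apply: Or32.
have [PbV|nPbV] := pselect (P b^-1); first by apply: Or33.
exfalso.
have ub := grpU gB Bb.
have key c : B c -> ~ A c -> ~ P c -> exists2 i, (0 < i)%N & P (c ^+ i)^-1.
  move=> Bc nAc nPc; apply: contrapT => h.
  apply: (maxP (extend_cone P c)); last first.
    by apply: extend_coneP => // i i0 Pc; apply: h; exists i.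
  split; first by move=> x Px; exists x, 0%N; rewrite expr0 mulr1; split=> //; left.
  move=> sub; apply: nPc; apply: sub; exists 1, 1%N; rewrite mul1r expr1; split=> //.
  by right; split=> //; apply: (grp1 gA).
have [i i0 Pi] := key b Bb nAb nPb.
have [|j j0 Pj] := key b^-1 (grpV gB Bb) _ nPbV.
  by move=> /(grpV gA); rewrite invrK.
apply: (coneA cP (x := 1)); last exact: (grp1 gA).
have -> : (1 : L) = ((b ^+ i)^-1) ^+ j * ((b^-1 ^+ j)^-1) ^+ i.
  by rewrite -!exprVn invrK -!exprM mulnC exprVn mulVr // unitrX.
by apply: (coneM cP); apply: coneX.
Qed.
End Order.

Section Domain.
Variables (L : unitRingType) (K A B : L -> Prop).
Hypotheses (hK : division_subring K) (cK : forall x y, K x -> K y -> x * y = y * x).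
Hypothesis ZK : forall z, central z -> K z.
Hypotheses (gA : grp A) (gB : grp B) (AK : forall a, A a -> K a) (AB : forall a, A a -> B a).
Hypothesis nBK : normalized_by B K.
Hypothesis tw : twisting K A B.
Hypothesis BA : forall x y, B x -> B y -> A (comm x y).
Hypothesis tfree : forall b n, B b -> (0 < n)%N -> A (b ^+ n) -> A b.
Local Notation R := (kspan K B).
Local Notation coef := (coset_coef hK cK gB AK tw).

(** A nonzero combination has a term strictly above all others. Terms of one coset are merged and
    may then cancel, so the induction is on the number of terms and not term by term. *)
Lemma spn_leading (P : L -> Prop) : cone A B P -> (forall b, B b -> [\/ A b, P b | P b^-1]) ->
  forall n (Q : L -> Prop) s, (forall c, Q c -> B c) -> spn K Q n s -> s <> 0 ->
  exists b k r m, [/\ Q b, K k, k != 0 & [/\ s = b * k + r, (m < n)%N & spn K (fun c => Q c /\ P (c^-1 * b)) m r]].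
Proof.
move=> cP tot; elim/ltn_ind => n IH Q s QB sp s0.
inversion sp as [|n' b' k' z Qb' Kk' sz en es]; subst; first by [].
have Bb' := QB _ Qb'; have ub' := grpU gB Bb'.
have [k0'|k0'] := eqVneq k' 0.
  have z0 : z <> 0 by move=> z0; apply: s0; rewrite k0' z0 mulr0 addr0.
  have [b [k [r [m [Qb Kk k0 [e lt sr]]]]]] := IH _ (ltnSn _) Q z QB sz z0.
  exists b, k, r, m; split=> //; split=> //; first by rewrite k0' mulr0 add0r.
  exact: ltnW.
have [z0|z0] := pselect (z = 0).
  exists b', k', 0, 0%N; split=> //; split=> //; first by rewrite z0.
  exact: spn0.
have [b [k [r [m [Qb Kk k0 [e lt sr]]]]]] := IH _ (ltnSn _) Q z QB sz z0.
have Bb := QB _ Qb; have ub := grpU gB Bb.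
have weak (Q1 Q2 : L -> Prop) j x : (forall c, Q1 c -> Q2 c) -> spn K Q1 j x -> spn K Q2 j x.
  by move=> sub; elim=> [|i c l y Qc Kl _ ih]; [apply: spn0|apply: spnS => //; apply: sub].
have [|Abb|Pbb|Pbb] := tot (b^-1 * b'); first by apply: (grpM gB) => //; apply: (grpV gB).
- have Ka := AK Abb; set a := b^-1 * b' in Abb Ka.
  have eb : b' = b * a by rewrite /a mulVKr.
  have es : b' * k' + z = b * (a * k' + k) + r by rewrite e eb mulrDr !mulrA addrA.
  have [c0|c0] := eqVneq (a * k' + k) 0.
    rewrite es c0 mulr0 add0r in s0 *.
    have [b2 [k2 [r2 [m2 [[Qb2 _] Kk2 k20 [e2 lt2 sr2]]]]]] := IH m (ltnW lt) (fun c => Q c /\ P (c^-1 * b)) r (fun c (h : _ /\ _) => QB c (proj1 h)) sr s0.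
    exists b2, k2, r2, m2; split=> //; split=> //; first by apply: (ltn_trans lt2); apply: ltnW.
    by apply: weak sr2 => c [[]].
  exists b, (a * k' + k), r, m; split=> //; first by apply: (dsD hK) => //; apply: (dsM hK).
  by split=> //; apply: ltnW.
- exists b', k', z, m.+1; split=> //; split=> //.
  rewrite e; apply: spnS => //; apply: weak sr => c [Qc Pc]; split=> //.
  have -> : c^-1 * b' = (c^-1 * b) * (b^-1 * b') by rewrite -mulrA mulVKr.
  exact: (coneM cP).
- exists b, k, (b' * k' + r), m.+1; split=> //; split=> //; first by rewrite e addrCA.
  apply: spnS => //; split=> //.
  by move: Pbb; rewrite invrM ?unitrV // invrK.
Qed.

(** The product of the leading terms is strictly above all other products and cannot be
    cancelled. *)
Lemma kspan_domain x y : R x -> R y -> x * y = 0 -> x = 0 \/ y = 0.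
Proof.
move=> [n sx] [n' sy] xy; apply: contrapT => /not_orP[x0 y0].
have [P [cP tot]] := exists_order gA gB AB BA tfree.
have [b [k [r [m [Bb Kk k0 [ex _ sr]]]]]] := spn_leading cP tot (fun _ h => h) sx x0.
have [b' [k' [r' [m' [Bb' Kk' k0' [ey _ sr']]]]]] := spn_leading cP tot (fun _ h => h) sy y0.
have [ub ub'] := (grpU gB Bb, grpU gB Bb').
pose low c := B c /\ P (c^-1 * (b * b')).
have Bbb : B (b * b') by apply: (grpM gB).
have prod (c c' l l' : L) : B c -> B c' -> K l -> K l' -> P ((c * c')^-1 * (b * b')) -> kspan K low (c * l * (c' * l')).
  move=> Bc Bc' Kl Kl' Pc; have uc' := grpU gB Bc'.
  have -> : c * l * (c' * l') = (c * c') * ((c'^-1 * l * c') * l') by rewrite !mulrA mulrK.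
  by apply: kspan1; [split=> //; apply: (grpM gB)|apply: (dsM hK) => //; apply: nBK].
have cc (c c' : L) : B c -> B c' -> (c * c')^-1 * (b * b') = c'^-1 * (c^-1 * b) * c' * (c'^-1 * b').
  by move=> Bc Bc'; rewrite invrM ?(grpU gB) // !mulrA mulrK ?(grpU gB).
have ks : kspan K (fun c => B c /\ P (c^-1 * b)) r by exists m.
have ks' : kspan K (fun c => B c /\ P (c^-1 * b')) r' by exists m'.
have l1 : kspan K low (b * k * r').
  elim/span_ind': ks' => [|c l z [Bc Pc] Kl _ ih]; first by rewrite mulr0; apply: kspan0.
  rewrite mulrDr; apply: spanD => //; apply: prod => //.
  by rewrite cc // mulVr // mulr1 mulVr ?(grpU gB) // mul1r.
have l23 : kspan K low (r * (b' * k' + r')).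
  elim/span_ind': ks => [|c l z [Bc Pc] Kl _ ih]; first by rewrite mul0r; apply: kspan0.
  rewrite mulrDl; apply: spanD => //; rewrite mulrDr; apply: spanD.
    apply: prod => //; rewrite cc // mulVr // mulr1.
    exact: (coneJ gB BA cP).
  elim/span_ind': ks' => [|c' l' z' [Bc' Pc'] Kl' _ ih']; first by rewrite mulr0; apply: kspan0.
  rewrite mulrDr; apply: spanD => //; apply: prod => //; rewrite cc //.
  by apply: (coneM cP) => //; apply: (coneJ gB BA cP).
have Kb : K (b'^-1 * k * b') by apply: nBK.
have : (b'^-1 * k * b') * k' = 0.
  apply: (coef (c := b * b') (y := - (b * k * r' + r * (b' * k' + r')))) => //; first exact: (dsM hK).
    have -> : b * b' * (b'^-1 * k * b' * k') = b * k * (b' * k') by rewrite !mulrA mulrK.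
    move: xy; rewrite ex {1}ey => xy.
    by apply: (eq_by_diff xy); rewrite mulrDl [b * k * (b' * k' + r')]mulrDr; zmod.
  apply: (spanN hK); apply: span_mono (spanD l1 l23) => c [Bc Pc]; split=> // Ac.
  apply: (coneA cP Pc); have -> : c^-1 * (b * b') = ((b * b')^-1 * c)^-1.
    by rewrite invrM ?invrK ?unitrV ?(grpU gB).
  exact: (grpV gA).
have uk := dsU hK Kk k0; have uk' := dsU hK Kk' k0'.
move=> z; have : b'^-1 * k * b' * k' \is a GRing.unit by rewrite !(unitrMl, unitrV).
by rewrite z unitr0.
Qed.
End Domain.

Lemma exp_beats_power k : exists m, (m.+1 ^ k < 2 ^ m)%N.
Proof.
(* With m + 1 a power of 2, both sides become powers of 2 and only exponents are compared. *)
exists (2 ^ (2 * k.+1)).-1; rewrite prednK ?expn_gt0 // -expnM ltn_exp2l //.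
have h : ((2 * k.+1) * k + 1 < 2 ^ (2 * k.+1))%N.
  by rewrite expnM; elim: k => [|k IH]; rewrite ?expn1 // expnS; move: (_ ^ _)%N IH => q; nia.
by rewrite -ltnS prednK ?expn_gt0 // -addn1.
Qed.

(** * Polynomial growth and common multiples *)

Section Growth.
Variables (L : unitRingType) (K A B : L -> Prop).
Hypotheses (hK : division_subring K) (cK : forall x y, K x -> K y -> x * y = y * x).
Hypothesis ZK : forall z, central z -> K z.
Hypotheses (gA : grp A) (gB : grp B) (AK : forall a, A a -> K a) (AB : forall a, A a -> B a).
Hypothesis nBK : normalized_by B K.
Hypothesis BA : forall x y, B x -> B y -> A (comm x y).
Hypothesis domR : forall x y, kspan K B x -> kspan K B y -> x * y = 0 -> x = 0 \/ y = 0.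
Local Notation R := (kspan K B).
Implicit Types (gs ws : seq L).
Local Notation lspan ws := (kspan K (fun c => c \in ws)).

Fixpoint monomials gs m : seq L :=
  if gs is g :: gs' then [seq g ^+ a * w | a <- iota 0 m.+1, w <- monomials gs' m] else [:: 1].

Lemma size_monomials gs m : size (monomials gs m) = (m.+1 ^ size gs)%N.
Proof.
by elim: gs => //= g gs ih; rewrite (size_allpairs (fun a w => g ^+ a * w) (0%N :: iota 1 m)) /= size_iota ih expnS.
Qed.

Lemma monomialsP g gs m x :
  reflect (exists a w, [/\ (a <= m)%N, w \in monomials gs m & x = g ^+ a * w])
    (x \in monomials (g :: gs) m).
Proof.
have iot a : (a \in iota 0 m.+1) = (a <= m)%N by rewrite mem_iota.
apply: (iffP allpairsP) => [[[a w] [ha hw ->]]|[a [w [ha hw ->]]]].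
  by exists a, w; split=> //; rewrite -iot.
by exists (a, w); split=> //; rewrite iot.
Qed.

Lemma monomials_mono gs m x : x \in monomials gs m -> x \in monomials gs m.+1.
Proof.
elim: gs x => // g gs ih x /monomialsP[a [w [ha hw ->]]].
by apply/monomialsP; exists a, w; split; [apply: leqW|apply: ih|].
Qed.

Lemma monomials_B gs m x : (forall g, g \in gs -> B g) -> x \in monomials gs m -> B x.
Proof.
elim: gs x => [|g gs ih] x hgs; first by rewrite inE => /eqP ->; apply: (grp1 gB).
move=> /monomialsP[a [w [_ hw ->]]]; apply: (grpM gB).
  by apply: grpX => //; apply: hgs; rewrite mem_head.
by apply: ih => // g' hg'; apply: hgs; rewrite inE hg' orbT.
Qed.

(** As B / A is abelian, [g] moves to its place in the monomial at the cost of a factor from [A],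
    which is pushed to the right and absorbed by [K]. *)
Lemma monomials_mul gs m g w : (forall g, g \in gs -> B g) -> g \in gs -> w \in monomials gs m ->
  exists w' a, [/\ w' \in monomials gs m.+1, A a & g * w = w' * a].
Proof.
elim: gs w => // g0 gs ih w hgs hg /monomialsP[i [v [hi hv ->]]].
have Bg0 : B g0 by apply: hgs; rewrite mem_head.
have hgs' g' : g' \in gs -> B g' by move=> h; apply: hgs; rewrite inE h orbT.
move: hg; rewrite inE => /orP[/eqP ->|hg].
  exists (g0 ^+ i.+1 * v), 1; rewrite mulr1 mulrA -exprS; split=> //; last exact: (grp1 gA).
  by apply/monomialsP; exists i.+1, v; split=> //; apply: monomials_mono.
have [w' [a [hw' Aa e]]] := ih v hgs' hg hv.
have Bg := hgs' _ hg; have Bi : B (g0 ^+ i) by apply: grpX.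
have Bv : B v by apply: monomials_B hv.
exists (g0 ^+ i * w'), (a * (v^-1 * comm g (g0 ^+ i) * v)); split.
- by apply/monomialsP; exists i, w'; split=> //; apply: leqW.
- by apply: (grpM gA) => //; apply: (A_normal gA gB AB BA) => //; apply: BA.
have -> : g0 ^+ i * w' * (a * (v^-1 * comm g (g0 ^+ i) * v)) =
  g0 ^+ i * (w' * a) * v^-1 * comm g (g0 ^+ i) * v by rewrite !mulrA.
by rewrite -e !mulrA !mulrK ?mulrV ?mul1r ?(grpU gB).
Qed.

Lemma lspan_mul gs m s x : (forall g, g \in gs -> B g) -> lspan gs s -> lspan (monomials gs m) x ->
  lspan (monomials gs m.+1) (s * x).
Proof.
move=> hgs ss sx; elim/span_ind': ss => [|g k z hg Kk _ ih]; first by rewrite mul0r; apply: kspan0.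
rewrite mulrDl; apply: spanD => //.
elim/span_ind': sx {ih} => [|w k' y hw Kk' _ ih]; first by rewrite mulr0; apply: kspan0.
rewrite mulrDr; apply: spanD => //.
have [w' [a [hw' Aa e]]] := monomials_mul hgs hg hw.
have Bw := monomials_B hgs hw.
have -> : g * k * (w * k') = w' * (a * (w^-1 * k * w) * k').
  by rewrite !mulrA -e mulrK ?(grpU gB).
by apply: kspan1 => //; apply: (dsM hK) => //; apply: (dsM hK); [apply: AK|apply: nBK].
Qed.

Lemma lspan_coef ws x : lspan ws x ->
  exists2 a : 'I_(size ws) -> L, forall j, K (a j) & x = \sum_(j < size ws) ws`_j * a j.
Proof.
elim/span_ind' => [|b k z hb Kk _ [a Ka ->]].
  by exists (fun=> 0) => [_|]; [apply: ds0|rewrite big1 // => i _; rewrite mulr0].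
have lt : (index b ws < size ws)%N by rewrite index_mem.
exists (fun j => a j + (if j == Ordinal lt then k else 0)).
  by move=> j; apply: (dsD hK) => //; case: ifP => // _; apply: ds0.
under [RHS]eq_bigr => j _ do rewrite mulrDr.
rewrite big_split /= addrC; congr (_ + _).
rewrite (bigD1 (Ordinal lt)) //= eqxx big1 ?addr0 ?nth_index // => j /negbTE ->.
by rewrite mulr0.
Qed.

Lemma lspan_support n x : spn K B n x -> exists2 gs : seq L, (forall g, g \in gs -> B g) & lspan gs x.
Proof.
elim=> [|i b k y Bb Kk _ [gs hgs ih]]; first by exists [::] => //; apply: kspan0.
exists (b :: gs); first by move=> g; rewrite inE => /orP[/eqP ->|/hgs].
apply: spanS => //; first by rewrite mem_head.
by apply: span_mono ih => c hc; rewrite inE hc orbT.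
Qed.

Definition kindep r (X : 'I_r -> L) := forall c : 'I_r -> L, (forall i, K (c i)) ->
  \sum_i X i * c i = 0 -> forall i, c i = 0.

Lemma kindep_size ws r (X : 'I_r -> L) : kindep X -> (forall i, lspan ws (X i)) -> (r <= size ws)%N.
Proof.
move=> iX sX; rewrite leqNgt; apply/negP => lt.
have /choice[a ha] : forall i, exists a : 'I_(size ws) -> L, (forall j, K (a j)) /\ X i = \sum_(j < size ws) ws`_j * a j.
  by move=> i; have [a Ka e] := lspan_coef (sX i); exists a.
have [c [Kc [[i nz] hc]]] := linear_dependence hK lt (fun i j => (ha i).1 j).
move/eqP: nz; apply; apply: iX => //.
under eq_bigr => i' _ do rewrite (ha i').2 mulr_suml.
rewrite exchange_big /= big1 // => j _.
rewrite -[RHS](mulr0 ws`_j) -[X in _ = _ * X](hc j) mulr_sumr; apply: eq_bigr => i' _.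
by rewrite -mulrA (cK (Kc i') ((ha i').1 j)).
Qed.

(* Without a common right multiple, the 2^m words of length m in s and s' would be independent over K, inside the span of (m+1)^d monomials. *)
Lemma kspan_ore s s' : R s -> R s' -> s != 0 -> s' != 0 ->
  exists x y, [/\ R x, R y, s * x = s' * y & s * x != 0].
Proof.
move=> Rs Rs' nz nz'; apply: contrapT => nex.
have nor x y : R x -> R y -> s * x = s' * y -> x = 0 /\ y = 0.
  move=> Rx Ry e; have [sx|sx] := eqVneq (s * x) 0; last by case: nex; exists x, y.
  split.
    by case: (domR Rs Rx sx) => // s0; rewrite s0 eqxx in nz.
  by case: (domR Rs' Ry (etrans (esym e) sx)) => // s0; rewrite s0 eqxx in nz'.
have [n sn] := Rs; have [n' sn'] := Rs'.
have [gs1 h1 l1] := lspan_support sn; have [gs2 h2 l2] := lspan_support sn'.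
pose gs := gs1 ++ gs2.
have hgs g : g \in gs -> B g by rewrite mem_cat => /orP[/h1|/h2].
have ls : lspan gs s by apply: span_mono l1 => c; rewrite mem_cat => ->.
have ls' : lspan gs s' by apply: span_mono l2 => c; rewrite mem_cat => ->; rewrite orbT.
clearbody gs.
have toR m x : lspan (monomials gs m) x -> R x by apply: span_mono => c; apply: monomials_B.
have grow m : exists X : 'I_(2 ^ m) -> L, kindep X /\ forall i, lspan (monomials gs m) (X i).
  elim: m => [|m [X [iX sX]]].
    exists (fun=> 1); split; last first.
      move=> _; apply: (spanb hK); elim: (gs) => [|g l ih]; first by rewrite mem_head.
      by apply/monomialsP; exists 0%N, 1; rewrite expr0 mulr1.
    move=> c _; rewrite big_ord1 mul1r => c0 i; rewrite (_ : i = ord0) //.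
    by case: i => [[]] //= lt; apply: val_inj.
  rewrite expnS mul2n -addnn.
  exists (fun i => match fintype.split i with inl j => s * X j | inr j => s' * X j end); split; last first.
    by move=> i; case: (fintype.split i) => j; apply: lspan_mul.
  move=> c Kc; rewrite big_split_ord /= => h.
  have RX m' (d : 'I_m' -> L) (Y : 'I_m' -> L) : (forall i, K (d i)) -> (forall i, R (Y i)) -> R (\sum_i Y i * d i).
    by move=> Kd RY; apply: kspan_sum => i _; apply: (spanZ hK).
  have [] := nor (\sum_i X i * c (lshift _ i)) (\sum_i X i * - c (rshift _ i)).
  - by apply: RX => // i; apply: toR (sX i).
  - by apply: RX => [i|i]; [apply: (dsN hK)|apply: toR (sX i)].
  - rewrite !mulr_sumr; move: h.
    under eq_bigr => i _ do rewrite -/(unsplit (inl i)) unsplitK -mulrA.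
    under [X in _ + X]eq_bigr => i _ do rewrite -/(unsplit (inr i)) unsplitK -mulrA.
    move=> /addr0_eq e; apply: oppr_inj; apply: etrans e _; rewrite -sumrN.
    by apply: eq_bigr => i _; rewrite !mulrN opprK.
  move=> /iX h3 /iX h4 i; rewrite -(splitK i); case: (fintype.split i) => j /=.
    by apply: h3 => k; apply: Kc.
  by apply/eqP; rewrite -oppr_eq0; apply/eqP; apply: h4 => k; apply: (dsN hK).
have [m hm] := exp_beats_power (size gs).
have [X [iX sX]] := grow m.
by have := kindep_size iX sX; rewrite size_monomials leqNgt hm.
Qed.
End Growth.

Lemma unit_neq0 (R : unitRingType) (x : R) : x \is a GRing.unit -> x != 0.
Proof. by apply: contraTN => /eqP ->; rewrite unitr0. Qed.

(** * Division rings of right fractions *)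

Section Fractions.
Variables (L : unitRingType) (R : L -> Prop).
Hypothesis hR : subring_over_center R.
Hypothesis uR : forall x, R x -> x != 0 -> x \is a GRing.unit.
Hypothesis oreR : forall x y, R x -> R y -> x != 0 -> y != 0 ->
  exists x' y', [/\ R x', R y', x * x' = y * y' & x * x' != 0].

Definition fractions x := exists s d, [/\ R s, R d, d != 0 & x = s * d^-1].

Lemma fractions_incl x : R x -> fractions x.
Proof. by move=> Rx; exists x, 1; split=> //; rewrite ?oner_neq0 ?invr1 ?mulr1 //; apply: (sr1 hR). Qed.

Lemma fractionsB x y : fractions x -> fractions y -> fractions (x - y).
Proof.
move=> [s [d [Rs Rd d0 ->]]] [s' [d' [Rs' Rd' d0' ->]]].
have [a [b [Ra Rb e nz]]] := oreR Rd Rd' d0 d0'.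
have [ud ud'] := (uR Rd d0, uR Rd' d0').
have ue : d * a \is a GRing.unit by apply: uR => //; apply: (srM hR).
exists (s * a - s' * b), (d * a); split=> //.
- by apply: (srB hR); apply: (srM hR).
- exact: (srM hR).
apply: (mulIr ue); rewrite mulrVK // mulrBl [in X in X - _]mulrA mulrVK //; congr (_ - _).
by rewrite e mulrA mulrVK.
Qed.

Lemma fractionsM x y : fractions x -> fractions y -> fractions (x * y).
Proof.
move=> [s [d [Rs Rd d0 ->]]] [s' [d' [Rs' Rd' d0' ->]]].
have [ud ud'] := (uR Rd d0, uR Rd' d0').
case: (eqVneq s' 0) => [->|nz'].
  by rewrite mul0r mulr0; apply: fractions_incl; apply: (sr0 hR).
(* The common multiple d a = s' b turns d^-1 s' into a b^-1. *)
have [a [b [Ra Rb e nz]]] := oreR Rd Rs' d0 nz'.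
have us' := uR Rs' nz'.
have b0 : b != 0 by apply: contra nz => /eqP b0; rewrite e b0 mulr0.
have ub := uR Rb b0.
exists (s * a), (d' * b); split.
- exact: (srM hR).
- exact: (srM hR).
- by apply: unit_neq0; rewrite unitrMl.
have udb : d' * b \is a GRing.unit by rewrite unitrMl.
apply: (mulIr udb); rewrite mulrVK // !mulrA mulrVK // -[s * d^-1 * s' * b]mulrA -e.
by rewrite mulrA mulrVK.
Qed.

Lemma fractionsV x : fractions x -> fractions x^-1.
Proof.
move=> [s [d [Rs Rd d0 ->]]]; have ud := uR Rd d0.
case: (eqVneq s 0) => [->|nz].
  by rewrite mul0r invr_out ?unitr0 //; apply: fractions_incl; apply: (sr0 hR).
by exists d, s; split=> //; rewrite invrM ?unitrV ?invrK // uR.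
Qed.

Lemma fractions_division : division_subring fractions.
Proof.
split; [|exact: fractionsB|exact: fractionsM| |exact: fractionsV].
  by apply: fractions_incl; apply: (sr1 hR).
move=> _ [s [d [Rs Rd d0 ->]]] nz; have ud := uR Rd d0.
rewrite unitrMl ?unitrV //; apply: uR => //; apply: contra nz => /eqP ->.
by rewrite mul0r.
Qed.

Lemma fractions_sub : subring_over_center fractions.
Proof.
by split; [move=> z /(srZ hR)/fractions_incl|exact: fractionsB|exact: fractionsM].
Qed.

Lemma fractions_norm (M : L -> Prop) : (forall m, M m -> m \is a GRing.unit) ->
  normalized_by M R -> normalized_by M fractions.
Proof.
move=> uM nR m _ Mm [s [d [Rs Rd d0 ->]]]; have um := uM _ Mm; have ud := uR Rd d0.
exists (m^-1 * s * m), (m^-1 * d * m); split; [exact: nR|exact: nR| |].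
  by apply: unit_neq0; rewrite !unitrMl ?unitrV.
by rewrite conjV // !mulrA mulrK.
Qed.
End Fractions.

Lemma division_units_grp (L : unitRingType) (Q : L -> Prop) : division_subring Q ->
  grp (fun x => Q x /\ x != 0).
Proof.
move=> hQ; have uQ := dsU hQ; split.
- by move=> x [Qx nz]; apply: uQ.
- by split; [apply: (ds1 hQ)|apply: oner_neq0].
- move=> x y [Qx nx] [Qy ny]; split; first exact: (dsM hQ).
  by apply: unit_neq0; rewrite unitrMl ?uQ.
- move=> x [Qx nx]; split; first exact: (dsV hQ).
  by apply: unit_neq0; rewrite unitrV uQ.
Qed.

Section Concrete.
Variables (D : unitRingType) (n : nat).
Hypothesis dD : forall x : D, x != 0 -> x \is a GRing.unit.
Local Notation N := n.+2.
Local Notation L := (clu 'M[D]_N).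
Local Notation V := 'rV[D]_N.
Local Notation C := 'cV[D]_N.
Local Notation e_ := (@e_ D n).
Local Notation Tg := (@Tg D n).

Lemma e_neq0 i : e_ i != 0.
Proof. by apply/eqP => /(congr1 (fun v : V => v 0 i)); rewrite e_E eqxx mxE => /eqP; rewrite oner_eq0. Qed.

Lemma square_zero_exists : exists2 x : L, x != 0 & x * x = 0.
Proof.
have [v [phi [psi fr]]] := ex_frame_w dD (e_neq0 ord0).
have [_ h _ h1] := fr; exists (rk psi (e_ ord0)); last exact: rk_sq.
apply/eqP => z; have := e_neq0 ord0; rewrite -[e_ ord0]scale1r -h1.
by rewrite -act_rk z act0 eqxx.
Qed.

Lemma not_all_division (Q : L -> Prop) : division_subring Q -> ~ (forall x, Q x).
Proof.
move=> hQ all; have [x nz xx] := square_zero_exists.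
have ux := dsU hQ (all x) nz; move/eqP: nz; apply.
by apply: (mulrI ux); rewrite xx mulr0.
Qed.

Variable t : D.
Hypotheses (ct : forall d, t * d = d * t) (t0 : t != 0) (t1 : t * t != 1).

Lemma central_t : exists T : L, [/\ central T, T != 0 & T * T != 1].
Proof.
exists t%:M; split; first exact: scalar_central.
  apply/eqP => z; have := act_scalar (e_ ord0) ct; rewrite z act0 => /esym e.
  move: t0 (e_neq0 ord0) => nz; rewrite -[e_ ord0]scale1r -(mulVr (dD nz)) -scalerA e scaler0 eqxx //.
apply/eqP => z; have : e_ ord0 *m (t%:M * t%:M : L) = (t * t) *: e_ ord0.
  by rewrite actM !act_scalar // scalerA.
rewrite z act1 => e.
have tt : t * t - 1 != 0 by rewrite subr_eq0.
have := e_neq0 ord0; rewrite -[e_ ord0]scale1r -(mulVr (dD tt)) -scalerA scalerBl -e scale1r subrr scaler0.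
by rewrite eqxx.
Qed.

Hypothesis ncD : exists a b : D, a * b <> b * a.
Variables G M : L -> Prop.
Hypotheses (gG : grp G) (TG : forall x, Tg x -> G x) (gM : grp M) (MG : forall x, M x -> G x).
Hypothesis maxM : forall H : L -> Prop, grp H -> (forall x, M x -> H x) -> (forall x, H x -> G x) ->
  (forall x, H x -> M x) \/ (forall x, G x -> H x).
Hypothesis solM : solvable_in M.
Local Notation subring_trichotomy := (subring_trichotomy dD ct t0 t1 gG TG gM MG maxM).

(** Q is not all of L, which has nonzero elements of square zero. If the units of Q in [G] are in
    [M], the commutators of units of Q are in [M] too, so the unit group of Q is solvable and Hua's
    theorem applies. *)
Lemma division_normalized_comm (Q : L -> Prop) : division_subring Q -> subring_over_center Q ->
  normalized_by M Q -> forall x y, Q x -> Q y -> x * y = y * x.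
Proof.
move=> hQ sQ nQ.
have [cQ|all|h] := subring_trichotomy sQ nQ.
- by move=> x y /cQ.
- by case: (not_all_division hQ all).
pose Q' x := Q x /\ x != 0.
have gQ' : grp Q' := division_units_grp hQ.
have [T [cT T0 T1]] := central_t.
have [k hk] := solM.
have Q'Q j x : der j Q' x -> Q' x by apply: der_sub.
have hc a b : Q' a -> Q' b -> M (comm a b).
  move=> ha hb; have Qab : Q' (comm a b) by rewrite /comm; do !apply: (grpM gQ') => //; apply: (grpV gQ').
  apply: h; [by case: Qab|by apply: (dsV hQ); case: Qab|].
  by apply: (comm_G dD TG); apply: (grpU gQ').
apply: (@division_solvable_comm _ Q hQ T (srZ sQ cT) _ T0 T1 (fun j => der j Q') _ _ _ _ _ k.+1).
- by move=> q _; apply: cT.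
- by [].
- by move=> j x /Q'Q[].
- by move=> j; apply: der_grp.
- by move=> j; apply: der_norm => //; [apply: (grpU gQ')|apply: grp_norm_self].
- by move=> j x y; apply: der_comm.
- by move=> x /(der_shift gM hc)/hk -> q _; rewrite mul1r mulr1.
Qed.

Variables K A B : L -> Prop.
Hypotheses (hK : division_subring K) (cK : forall x y, K x -> K y -> x * y = y * x).
Hypothesis ZK : forall z, central z -> K z.
Hypotheses (gA : grp A) (gB : grp B) (AK : forall a, A a -> K a) (AB : forall a, A a -> B a).
Hypotheses (nBK : normalized_by B K) (nK : normalized_by M K) (nB : normalized_by M B).
Hypothesis tw : twisting K A B.
Hypothesis BA : forall x y, B x -> B y -> A (comm x y).
Hypothesis tfree : forall b m, B b -> (0 < m)%N -> A (b ^+ m) -> A b.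
Local Notation R := (kspan K B).

(** Common multiples serve twice: with irreducibility they make the nonzero elements of R invertible
    in L, and then they make the fractions closed under the ring operations. *)
Lemma torsion_free_comm x y : R x -> R y -> x * y = y * x.
Proof.
have dom := kspan_domain hK cK gA gB AK AB nBK tw BA tfree.
have hR := span_sub hK gB nBK ZK.
have nR := span_norm (grpU gM) nB nK.
have ore := kspan_ore hK cK gA gB AK AB nBK BA dom.
have uR := ore_units dD ct t0 t1 ncD gG TG gM MG maxM solM (sr1 hR) (srM hR) nR ore.
move=> Rx Ry.
apply: (division_normalized_comm (fractions_division hR uR ore) (fractions_sub hR uR ore)).
- exact: (fractions_norm uR (grpU gM) nR).
- exact: (fractions_incl hR).
- exact: (fractions_incl hR).
Qed.
End Concrete.

(** * The span is everything and A is its own centraliser *)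

Section Cyclic.
Variables (D : unitRingType) (n : nat).
Hypothesis dD : forall x : D, x != 0 -> x \is a GRing.unit.
Local Notation N := n.+2.
Local Notation L := (clu 'M[D]_N).
Local Notation V := 'rV[D]_N.
Local Notation C := 'cV[D]_N.
Local Notation e_ := (@e_ D n).
Local Notation c_ := (@c_ D n).
Variable K : L -> Prop.
Hypotheses (hK : division_subring K) (cK : forall x y, K x -> K y -> x * y = y * x).
Variables (p : nat) (b : L).
Hypothesis pp : prime p.
Hypothesis indb : kindep K (fun i : 'I_p => b ^+ i).
Hypothesis spanb : forall x, kspan K (fun c => c \in [seq b ^+ i | i <- iota 0 p]) x.

Definition vindep d (X : 'I_d -> V) := forall k : 'I_d -> L, (forall j, K (k j)) ->
  \sum_j X j *m k j = 0 -> forall j, k j = 0.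

Lemma e_rk_c i j (v : V) : e_ i *m (rk (c_ j) v : L) = if i == j then v else 0.
Proof. by rewrite act_rk e_c; case: (i == j); rewrite ?scale1r ?scale0r. Qed.

(** Placing each of the d vectors in each of the N rows gives N d independent elements of L, which
    is spanned by p powers of b. *)
Lemma vindep_size d (X : 'I_d -> V) : vindep X -> (N * d <= p)%N.
Proof.
move=> iX; pose E (u : 'I_N * 'I_d) : L := rk (c_ u.1) (X u.2).
have := @kindep_size _ _ hK cK [seq b ^+ i | i <- iota 0 p] _ (fun k : 'I_(#|{: 'I_N * 'I_d}|) => E (enum_val k)).
have cE : #|{: 'I_N * 'I_d}| = (N * d)%N by rewrite card_prod !card_ord.
rewrite size_map size_iota -cE; apply; last by move=> k; apply: spanb.
move=> c Kc h k0; rewrite -(enum_valK k0); case: (enum_val k0) => i j {k0}.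
have := congr1 (fun x : L => e_ i *m x) h; rewrite act0 act_sum => {}h.
apply: (iX (fun j => c (enum_rank (i, j)))) => //.
rewrite -[RHS]h [RHS](reindex (@enum_rank ('I_N * 'I_d)%type)) /=.
  transitivity (\sum_i' \sum_j' e_ i *m (E (enum_val (enum_rank (i', j'))) * c (enum_rank (i', j')))); last first.
    by rewrite pair_bigA; apply: eq_bigr => [[i' j']] _.
  rewrite (bigD1 i) //= [X in _ + X]big1 ?addr0 => [|i' ne].
    by apply: eq_bigr => j' _; rewrite enum_rankK actM e_rk_c eqxx.
  by apply: big1 => j' _; rewrite enum_rankK actM e_rk_c eq_sym (negbTE ne) mul0mx.
by apply: onW_bij; apply: enum_rank_bij.
Qed.

Lemma vbasis : exists d (X : 'I_d -> V), vindep X /\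
  forall v, exists2 k : 'I_d -> L, (forall j, K (k j)) & v = \sum_j X j *m k j.
Proof.
have ex : exists d, `[< exists X : 'I_d -> V, vindep X >].
  by exists 0%N; apply/asboolP; exists (fun=> 0) => k _ _ [].
have bd d : `[< exists X : 'I_d -> V, vindep X >] -> (d <= p)%N.
  by move=> /asboolP[X /vindep_size]; apply: leq_trans; rewrite leq_pmull.
case: (ex_maxnP ex bd) => d /asboolP[X iX] maxd; exists d, X; split=> // v.
apply: contrapT => nv.
have /maxd : `[< exists X : 'I_d.+1 -> V, vindep X >]; last by rewrite ltnn.
apply/asboolP; exists (fun i => if unlift ord0 i is Some j then X j else v).
move=> k Kk; rewrite big_ord_recl unlift_none.
under eq_bigr => j _ do rewrite liftK.
move=> h.
have k0 : k ord0 = 0.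
  apply/eqP; apply: contrapT => /negP nz; apply: nv.
  have uk := dsU hK (Kk _) nz.
  exists (fun j => - k (lift ord0 j) * (k ord0)^-1).
    by move=> j; apply: (dsM hK); [apply: (dsN hK)|apply: (dsV hK)].
  have e : v *m k ord0 = \sum_j X j *m (- k (lift ord0 j)).
    apply: oppr_inj; rewrite -sumrN; apply: etrans (addr0_eq h) _.
    by apply: eq_bigr => j _; rewrite actN opprK.
  rewrite -[v]act1 -(mulrV uk) actM e mulmx_suml; apply: eq_bigr => j _.
  by rewrite -actM.
move: h; rewrite k0 act0 add0r => h j.
case: (unliftP ord0 j) => [j' ->|-> //].
by apply: (iX (fun j => k (lift ord0 j))).
Qed.

(** L has dimension p over [K] by the powers of b, and N d by rows, where d is the dimension of V.
    As p is prime and N >= 2, d = 1; the scalars of D then act on a generator of V through the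
    commutative [K]. *)
Lemma cyclic_split_comm (x y : D) : x * y = y * x.
Proof.
have [d [X [iX sX]]] := vbasis.
have le1 := vindep_size iX.
have ge1 : (p <= N * d)%N.
  pose ws := [seq (rk (c_ u.1) (X u.2) : L) | u : 'I_N * 'I_d].
  have -> : (N * d = size ws)%N by rewrite size_map -cardE card_prod !card_ord.
  apply: (kindep_size hK cK indb) => i; set z := b ^+ i; clearbody z.
  have /choice[k hk] : forall i, exists k : 'I_d -> L, (forall j, K (k j)) /\ e_ i *m z = \sum_j X j *m k j.
    by move=> i'; have [k Kk e] := sX (e_ i' *m z); exists k.
  have -> : z = \sum_i' \sum_j (rk (c_ i') (X j) : L) * k i' j.
    apply: act_ext => i'; rewrite (hk i').2 act_sum (bigD1 i') //= [X in _ = _ + X]big1 ?addr0.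
      by rewrite act_sum; apply: eq_bigr => j _; rewrite actM e_rk_c eqxx.
    by move=> i2 ne; rewrite act_sum big1 // => j _; rewrite actM e_rk_c eq_sym (negbTE ne) mul0mx.
  apply: kspan_sum => i' _; apply: kspan_sum => j _; apply: kspan1; last exact: (hk i').1.
  by apply/mapP; exists (i', j); rewrite ?mem_enum.
have pE : p = (N * d)%N by apply/eqP; rewrite eqn_leq ge1 le1.
have d1 : d = 1%N.
  have /primeP[_ /(_ N)] := pp; rewrite pE dvdn_mulr // => /(_ isT) /orP[//|/eqP e].
  apply/eqP; rewrite -(eqn_pmul2l (ltn0Sn n.+1)) muln1 -e.
  by [].
subst d; set v := X ord0.
have /choice[f hf] : forall a : D, exists k, K k /\ a *: v = v *m k.
  by move=> a; have [k Kk e] := sX (a *: v); exists (k ord0); rewrite e big_ord1.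
have nz : v != 0.
  apply/eqP => z; have := iX (fun=> 1) (fun=> ds1 hK); rewrite big_ord1 -/v z mul0mx.
  by move=> /(_ erefl ord0)/eqP; rewrite oner_eq0.
have E a a' : (a * a') *: v = v *m (f a * f a').
  by rewrite -scalerA (hf a').2 scalemxAl (hf a).2 actM.
have : (x * y - y * x) *: v = 0.
  by rewrite scalerBl !E (cK (hf x).1 (hf y).1) subrr.
move=> z; apply: subr0_eq; apply: contrapT => /eqP ne.
by case/eqP: nz; rewrite -[v]scale1r -(mulVr (dD ne)) -scalerA z scaler0.
Qed.
End Cyclic.

Section CyclicExtension.
Variables (L : unitRingType) (A : L -> Prop) (b : L) (p : nat).
Hypotheses (gA : grp A) (ub : b \is a GRing.unit) (p0 : (0 < p)%N) (Abp : A (b ^+ p)).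
Hypotheses (nb : forall a, A a -> A (b^-1 * a * b)) (nb' : forall a, A a -> A (b * a * b^-1)).

(** Exponents in nat are enough to have inverses, because a positive power of b lies in [A]. *)
Definition cyclic_ext x := exists a i, A a /\ x = a * b ^+ i.

Lemma cyclic_conjX a i : A a -> A (b ^+ i * a * (b ^+ i)^-1).
Proof.
move=> Aa; elim: i => [|i ih]; first by rewrite expr0 invr1 mulr1 mul1r.
have -> : b ^+ i.+1 * a * (b ^+ i.+1)^-1 = b * (b ^+ i * a * (b ^+ i)^-1) * b^-1.
  by rewrite exprS invrM ?unitrX // !mulrA.
exact: nb'.
Qed.
Lemma cyclic_conjXV a i : A a -> A ((b ^+ i)^-1 * a * b ^+ i).
Proof.
move=> Aa; elim: i => [|i ih]; first by rewrite expr0 invr1 mulr1 mul1r.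
have -> : (b ^+ i.+1)^-1 * a * b ^+ i.+1 = b^-1 * ((b ^+ i)^-1 * a * b ^+ i) * b.
  by rewrite {2}exprSr exprSr invrM ?unitrX // !mulrA.
exact: nb.
Qed.

Lemma cyclic_ext_incl a : A a -> cyclic_ext a.
Proof. by move=> Aa; exists a, 0%N; rewrite expr0 mulr1. Qed.
Lemma cyclic_ext_gen : cyclic_ext b.
Proof. by exists 1, 1%N; rewrite mul1r expr1; split=> //; apply: (grp1 gA). Qed.

Lemma cyclic_ext_grp : grp cyclic_ext.
Proof.
have inM x y : cyclic_ext x -> cyclic_ext y -> cyclic_ext (x * y).
  move=> [a [i [Aa ->]]] [a' [j [Aa' ->]]].
  exists (a * (b ^+ i * a' * (b ^+ i)^-1)), (i + j)%N; split.
    by apply: (grpM gA) => //; apply: cyclic_conjX.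
  by rewrite exprD !mulrA mulrVK ?unitrX.
have inX x i : cyclic_ext x -> cyclic_ext (x ^+ i).
  by move=> hx; elim: i => [|i ih]; [apply: cyclic_ext_incl; apply: (grp1 gA)|rewrite exprS; apply: inM].
have bV : cyclic_ext b^-1.
  exists (b ^+ p)^-1, p.-1; split; first exact: (grpV gA).
  by rewrite -{1}(prednK p0) exprSr invrM ?unitrX // mulrVK ?unitrX.
split=> //.
- by move=> _ [a [i [Aa ->]]]; rewrite unitrMl ?unitrX //; apply: (grpU gA).
- by apply: cyclic_ext_incl; apply: (grp1 gA).
- move=> _ [a [i [Aa ->]]]; have ua := grpU gA Aa; rewrite invrM ?unitrX //; apply: inM.
    by rewrite -exprVn; apply: inX.
  by apply: cyclic_ext_incl; apply: (grpV gA).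
Qed.

Lemma cyclic_ext_mod x : cyclic_ext x -> exists2 i, (i < p)%N & exists2 a, A a & x = b ^+ i * a.
Proof.
move=> [a [i [Aa ->]]]; exists (i %% p)%N; first by rewrite ltn_mod.
exists ((b ^+ p) ^+ (i %/ p) * ((b ^+ i)^-1 * a * b ^+ i)).
  by apply: (grpM gA); [apply: grpX|apply: cyclic_conjXV].
by rewrite !mulrA -exprM -exprD mulnC addnC -divn_eq mulrV ?unitrX // mul1r.
Qed.
End CyclicExtension.

Lemma pow_coset_notin (L : unitRingType) (A : L -> Prop) (b : L) p (i j : 'I_p) : grp A ->
  prime p -> b \is a GRing.unit -> A (b ^+ p) -> ~ A b -> i != j -> ~ A ((b ^+ j)^-1 * b ^+ i).
Proof.
move=> gA pp ub Abp nAb ne.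
case: (ltngtP i j) => [lt|lt|e']; last by case/eqP: ne; apply: val_inj.
  rewrite -(subnKC (ltnW lt)) exprD invrM ?unitrX // mulrVK ?unitrX // => h.
  have : ~ A (b ^+ (j - i)).
    by apply: (pow_notin gA pp) => //; rewrite subn_gt0 lt /= (leq_ltn_trans (leq_subr _ _) (ltn_ord j)).
  by apply; rewrite -[b ^+ _]invrK; apply: (grpV gA).
rewrite -(subnKC (ltnW lt)) exprD mulrA mulVr ?unitrX // mul1r.
by apply: (pow_notin gA pp) => //; rewrite subn_gt0 lt /= (leq_ltn_trans (leq_subr _ _) (ltn_ord i)).
Qed.

Section Concrete.
Variables (D : unitRingType) (n : nat).
Hypothesis dD : forall x : D, x != 0 -> x \is a GRing.unit.
Local Notation N := n.+2.
Local Notation L := (clu 'M[D]_N).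
Local Notation Tg := (@Tg D n).
Variable t : D.
Hypotheses (ct : forall d, t * d = d * t) (t0 : t != 0) (t1 : t * t != 1).
Hypothesis ncD : exists a b : D, a * b <> b * a.
Variables G M : L -> Prop.
Hypotheses (gG : grp G) (TG : forall x, Tg x -> G x) (gM : grp M) (MG : forall x, M x -> G x).
Hypothesis maxM : forall H : L -> Prop, grp H -> (forall x, M x -> H x) -> (forall x, H x -> G x) ->
  (forall x, H x -> M x) \/ (forall x, G x -> H x).
Hypothesis solM : solvable_in M.
Local Notation subring_trichotomy := (subring_trichotomy dD ct t0 t1 gG TG gM MG maxM).

Lemma principle_units (S : L -> Prop) : subring_over_center S -> normalized_by M S ->
  ~ (forall x, S x -> central x) -> ~ (forall x, S x) ->
  forall u v, unit_in S u -> unit_in S v -> M (comm u v).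
Proof.
move=> sS nS nc nall u v; have [//|//|h] := subring_trichotomy sS nS.
move=> Su Sv; have gS := unit_in_grp sS.
have [S1 _ S2] : unit_in S (comm u v) by rewrite /comm; do !apply: (grpM gS) => //; apply: (grpV gS).
by apply: h => //; apply: (comm_G dD TG); [case: Su|case: Sv].
Qed.

Variables (K A : L -> Prop).
Hypotheses (hK : division_subring K) (cK : forall x y, K x -> K y -> x * y = y * x).
Hypothesis ZK : forall z, central z -> K z.
Hypotheses (gA : grp A) (AK : forall a, A a -> K a) (AM : forall a, A a -> M a).
Hypotheses (nA : normalized_by M A) (nK : normalized_by M K).

Section Alpha.
Hypothesis alpha : forall m, M m -> (forall a, A a -> a * m = m * a) -> A m.
Let wit m : M m -> ~ A m -> ~ central m.
Proof. by move=> Mm nAm cm; apply: nAm; apply: alpha => // a _; rewrite cm. Qed.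
Let tw := alpha_twisting cK gA gM AK nA alpha.

(** [step] is applied twice. For [B] it gives R = L, hence [M] is contained in [B] by homogeneity,
    so that [A] and b generate a normal subgroup of [M]. For this subgroup it shows that the powers
    b^i with i < p span L over [K]. *)
Lemma alpha_torsion_false (B : L -> Prop) p b : grp B -> (forall a, A a -> B a) ->
  (forall b, B b -> M b) -> normalized_by M B -> (forall x y, B x -> B y -> A (comm x y)) ->
  prime p -> B b -> ~ A b -> A (b ^+ p) -> False.
Proof.
move=> gB AB BM nB BA pp Bb nAb Abp.
have [T [cT T0 T1]] := central_t n dD ct t0 t1.
have step (B1 : L -> Prop) : grp B1 -> (forall a, A a -> B1 a) -> (forall b, B1 b -> M b) -> normalized_by M B1 ->
    B1 b -> forall x, kspan K B1 x.
  move=> gB1 AB1 BM1 nB1 B1b.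
  have nBK1 : normalized_by B1 K by move=> m k /BM1; apply: nK.
  apply: contrapT => nall.
  have HX := principle_units (span_sub hK gB1 nBK1 ZK) (span_norm (grpU gM) nB1 nK).
  apply: (alpha_false hK cK ZK gA gB1 gM AK AB1 BM1 nA nK alpha _ pp B1b nAb Abp cT T0 T1).
  apply: HX => // cen; apply: (wit (BM _ Bb) nAb); apply: cen; exact: spanb.
have all := step B gB AB BM nB Bb.
have MB m : M m -> B m by move=> Mm; apply: (alpha_homogeneous hK cK gA gB gM AK AB BM nA alpha).
have Mb := BM _ Bb; have ub := grpU gM Mb.
have nb a : A a -> A (b^-1 * a * b) by apply: nA.
have nb' a : A a -> A (b * a * b^-1) by apply: (grp_conjV gM nA).
pose B1 := cyclic_ext A b.
have gB1 : grp B1 := cyclic_ext_grp gA ub (prime_gt0 pp) Abp nb'.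
have B1M x : B1 x -> M x.
  by move=> [a [i [Aa ->]]]; apply: (grpM gM); [apply: AM|apply: grpX].
have nB1 : normalized_by M B1.
  move=> m x Mm B1x; have um := grpU gM Mm; have ux := grpU gB1 B1x.
  have -> : m^-1 * x * m = x * comm x m by rewrite /comm !mulrA mulrV // mul1r.
  apply: (grpM gB1) => //; apply: cyclic_ext_incl; apply: BA; apply: MB => //; exact: B1M.
have all1 := step B1 gB1 (cyclic_ext_incl b (A := A)) B1M nB1 (cyclic_ext_gen b gA).
have [x [y nxy]] := ncD; apply: nxy.
apply: (cyclic_split_comm dD hK cK pp (b := b)).
  move=> k Kk h j; have Bbj : B (b ^+ j) by apply: grpX.
  apply: (coset_coef hK cK gB AK (tw BM) Bbj (Kk j) (y := - \sum_(i < p | i != j) b ^+ i * k i)).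
    by apply: subr0_eq; rewrite opprK -[RHS]h [RHS](bigD1 j).
  apply: (spanN hK); apply: kspan_sum => i ne; apply: kspan1 => //; split; first exact: grpX.
  exact: pow_coset_notin.
move=> z; elim/span_ind': (all1 z) => [|c k w B1c Kk _ ih]; first exact: kspan0.
apply: spanD => //.
have [i ip [a Aa ->]] := cyclic_ext_mod gA ub (prime_gt0 pp) Abp nb B1c.
rewrite -mulrA; apply: kspan1; last by apply: (dsM hK) => //; apply: AK.
by apply/mapP; exists i; rewrite ?mem_iota.
Qed.

End Alpha.
End Concrete.

(** * The span is everything and B centralises K *)

Section ScaledPowers.
Variable L : unitRingType.
Implicit Types (x y w f : L).

Lemma expr_comm_bin x y w n : w * x = x * w -> w * y = y * w -> y * x = x * y * w ->
  (x * y) ^+ n = x ^+ n * y ^+ n * w ^+ 'C(n, 2).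
Proof.
move=> cwx cwy e.
have cwX m z : w * z = z * w -> z * w ^+ m = w ^+ m * z by move=> h; apply: commrX; apply/esym.
have yx m : y * x ^+ m = x ^+ m * y * w ^+ m.
  elim: m => [|m ih]; first by rewrite !expr0 mulr1 mul1r mulr1.
  rewrite !exprSr mulrA ih -[x ^+ m * y * w ^+ m * x]mulrA -cwX //.
  by rewrite mulrA -[x ^+ m * y * x]mulrA e !mulrA -[_ * w * _]mulrA -exprS exprSr !mulrA.
elim: n => [|n ih]; first by rewrite !expr0 !mulr1.
rewrite exprS ih binS bin1 addnC.
have -> : x * y * (x ^+ n * y ^+ n * w ^+ 'C(n, 2)) = x * (y * x ^+ n) * y ^+ n * w ^+ 'C(n, 2).
  by rewrite !mulrA.
rewrite yx exprD.
have -> : x * (x ^+ n * y * w ^+ n) * y ^+ n * w ^+ 'C(n, 2) = x * x ^+ n * y * (w ^+ n * y ^+ n) * w ^+ 'C(n, 2).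
  by rewrite !mulrA.
by rewrite -cwX ?exprS ?mulrA //; apply: commrX.
Qed.

Definition pm1 x := x = 1 \/ x = -1.

Lemma pm1M x y : pm1 x -> pm1 y -> pm1 (x * y).
Proof. by rewrite /pm1 => -[->|->] [->|->]; rewrite ?mulrNN ?mulrN ?mulNr ?mulr1; [left|right|right|left]. Qed.

Lemma pm1V x : pm1 x -> pm1 x^-1.
Proof. by case=> ->; rewrite ?invrN invr1; [left|right]. Qed.

Variables (K : L -> Prop).
Hypotheses (hK : division_subring K).

Lemma pm1_sq x : K x -> x * x = 1 -> pm1 x.
Proof.
move=> Kx xx; case: (eqVneq x 1) => [->|ne]; [by left|right].
have u1 : x - 1 \is a GRing.unit.
  by apply: (dsU hK); [apply: (dsB hK) => //; apply: (ds1 hK)|rewrite subr_eq0].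
apply: subr0_eq; rewrite opprK; apply: (mulrI u1).
by rewrite mulr0 mulrDr mulrBl xx mul1r mulr1; zmod.
Qed.

(** An odd p divides C(p, 2); for p = 2 the exponent is 1 and w^2 = 1. This factor in (x y)^p is why
    p-th powers are only normalised to 1 or -1. *)
Lemma pm1_bin w p : prime p -> K w -> w ^+ p = 1 -> pm1 (w ^+ 'C(p, 2)).
Proof.
move=> pp Kw wp; have [p2|p2] := eqVneq p 2%N.
  by rewrite p2 expr1; apply: pm1_sq => //; rewrite -expr2 -p2.
have {}p2 : (2 < p)%N by rewrite ltn_neqAle eq_sym p2 prime_gt1.
have /dvdnP[q ->] : (p %| 'C(p, 2))%N by apply: prime_dvd_bin.
by left; rewrite mulnC exprM wp expr1n.
Qed.

Hypothesis cenK : forall k, K k -> central k.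

Definition scaled_root p x := exists f, [/\ K f, f != 0 & pm1 ((f * x) ^+ p)].

Lemma scaled_root_mul p x y : prime p -> x \is a GRing.unit -> y \is a GRing.unit ->
  K (comm y x) -> comm y x ^+ p = 1 -> scaled_root p x -> scaled_root p y -> scaled_root p (x * y).
Proof.
move=> pp ux uy Kw wp [f [Kf nf hf]] [g [Kg ng hg]].
have [uf ug] := (dsU hK Kf nf, dsU hK Kg ng).
exists (f * g); split; first exact: (dsM hK).
  by apply: unit_neq0; rewrite unitrMl.
have E : f * g * (x * y) = (f * x) * (g * y) by rewrite -!mulrA [x * (g * _)]mulrA -(cenK Kg x) !mulrA.
rewrite E (@expr_comm_bin (f * x) (g * y) (comm y x)).
- by apply: pm1M; [apply: pm1M|apply: pm1_bin].
- exact: cenK.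
- exact: cenK.
have -> : g * y * (f * x) = f * g * (y * x).
  by rewrite -[g * y * _]mulrA [y * (f * x)]mulrA -(cenK Kf y) -[f * y * x]mulrA mulrA (cenK Kg f).
by rewrite (commE uy ux) mulrA E.
Qed.

Lemma scaled_rootV p x : x \is a GRing.unit -> scaled_root p x -> scaled_root p x^-1.
Proof.
move=> ux [f [Kf nf hf]]; have uf := dsU hK Kf nf.
exists f^-1; split; [exact: (dsV hK)|by apply: unit_neq0; rewrite unitrV|].
by rewrite -invrM // -(cenK Kf) exprVn; apply: pm1V.
Qed.

Lemma scaled_rootK p a : K a -> a != 0 -> scaled_root p a.
Proof.
move=> Ka na; have ua := dsU hK Ka na; exists a^-1; split; first exact: (dsV hK).
  by apply: unit_neq0; rewrite unitrV.
by rewrite mulVr // expr1n; left.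
Qed.
End ScaledPowers.

Section Concrete.
Variables (D : unitRingType) (n : nat).
Hypothesis dD : forall x : D, x != 0 -> x \is a GRing.unit.
Local Notation N := n.+2.
Local Notation L := (clu 'M[D]_N).
Local Notation Tg := (@Tg D n).
Variable t : D.
Hypotheses (ct : forall d, t * d = d * t) (t0 : t != 0) (t1 : t * t != 1).
Variables G M : L -> Prop.
Hypotheses (gG : grp G) (TG : forall x, Tg x -> G x) (gM : grp M) (MG : forall x, M x -> G x).
Hypothesis maxM : forall H : L -> Prop, grp H -> (forall x, M x -> H x) -> (forall x, H x -> G x) ->
  (forall x, H x -> M x) \/ (forall x, G x -> H x).
Variables (K A : L -> Prop).
Hypotheses (hK : division_subring K) (cK : forall x y, K x -> K y -> x * y = y * x).
Hypothesis ZK : forall z, central z -> K z.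
Hypotheses (gA : grp A) (AK : forall a, A a -> K a) (AM : forall a, A a -> M a).
Hypotheses (nA : normalized_by M A) (nK : normalized_by M K).
Hypothesis maxA : forall A' : L -> Prop, grp A' -> (forall x, A' x -> M x) -> normalized_by M A' ->
  (forall x y, A' x -> A' y -> x * y = y * x) -> (forall a, A a -> A' a) -> forall x, A' x -> A x.

Section Extension.
Variable B : L -> Prop.
Hypotheses (gB : grp B) (AB : forall a, A a -> B a) (BM : forall b, B b -> M b) (nB : normalized_by M B).
Hypothesis bK : forall b k, B b -> K k -> b * k = k * b.
Hypothesis BA : forall x y, B x -> B y -> A (comm x y).

(** The center of [B] is an abelian normal subgroup of [M] containing [A], so it is [A] by
    maximality. *)
Lemma center_in_A b : B b -> ~ A b -> exists2 x, B x & comm b x <> 1.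
Proof.
move=> Bb nAb; apply: contrapT => nex; apply: nAb.
pose Z x := B x /\ forall y, B y -> x * y = y * x.
have gZ : grp Z.
  split.
  - by move=> x [/(grpU gB)].
  - by split; [apply: (grp1 gB)|move=> y _; rewrite mulr1 mul1r].
  - move=> x y [Bx hx] [By hy]; split; first exact: (grpM gB).
    by move=> z Bz; rewrite -mulrA hy // mulrA hx // mulrA.
  - move=> x [Bx hx]; have ux := grpU gB Bx; split; first exact: (grpV gB).
    by move=> y By; apply: (mulrI ux); apply: (mulIr ux); rewrite mulVKr // -!mulrA mulVr // mulr1 hx.
apply: (maxA gZ).
- by move=> x [/BM].
- move=> m x Mm [Bx hx]; split; first exact: nB.
  move=> y By; have um := grpU gM Mm.
  have h := hx _ (grp_conjV gM nB Mm By).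
  apply: (mulrI um); apply: (mulIr (_ : m^-1 \is a GRing.unit)); rewrite ?unitrV //.
  by move: h; rewrite !mulrA mulrV // mul1r => ->; rewrite mulrK.
- by move=> x y [_ hx] [By _]; apply: hx.
- by move=> a Aa; split; [apply: AB|move=> y By; rewrite (bK By (AK Aa))].
split=> // y By; rewrite commE ?(grpU gB) //.
have -> : comm b y = 1 by apply: contrapT => ne; apply: nex; exists y.
by rewrite mulr1.
Qed.

Variable p : nat.
Hypotheses (pp : prime p) (Bp : forall b, B b -> A (b ^+ p)).

Lemma span_all_of_noncentral : (exists2 b, B b & ~ A b) -> forall x, kspan K B x.
Proof.
move=> ex; have [b Bb nAb] := ex; have [x Bx c1] := center_in_A Bb nAb.
have nBK := beta_norm gB bK.
have [T [cT T0 T1]] := central_t n dD ct t0 t1.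
apply: contrapT => nall.
apply: (beta_false hK cK ZK gA gB gM AK nB bK BA center_in_A _ pp Bp cT T0 T1 ex).
apply: (principle_units dD ct t0 t1 gG TG gM MG maxM (span_sub hK gB nBK ZK) (span_norm (grpU gM) nB nK)) => // cen.
by apply: c1; apply: comm1; rewrite ?(grpU gB) //; apply: cen; apply: spanb.
Qed.
End Extension.

Variable B : L -> Prop.
Hypotheses (gB : grp B) (AB : forall a, A a -> B a) (BM : forall b, B b -> M b) (nB : normalized_by M B).
Hypothesis bK : forall b k, B b -> K k -> b * k = k * b.
Hypothesis BA : forall x y, B x -> B y -> A (comm x y).
Variable p : nat.
Hypotheses (pp : prime p) (Bp : forall b, B b -> A (b ^+ p)).
Hypothesis exB : exists2 b, B b & ~ A b.

Lemma K_central k : K k -> central k.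
Proof.
move=> Kk y; elim/span_ind': (span_all_of_noncentral gB AB BM nB bK BA pp Bp exB y) => [|b l z Bb Kl _ ih].
  by rewrite mulr0 mul0r.
by rewrite mulrDr mulrDl ih mulrA -(bK Bb Kk) -!mulrA (cK Kk Kl).
Qed.

Lemma A_central a y : A a -> a * y = y * a.
Proof. by move=> /AK/K_central. Qed.

Lemma comm_root x y : B x -> B y -> comm x y ^+ p = 1.
Proof. by move=> Bx By; apply: (root_pow gA gB AK bK BA Bx By (Bp Bx)). Qed.

(** The elements of [B] with a scaled root form a normal subgroup B1 of [M] containing [A]. Once B1
    exceeds [A] its span is already L, and independence of cosets puts every b into B1. *)
Lemma scaled_root_all b : B b -> scaled_root K p b.
Proof.
move=> Bb; pose B1 x := B x /\ scaled_root K p x.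
have A0 a : A a -> a != 0 by move=> /(grpU gA)/unit_neq0.
have AB1 a : A a -> B1 a by move=> Aa; split; [apply: AB|apply: scaled_rootK; [|apply: AK|apply: A0]].
have gB1 : grp B1.
  split.
  - by move=> x [/(grpU gB)].
  - by apply: AB1; apply: (grp1 gA).
  - move=> x y [Bx hx] [By hy]; split; first exact: (grpM gB).
    by apply: (scaled_root_mul hK K_central pp) => //; rewrite ?(grpU gB) ?comm_root //; apply: AK; apply: BA.
  - by move=> x [Bx hx]; split; [apply: (grpV gB)|apply: (scaled_rootV hK K_central) => //; apply: (grpU gB)].
have nB1 : normalized_by M B1.
  move=> m x Mm [Bx [f [Kf nf hf]]]; have um := grpU gM Mm; split; first exact: nB.
  exists f; split=> //.
  have -> : f * (m^-1 * x * m) = m^-1 * (f * x) * m by rewrite !mulrA (K_central Kf).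
  rewrite -conjX //; case: hf => ->; first by left; rewrite mulr1 mulVr.
  by right; rewrite mulrN1 mulNr mulVr.
have B1M x : B1 x -> M x by case=> /BM.
have bK1 x k : B1 x -> K k -> x * k = k * x by case=> Bx _; apply: bK.
have BA1 x y : B1 x -> B1 y -> A (comm x y) by move=> [Bx _] [By _]; apply: BA.
have Bp1 x : B1 x -> A (x ^+ p) by case=> Bx _; apply: Bp.
(* Were B1 equal to [A], take c in [B] outside [A]. For m in [M] the element d = c^-1 (m^-1 c m) has
   p-th power 1 or -1, hence is in [A]; so [A] and c generate an abelian normal subgroup, against
   [maxA]. *)
have exB1 : exists2 x, B1 x & ~ A x.
  apply: contrapT => nex; have {}nex x : B1 x -> A x by move=> B1x; apply: contrapT => nAx; apply: nex; exists x.
  have [c Bc nAc] := exB; apply: nAc.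
  have uc := grpU gB Bc.
  have cc a : A a -> c^-1 * a * c = a by move=> Aa; rewrite -mulrA (A_central c Aa) mulKr.
  have cc' a : A a -> c * a * c^-1 = a by move=> Aa; rewrite -(A_central c Aa) mulrK.
  have gC : grp (cyclic_ext A c).
    by apply: (@cyclic_ext_grp _ A c p) => //; [apply: prime_gt0|apply: Bp|move=> a Aa; rewrite cc'].
  apply: (maxA gC); last by apply: cyclic_ext_gen.
  - move=> _ [a [i [Aa ->]]]; apply: (grpM gM); [exact: AM|apply: grpX => //; exact: BM].
  - move=> m _ Mm [a [i [Aa ->]]]; have um := grpU gM Mm.
    have -> : m^-1 * (a * c ^+ i) * m = (m^-1 * a * m) * (m^-1 * c * m) ^+ i by rewrite -conjX // !mulrA mulrK.
    apply: (grpM gC); first by apply: cyclic_ext_incl; apply: nA.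
    apply: grpX => //; set d := c^-1 * (m^-1 * c * m).
    have Bd : B d by apply: (grpM gB); [apply: (grpV gB)|apply: nB].
    have ud := grpU gB Bd.
    have -> : m^-1 * c * m = c * d by rewrite /d mulVKr.
    have cd : (c * d) ^+ p = c ^+ p by rewrite /d mulVKr // -conjX // -mulrA (A_central m (Bp Bc)) mulKr.
    clearbody d; have e := @expr_comm_bin _ c d (comm d c) p (K_central (AK (BA Bd Bc)) c) (K_central (AK (BA Bd Bc)) d) (commE ud uc).
    have ucp : c ^+ p \is a GRing.unit by rewrite unitrX.
    have dp : d ^+ p * comm d c ^+ 'C(p, 2) = 1.
      by apply: (mulrI ucp); rewrite mulr1 mulrA -e cd.
    have hw : pm1 (comm d c ^+ 'C(p, 2)) by apply: (pm1_bin hK pp); [apply: AK; apply: BA|apply: comm_root].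
    apply: (grpM gC); first exact: cyclic_ext_gen.
    apply: cyclic_ext_incl; apply: nex; split=> //; exists 1; rewrite mul1r; split; [exact: (ds1 hK)|exact: oner_neq0|].
    case: hw dp => ->; first by rewrite mulr1; left.
    by rewrite mulrN1 => dp; right; rewrite -dp opprK.
  - move=> x y [a [i [Aa ->]]] [a' [j [Aa' ->]]].
    have cA a0 i0 : A a0 -> c ^+ i0 * a0 = a0 * c ^+ i0 by move=> /A_central ->.
    by rewrite -!mulrA [c ^+ i * (_ * _)]mulrA [c ^+ j * (_ * _)]mulrA !cA // -!mulrA -!exprD addnC !mulrA (A_central a Aa').
  - exact: cyclic_ext_incl.
have all1 := span_all_of_noncentral gB1 AB1 B1M nB1 bK1 BA1 pp Bp1 exB1.
have tw := beta_twisting gB bK BA (center_in_A gB AB BM nB bK).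
have [b1 [Bb1 h1] Ab1] := span_homogeneous hK cK gB AK tw Bb (P := B1) (fun x h => proj1 h) (all1 b).
have ub1 := grpU gB Bb1; have ub := grpU gB Bb.
suff [] : B1 b by [].
have -> : b = b1 * (b^-1 * b1)^-1 by rewrite invrM ?unitrV // invrK mulVKr.
by apply: (grpM gB1) => //; apply: AB1; apply: (grpV gA).
Qed.
End Concrete.

Section RootOfUnity.
Variables (L : unitRingType) (K : L -> Prop).
Hypotheses (hK : division_subring K).
Variables (p : nat) (w : L).
Hypotheses (pp : prime p) (Kw : K w) (wp : w ^+ p = 1) (w1 : w <> 1).

(** In characteristic p, Frobenius would give (w - 1)^p = w^p - 1 = 0 although w - 1 is
    invertible. *)
Lemma char_ne_root : (p%:R : L) != 0.
Proof.
apply/eqP => p0; have chL : p \in [pchar L] by rewrite inE pp p0 eqxx.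
have u1 : w - 1 \is a GRing.unit.
  by apply: (dsU hK); [apply: (dsB hK) => //; apply: (ds1 hK)|rewrite subr_eq0; apply/eqP].
have e : pFrobenius_aut chL (w - 1) = 0.
  rewrite pFrobenius_autB_comm; last by rewrite /GRing.comm mulr1 mul1r.
  by rewrite pFrobenius_aut1 pFrobenius_autE wp subrr.
by move: u1; rewrite -(unitrX_pos _ (prime_gt0 pp)) -(pFrobenius_autE chL) e unitr0.
Qed.

Lemma sum_powers_root i : (0 < i < p)%N -> \sum_(j < p) (w ^+ i) ^+ j = 0.
Proof.
move=> ip; have uw : w \is a GRing.unit by rewrite -(unitrX_pos _ (prime_gt0 pp)) wp unitr1.
have g1 : grp (fun x : L => x = 1).
  by split=> // [x ->|x y -> ->|x ->]; rewrite ?unitr1 ?mulr1 ?invr1.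
have ne : w ^+ i <> 1 by apply: (pow_notin g1 pp).
have u1 : w ^+ i - 1 \is a GRing.unit.
  by apply: (dsU hK); [apply: (dsB hK); [apply: (dsX hK)|apply: (ds1 hK)]|rewrite subr_eq0; apply/eqP].
by apply: (mulrI u1); rewrite mulr0 -subrX1 -exprM mulnC exprM wp expr1n subrr.
Qed.
End RootOfUnity.

(** * Joint eigenspaces *)

Section Eigen.
Variables (D : unitRingType) (n : nat).
Hypothesis dD : forall x : D, x != 0 -> x \is a GRing.unit.
Local Notation N := n.+2.
Local Notation L := (clu 'M[D]_N).
Local Notation V := 'rV[D]_N.
Local Notation e_ := (@e_ D n).
Hypothesis ncD : exists a b : D, a * b <> b * a.
Variables (K B : L -> Prop).
Hypotheses (hK : division_subring K) (cenK : forall k, K k -> central k).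
Hypotheses (gB : grp B) (spanB : forall x, kspan K B x).
Hypothesis BK : forall x y, B x -> B y -> K (comm x y).
Variable p : nat.
Hypotheses (pp : prime p) (rootB : forall x y, B x -> B y -> comm x y ^+ p = 1).

(** [I] is a set of eigenvalue conditions: a pair b, l in it asks b to act on v as l. *)
Definition eigen (I : L -> L -> Prop) (v : V) := forall b l, I b l -> v *m b = v *m l.
Definition datum (I : L -> L -> Prop) := forall b l, I b l -> B b /\ K l.
Definition centr (I : L -> L -> Prop) b := B b /\ forall b' l, I b' l -> b * b' = b' * b.

Lemma eigen_subsp I : subsp (eigen I).
Proof.
split.
- by move=> b l _; rewrite !mul0mx.
- by move=> u v hu hv b l h; rewrite !mulmxDl (hu _ _ h) (hv _ _ h).
- by move=> a v hv b l h; rewrite -!scalemxAl (hv _ _ h).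
Qed.

Lemma eigen_comm I v y : eigen I v -> (forall b l, I b l -> y * b = b * y) -> datum I -> eigen I (v *m y).
Proof.
move=> hv cy dI b l h; have [_ Kl] := dI _ _ h.
by rewrite -!actM (cy _ _ h) -(cenK Kl y) !actM (hv _ _ h).
Qed.

Lemma eigenK I v k : eigen I v -> datum I -> K k -> eigen I (v *m k).
Proof. by move=> hv dI Kk; apply: eigen_comm => // b l _; apply: (cenK Kk). Qed.

Lemma spn_split (P : L -> Prop) i x : spn K B i x -> spn K (fun b => B b /\ P b) i x \/
  exists b k j y, [/\ B b, ~ P b, K k & [/\ i = j.+1, x = b * k + y & spn K B j y]].
Proof.
elim=> [|j b k y Bb Kk sy ih]; first by left; apply: spn0.
have [Pb|nPb] := pselect (P b); last by right; exists b, k, j, y.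
case: ih => [h|[b1 [k1 [j1 [y1 [Bb1 nPb1 Kk1 [-> e sy1]]]]]]]; first by left; apply: spnS.
right; exists b1, k1, j1.+1, (b * k + y1); split=> //; split=> //; first by rewrite e addrCA.
exact: spnS.
Qed.

(* A term outside the centraliser of I is removed by right multiplication by b' - w l, for a suitable pair (b', l) of I and w = [b, b']. *)
Lemma eigen_transport I w0 : datum I -> eigen I w0 -> w0 != 0 ->
  forall i x, spn K B i x -> eigen I (w0 *m x) ->
  exists2 s, kspan K (centr I) s & w0 *m x = w0 *m s.
Proof.
move=> dI hw0 nz0; elim/ltn_ind => i IH x sx hx.
case: (spn_split (fun b => forall b' l, I b' l -> b * b' = b' * b) sx) => [h|].
  by exists x => //; exists i.
move=> [b [k [j [y [Bb nPb Kk [ei ex sy]]]]]].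
have {nPb} [b' [l [Ib' nc]]] : exists b' l, I b' l /\ b * b' <> b' * b.
  apply: contrapT => nex; apply: nPb => b' l h; apply: contrapT => ne.
  by apply: nex; exists b', l.
have [Bb' Kl] := dI _ _ Ib'.
have [ub ub'] := (grpU gB Bb, grpU gB Bb').
set w := comm b b'; have Kw : K w by apply: BK.
have bw : b * b' = b' * b * w by apply: commE.
have w1 : w <> 1 by move=> e; apply: nc; rewrite bw e mulr1.
clearbody w.
have shift c l' : B c -> K l' -> exists2 k', K k' & w0 *m (c * l' * b') - w0 *m (c * l' * (w * l)) = w0 *m (c * k').
  move=> Bc Kl'; exists (comm c b' * l' * l - l' * w * l).
    by apply: (dsB hK); apply: (dsM hK) => //; apply: (dsM hK) => //; apply: BK.
  have Kc : K (comm c b') by apply: BK.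
  have -> : c * l' * b' = b' * c * comm c b' * l'.
    by rewrite -mulrA (cenK Kl' b') mulrA -(commE (grpU gB Bc) ub').
  move: (comm c b') Kc => u Ku.
  have -> : w0 *m (b' * c * u * l') = w0 *m (c * (u * l' * l)).
    have -> : b' * c * u * l' = b' * (c * u * l') by rewrite !mulrA.
    rewrite actM (hw0 _ _ Ib') -actM; congr (_ *m _).
    by rewrite (cenK Kl) !mulrA.
  by rewrite -actB mulrBr !mulrA.
have [x'' [sx'' ex'']] : exists x'', spn K B j x'' /\ w0 *m (y * b') - w0 *m (y * (w * l)) = w0 *m x''.
  elim: sy => [|m c l' z Bc Kl' _ [x1 [s1 e1]]].
    by exists 0; split; [apply: spn0|rewrite !mul0r subrr act0].
  have [k' Kk' e'] := shift c l' Bc Kl'.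
  exists (c * k' + x1); split; first exact: spnS.
  by rewrite actD -e' -e1 !mulrDl !actD; zmod.
have nl : l != 0.
  apply/eqP => l0; have := hw0 _ _ Ib'; rewrite l0 act0 => /(unit_ker ub') z.
  by rewrite z eqxx in nz0.
pose mu := l - w * l.
have Kmu : K mu by apply: (dsB hK) => //; apply: (dsM hK).
have umu : mu \is a GRing.unit.
  apply: (dsU hK) => //; rewrite /mu -{1}[l]mul1r -mulrBl.
  apply: unit_neq0; rewrite unitrMl ?(dsU hK Kl) //; apply: (dsU hK).
    by apply: (dsB hK) => //; apply: (ds1 hK).
  by rewrite subr_eq0; apply/eqP => e; apply: w1.
have E : w0 *m (x * mu) = w0 *m x''.
  have -> : w0 *m (x * mu) = w0 *m (x * b') - w0 *m (x * (w * l)).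
    by rewrite mulrBr actB [w0 *m (x * l)]actM -(hx _ _ Ib') -actM.
  rewrite ex !mulrDl !actD -ex''.
  suff -> : w0 *m (b * k * b') = w0 *m (b * k * (w * l)) by zmod.
  have -> : b * k * b' = b' * (b * w * k).
    by rewrite -[b * k * b']mulrA (cenK Kk b') [b * (b' * k)]mulrA bw !mulrA.
  rewrite actM (hw0 _ _ Ib') -actM; congr (_ *m _).
  by rewrite (cenK Kl) -!mulrA [w * (k * _)]mulrA -(cenK Kk w) !mulrA.
have ji : (j < i)%N by rewrite ei.
have [|s ss es] := IH j ji x'' sx''.
  by rewrite -E actM; apply: eigenK.
exists (s * mu^-1); first by apply: (spanZ hK) => //; apply: (dsV hK).
by rewrite [RHS]actM -es -E -actM mulrK.
Qed.

(** By transport, every multiple a w0 is w0 s with s in the span of the centraliser of [I]; if this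
    centraliser were commutative, so would be D. *)
Lemma centr_noncomm I w0 : datum I -> eigen I w0 -> w0 != 0 ->
  exists b x, [/\ centr I b, centr I x & b * x <> x * b].
Proof.
move=> dI hw0 nz0; apply: contrapT => nex.
have cc b x : centr I b -> centr I x -> b * x = x * b.
  by move=> hb hx; apply: contrapT => ne; apply: nex; exists b, x.
have sc s s' : kspan K (centr I) s -> kspan K (centr I) s' -> s * s' = s' * s.
  move=> hs hs'; elim/span_ind': hs => [|b k z hb Kk _ ih]; first by rewrite mul0r mulr0.
  rewrite mulrDl mulrDr ih; congr (_ + _).
  suff bs : b * s' = s' * b by rewrite -mulrA (cenK Kk s') mulrA bs -mulrA.
  elim/span_ind': hs' => [|b' k' z' hb' Kk' _ ih']; first by rewrite mul0r mulr0.
  by rewrite mulrDl mulrDr ih' mulrA (cc _ _ hb hb') -!mulrA (cenK Kk' b).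
have [psi hpsi] := ex_dual dD nz0.
have /choice[f hf] : forall a : D, exists s, kspan K (centr I) s /\ a *: w0 = w0 *m s.
  move=> a; have e : w0 *m (rk psi (a *: w0) : L) = a *: w0 by rewrite act_rk hpsi scale1r.
  have [i si] := spanB (rk psi (a *: w0)).
  have [|s ss es] := eigen_transport dI hw0 nz0 si; last by exists s; rewrite -es e.
  by rewrite e; have [_ _ h] := eigen_subsp I; apply: h.
have [x [y nxy]] := ncD; apply: nxy; apply: subr0_eq; apply: contrapT => /eqP ne.
have E a a' : (a * a') *: w0 = w0 *m (f a * f a').
  by rewrite -scalerA (hf a').2 scalemxAl (hf a).2 actM.
have z : (x * y - y * x) *: w0 = 0 by rewrite scalerBl !E (sc _ _ (hf x).1 (hf y).1) subrr.
by case/eqP: nz0; rewrite -[w0]scale1r -(mulVr (dD ne)) -scalerA z scaler0.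
Qed.

(** S j, the sum of the powers of f b w^j, is up to the factor p a spectral idempotent of b. The S j
    add up to p, which is invertible, so one of them does not kill w0. *)
Lemma scaled_eigen I w0 b w f : datum I -> eigen I w0 -> w0 != 0 -> centr I b ->
  K w -> w ^+ p = 1 -> w <> 1 -> K f -> f != 0 -> (f * b) ^+ p = 1 ->
  exists l u, [/\ K l, eigen I u, u != 0 & u *m b = u *m l].
Proof.
move=> dI hw0 nz0 [Bb cb] Kw wp w1 Kf nf fb.
have uf := dsU hK Kf nf; have ub := grpU gB Bb.
have uw : w \is a GRing.unit by rewrite -(unitrX_pos _ (prime_gt0 pp)) wp unitr1.
pose h j := f * b * w ^+ j.
have Kwj j : K (w ^+ j) by apply: (dsX hK).
have hX j i : h j ^+ i = (f * b) ^+ i * (w ^+ j) ^+ i.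
  by rewrite /h exprMn_comm //; apply/esym; apply: (cenK (Kwj j)).
pose S j := \sum_(i < p) h j ^+ i.
have Sh j : S j * h j = S j.
  have hp : h j ^+ p = 1 by rewrite hX fb mul1r -exprM mulnC exprM wp expr1n.
  have := subrX1 (h j) p; rewrite hp subrr mulrBl mul1r => /esym/subr0_eq e.
  by rewrite -[RHS]e /S mulr_suml mulr_sumr; apply: eq_bigr => i _; rewrite -exprS -exprSr.
have sumS : \sum_(j < p) S j = p%:R.
  rewrite exchange_big /= (bigD1 (Ordinal (prime_gt0 pp))) //=.
  under eq_bigr => j _ do rewrite expr0.
  rewrite sumr_const card_ord big1 ?addr0 // => i ni.
  under eq_bigr => j _ do rewrite hX -exprM mulnC exprM.
  rewrite -mulr_sumr.
  rewrite (sum_powers_root hK pp Kw wp w1) ?mulr0 // ltn_ord andbT lt0n.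
  by apply: contra ni => /eqP e; apply/eqP; apply: val_inj.
have up : (p%:R : L) \is a GRing.unit.
  by apply: (dsU hK); [apply: ds_nat|apply: (char_ne_root hK pp Kw wp w1)].
have [j nzj] : exists j : 'I_p, w0 *m S j != 0.
  apply: contrapT => nex; move/eqP: nz0; apply; apply: (unit_ker up).
  rewrite -sumS act_sum big1 // => j _; apply/eqP; apply: contrapT => /negP ne.
  by apply: nex; exists j.
have Kl : K (f * w ^+ j) by apply: (dsM hK).
have ul : f * w ^+ j \is a GRing.unit by rewrite unitrMl // unitrX.
exists (f * w ^+ j)^-1, (w0 *m S j); split=> //; first exact: (dsV hK).
  apply: eigen_comm => // b' l hI; apply/esym.
  apply: commr_sum => i _; apply: commrX; rewrite /GRing.comm /h.
  rewrite mulrA mulrA -(cenK Kf b') -[f * b' * b]mulrA -(cb _ _ hI) -!mulrA.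
  by rewrite -[w ^+ j * b'](esym (cenK (Kwj j) b')).
rewrite -!actM; congr (_ *m _); apply: (mulIr ul).
rewrite mulrVK // -[in RHS](Sh j) /h -!mulrA; congr (_ * _).
by rewrite [LHS]mulrA -(cenK Kf b) -mulrA.
Qed.

(** In a minimal joint eigenspace take non-commuting b and x of its centraliser. If (f b)^p = 1, b
    has an eigenvector there; by minimality it acts on the whole eigenspace as one central element,
    while x preserves the eigenspace, so b x and x b agree on w0, which their commutator forbids. *)
Theorem unscalable_pair : exists b x, [/\ B b, B x, comm b x <> 1 &
  forall f, K f -> f != 0 -> (f * b) ^+ p <> 1 /\ (f * x) ^+ p <> 1].
Proof.
pose Fam W := exists I, [/\ datum I, W = eigen I & exists2 v, eigen I v & v != 0].
have F0 : Fam (eigen (fun _ _ => False)).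
  by exists (fun _ _ => False); split=> //; exists (e_ ord0) => //; apply: e_neq0.
have sF W : Fam W -> subsp W by move=> [I [_ -> _]]; apply: eigen_subsp.
have [_ [I [dI -> [w0 hw0 nz0]]] minI] := @subspace_dcc D n dD Fam _ F0 sF.
have nc1 b x : B b -> B x -> b * x <> x * b -> comm b x <> 1.
  by move=> Bb Bx ne e; apply: ne; rewrite commE ?(grpU gB) // e mulr1.
have key b x : centr I b -> centr I x -> b * x <> x * b -> forall f, K f -> f != 0 -> (f * b) ^+ p <> 1.
  move=> hb hx nc f Kf nf e.
  have [[Bb cb] [Bx cx]] := (hb, hx).
  have w1 := nc1 _ _ Bb Bx nc.
  have [l [u [Kl hu nzu ul]]] := scaled_eigen dI hw0 nz0 hb (BK Bb Bx) (rootB Bb Bx) w1 Kf nf e.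
  pose I' b' l' := I b' l' \/ (b' = b /\ l' = l).
  have sub : forall v, eigen I v -> eigen I' v.
    apply: minI.
      exists I'; split=> //; first by move=> b' l' [/dI|[-> ->]].
      by exists u => // b' l' [/hu|[-> ->]].
    by move=> v hv b' l' h; apply: hv; left.
  have act v : eigen I v -> v *m b = v *m l by move=> /sub; apply; right.
  have hwx : eigen I (w0 *m x) by apply: eigen_comm.
  have h1 : w0 *m (b * x) = w0 *m (x * b).
    by rewrite actM (act _ hw0) [RHS]actM (act _ hwx) -!actM (cenK Kl).
  have ub := grpU gB Bb; have ux := grpU gB Bx.
  have : w0 *m (x * b * (comm b x - 1)) = 0.
    by rewrite mulrBr mulr1 actB -(commE ub ux) h1 subrr.
  have u1 : x * b * (comm b x - 1) \is a GRing.unit.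
    rewrite !unitrMl //; apply: (dsU hK).
      by apply: (dsB hK); [apply: BK|apply: (ds1 hK)].
    by rewrite subr_eq0; apply/eqP.
  by move=> /(unit_ker u1) z; rewrite z eqxx in nz0.
have [b [x [hb hx nc]]] := centr_noncomm dI hw0 nz0.
have [[Bb cb] [Bx cx]] := (hb, hx).
exists b, x; split=> //; first exact: nc1.
move=> f Kf nf; split; first exact: (key b x).
by apply: (key x b) => // e; apply: nc.
Qed.
End Eigen.

(** * The anti-automorphism inverting elements of square 1 or -1, and its similitudes *)

Section Reversion.
Variables (L : unitRingType) (K B : L -> Prop).
Hypotheses (hK : division_subring K) (cenK : forall k, K k -> central k).
Hypotheses (gB : grp B) (KB : forall k, K k -> k != 0 -> B k).
Hypothesis spanB : forall x, kspan K B x.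
Hypothesis BK : forall x y, B x -> B y -> K (comm x y).
Hypothesis sqB : forall x y, B x -> B y -> comm x y * comm x y = 1.
Hypothesis zB : forall b, B b -> ~ K b -> exists2 x, B x & comm b x <> 1.
Hypothesis scaleB : forall b, B b -> exists f, [/\ K f, f != 0 & pm1 (f * b * (f * b))].
Hypothesis nsqK : forall g, K g -> g * g <> -1.
Local Notation A := (fun k => K k /\ k != 0).

Definition square_pm1 b := B b /\ pm1 (b * b).
Local Notation H := square_pm1.

Lemma square_pm1M b c : H b -> H c -> H (b * c).
Proof.
move=> [Bb hb] [Bc hc]; split; first exact: (grpM gB).
have [ub uc] := (grpU gB Bb, grpU gB Bc).
have Kw := BK Bc Bb.
have -> : b * c * (b * c) = b * b * (c * c) * comm c b.
  have -> : b * c * (b * c) = b * (c * b) * c by rewrite !mulrA.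
  rewrite (commE uc ub); move: (comm c b) Kw => w Kw.
  by rewrite mulrA -[_ * w * c]mulrA (cenK Kw) !mulrA.
apply: pm1M; first exact: pm1M.
by apply: (pm1_sq hK) => //; apply: sqB.
Qed.

Lemma square_pm1V b : H b -> H b^-1.
Proof.
move=> [Bb hb]; split; first exact: (grpV gB).
by have ub := grpU gB Bb; rewrite -invrM //; apply: pm1V.
Qed.

Lemma square_pm1K b : H b -> K b -> pm1 b.
Proof. by move=> [Bb [h|h]] Kb; [apply: (pm1_sq hK)|case: (nsqK Kb)]. Qed.

Lemma pm1_inv (x : L) : pm1 x -> x^-1 = x.
Proof. by case=> ->; rewrite ?invrN invr1. Qed.

(** A relation, because an element has many expressions as a combination; that the image does not
    depend on the expression is [tau_zero]. [P] restricts the elements that occur. *)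
Inductive tau (P : L -> Prop) : nat -> L -> L -> Prop :=
| tau0 : tau P 0 0 0
| tauS n b k x y : H b -> P b -> K k -> tau P n x y -> tau P n.+1 (b * k + x) (b^-1 * k + y).

Lemma tauD P n m x y x' y' : tau P n x y -> tau P m x' y' -> tau P (n + m) (x + x') (y + y').
Proof.
move=> hx hx'; elim: hx => [|i b k z z' Hb Pb Kk _ ih]; first by rewrite !add0r.
by rewrite -!addrA addSn; apply: tauS.
Qed.

(** As [K] has no square root of -1, two elements of H in one coset modulo [K] differ by a sign
    only, so collecting their terms is compatible with inverting them. *)
Lemma tau_extract b n x y : H b -> tau (fun=> True) n x y ->
  exists k m x' y', [/\ K k, (m <= n)%N, tau (fun c => ~ K (b^-1 * c)) m x' y' &
    x = b * k + x' /\ y = b^-1 * k + y'].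
Proof.
move=> Hb; have ub := grpU gB Hb.1.
elim=> [|i c l z z' Hc _ Kl _ [k [m [x' [y' [Kk le ht [-> ->]]]]]]].
  by exists 0, 0%N, 0, 0; split; [apply: (ds0 hK)| |apply: tau0|rewrite !mulr0 !addr0].
have [Ke|nKe] := pselect (K (b^-1 * c)).
  have He : H (b^-1 * c) by apply: square_pm1M => //; apply: square_pm1V.
  have pe := square_pm1K He Ke.
  exists (b^-1 * c * l + k), m, x', y'; split=> //; last split.
  - by apply: (dsD hK) => //; apply: (dsM hK).
  - exact: leqW.
  - by rewrite [in RHS]mulrDr -!mulrA mulVKr // !addrA.
  - rewrite [in RHS]mulrDr addrA; congr (_ + _ + _).
    have ue : b^-1 * c \is a GRing.unit by apply: (grpU gB); case: He.
    have ec : c = b * (b^-1 * c) by rewrite mulVKr.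
    have -> : c^-1 = b^-1 * (b^-1 * c) by rewrite {1}ec invrM // (pm1_inv pe) (cenK Ke).
    by rewrite -mulrA.
exists k, m.+1, (c * l + x'), (c^-1 * l + y'); split=> //; first exact: tauS.
by split; rewrite addrCA.
Qed.

Lemma reversion_twisting : twisting K A B.
Proof.
apply: (beta_twisting gB) => [b k _ Kk|x y Bx By|b Bb nAb]; first by rewrite (cenK Kk).
- by split; [apply: BK|apply: unit_neq0; apply: comm_unit; apply: (grpU gB)].
- by apply: zB => // Kb; apply: nAb; split=> //; apply: unit_neq0; apply: (grpU gB).
Qed.

(** By independence the coefficient collected at the coset of b is 0, so this coset drops out of [y]
    as well as of [x], and what remains is shorter. *)
Lemma tau_zero n x y : tau (fun=> True) n x y -> x = 0 -> y = 0.
Proof.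
elim/ltn_ind: n x y => n IH x y h x0.
inversion h as [|m b k z z' Hb _ Kk hz en ex ey]; subst; first by [].
have [k' [m' [x' [y' [Kk' le ht [ez ez']]]]]] := tau_extract Hb hz.
have cK u v : K u -> K v -> u * v = v * u by move=> Ku _; apply: cenK.
have kk : k + k' = 0.
  apply: (coset_coef hK cK gB (fun a (h : A a) => proj1 h) reversion_twisting (c := b) (y := - x')).
  - by case: Hb.
  - exact: (dsD hK).
  - by apply: subr0_eq; rewrite opprK -[RHS]x0 ez mulrDr addrA.
  apply: (spanN hK); elim: ht => [|i c l u u' Hc nKc Kl _ ih]; first exact: kspan0.
  by apply: spanS => //; split; [case: Hc|case].
have x'0 : x' = 0 by move: x0; rewrite ez addrA -mulrDr kk mulr0 add0r.
rewrite ez' addrA -mulrDr kk mulr0 add0r.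
apply: (IH m' _ x') => //.
elim: ht => [|i c l u u' Hc _ Kl _ ih]; [exact: tau0|exact: tauS].
Qed.

(* The K-linear anti-automorphism with b |-> b^-1 on elements of square 1 or -1, as a relation. *)
Definition reversion x y := exists n, tau (fun=> True) n x y.
Local Notation T := reversion.

Lemma reversionD x y x' y' : T x y -> T x' y' -> T (x + x') (y + y').
Proof. by move=> [n h] [m h']; exists (n + m)%N; apply: tauD. Qed.

Lemma reversion_term b k : H b -> K k -> T (b * k) (b^-1 * k).
Proof.
by move=> Hb Kk; exists 1%N; rewrite -[b * k]addr0 -[b^-1 * k]addr0; apply: tauS => //; apply: tau0.
Qed.

Lemma reversion0 : T 0 0. Proof. by exists 0%N; apply: tau0. Qed.

Lemma reversion_ind (F : L -> L -> Prop) : F 0 0 ->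
  (forall b k x y, H b -> K k -> T x y -> F x y -> F (b * k + x) (b^-1 * k + y)) ->
  forall x y, T x y -> F x y.
Proof.
move=> F0 FS x y [n h]; elim: h => // i b k z z' Hb _ Kk hz ih.
by apply: FS => //; exists i.
Qed.

Lemma square_pm11 : H 1.
Proof. by split; [apply: (grp1 gB)|left; rewrite mulr1]. Qed.

Lemma reversion_inv b : H b -> T b b^-1.
Proof. by move=> Hb; have := reversion_term Hb (ds1 hK); rewrite !mulr1. Qed.

Lemma reversionK k : K k -> T k k.
Proof.
by move=> Kk; have := reversion_term square_pm11 Kk; rewrite invr1 mul1r.
Qed.

Lemma reversionM x y x' y' : T x y -> T x' y' -> T (x * x') (y' * y).
Proof.
move=> hx hx'; elim/reversion_ind: hx => [|b k z z' Hb Kk _ ih].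
  by rewrite mul0r mulr0; apply: reversion0.
rewrite mulrDl mulrDr; apply: reversionD => //.
elim/reversion_ind: hx' {ih} => [|c l u u' Hc Kl _ ih].
  by rewrite mul0r mulr0; apply: reversion0.
rewrite mulrDl mulrDr; apply: reversionD => //.
have [ub uc] := (grpU gB Hb.1, grpU gB Hc.1).
have -> : b * k * (c * l) = b * c * (k * l) by rewrite -!mulrA [k * (c * l)]mulrA (cenK Kk c) -!mulrA.
have -> : c^-1 * l * (b^-1 * k) = (b * c)^-1 * (k * l).
  by rewrite invrM // -!mulrA [l * (b^-1 * k)]mulrA (cenK Kl b^-1) -!mulrA (cenK Kl k).
by apply: reversion_term; [apply: square_pm1M|apply: (dsM hK)].
Qed.

Lemma reversion_total x : exists y, T x y.
Proof.
elim/span_ind': (spanB x) => [|b k z Bb Kk _ [y hy]]; first by exists 0; apply: reversion0.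
have [f [Kf nf hf]] := scaleB Bb; have uf := dsU hK Kf nf.
have Hb : H (f * b) by split=> //; apply: (grpM gB) => //; apply: KB.
exists ((f * b)^-1 * (f^-1 * k) + y); apply: reversionD => //.
have -> : b * k = f * b * (f^-1 * k).
  by rewrite (cenK Kf b) -mulrA mulVKr.
by apply: reversion_term => //; apply: (dsM hK) => //; apply: (dsV hK).
Qed.

Lemma reversion_fun x y y' : T x y -> T x y' -> y = y'.
Proof.
move=> h h'; have K1 : K (-1) by apply: (dsN hK); apply: (ds1 hK).
have [n ht] := reversionD h (reversionM (reversionK K1) h').
by have := tau_zero ht; rewrite mulN1r mulrN1 subrr => /(_ erefl)/subr0_eq.
Qed.

(** [h] is the image of g under the anti-automorphism, and the scalar [h * g] is the multiplier of
    g. *)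
Definition similitude g := g \is a GRing.unit /\ exists h, [/\ T g h, K (h * g) & h * g != 0].

Lemma similitude_grp : grp similitude.
Proof.
split.
- by move=> x [].
- split; first exact: unitr1.
  by exists 1; split; rewrite ?mulr1 ?oner_neq0 //; [apply: reversionK|]; apply: (ds1 hK).
- move=> x y [ux [h [hx Kx nx]]] [uy [h' [hy Ky ny]]]; split; first by rewrite unitrMl.
  exists (h' * h).
  have -> : h' * h * (x * y) = (h * x) * (h' * y).
    have -> : h' * h * (x * y) = h' * (h * x) * y by rewrite !mulrA.
    by rewrite -(cenK Kx h') mulrA.
  split; [exact: reversionM|exact: (dsM hK)|].
  by apply: unit_neq0; rewrite unitrMl ?(dsU hK Kx) ?(dsU hK Ky).
- move=> x [ux [h [hx Kx nx]]]; split; first by rewrite unitrV.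
  have [y hy] := reversion_total x^-1; exists y.
  have yh : y * h = 1.
    have := reversionM hx hy; rewrite mulrV // => h1.
    by apply: (reversion_fun h1); apply: reversionK; apply: (ds1 hK).
  have uk := dsU hK Kx nx.
  have e : y * x^-1 = (h * x)^-1.
    by apply: (mulIr uk); rewrite mulVr // -mulrA -(cenK Kx x^-1) mulrK.
  by split=> //; rewrite e; [apply: (dsV hK)|apply: unit_neq0; rewrite unitrV].
Qed.

(** Conjugation by m preserves H. Applying the anti-automorphism to b m = m c with c = m^-1 b m
    shows that m h commutes with each b of H, so it is central. *)
Lemma similitude_normalizer (M : L -> Prop) m : (forall x, central x -> K x) -> grp M -> normalized_by M B -> M m -> similitude m.
Proof.
move=> ZK gM nB Mm; have um := grpU gM Mm; split=> //.
have [h hm] := reversion_total m; exists h.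
have cmh : central (m * h).
  have com b : H b -> b * (m * h) = m * h * b.
    move=> Hb; have ub := grpU gB Hb.1.
    have Hc : H (m^-1 * b * m).
      split; first by apply: nB => //; case: Hb.
      have -> : m^-1 * b * m * (m^-1 * b * m) = m^-1 * (b * b) * m by rewrite !mulrA mulrK.
      by case: Hb => _ [|] ->; [left; rewrite mulr1 mulVr|right; rewrite mulrN1 mulNr mulVr].
    have h1 := reversionM (reversion_inv Hb) hm.
    have h2 := reversionM hm (reversion_inv Hc).
    have e : m * (m^-1 * b * m) = b * m by rewrite !mulrA mulrV // mul1r.
    rewrite e in h2; have := reversion_fun h1 h2; rewrite conjV // => E.
    have E' : m * h * b^-1 = b^-1 * (m * h).
      by rewrite -mulrA E !mulrA mulrV // mul1r.
    by apply: (mulIr (_ : b^-1 \is a GRing.unit)); rewrite ?unitrV // -mulrA E' mulVKr // mulrK.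
  move=> y; have [z hz] := reversion_total y.
  elim/reversion_ind: hz => [|b k u u' Hb Kk _ ih]; first by rewrite mulr0 mul0r.
  by rewrite mulrDr mulrDl ih [m * h * (b * k)]mulrA -(com _ Hb) -[b * k * _]mulrA (cenK Kk (m * h)) -[b * (m * h) * k]mulrA.
have e : h * m = m * h.
  by apply: (mulrI um); rewrite mulrA cmh.
have [h' hh'] := reversion_total m^-1.
have h1 : h' * h = 1.
  have := reversionM hm hh'; rewrite mulrV // => h1.
  by apply: (reversion_fun h1); apply: reversionK; apply: (ds1 hK).
split=> //; first by rewrite e; apply: ZK.
apply/eqP => z; have : h' * (h * m) * m^-1 = 0 by rewrite z mulr0 mul0r.
by rewrite mulrA h1 mul1r mulrV // => /eqP; rewrite oner_eq0.
Qed.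

(** For y the image of x and k = (1 + y) (1 + x), one gets y x = (k - 1) x and y^2 = 0, hence (k -
    1)^2 x = 0. So x = 0, or k = 1 and y = -x. *)
Lemma similitude_square_zero x : x * x = 0 -> similitude (1 + x) -> T x (- x).
Proof.
move=> xx [ux [h [hT Kh nh]]].
have [y hy] := reversion_total x.
have e : h = 1 + y by apply: (reversion_fun hT); apply: reversionD => //; apply: reversionK; apply: (ds1 hK).
have yy : y * y = 0.
  have := reversionM hy hy; rewrite xx => h0; exact: (reversion_fun h0 reversion0).
set k := h * (1 + x) in Kh nh; have Ek : k = h * (1 + x) by [].
clearbody k.
have ey : y = k - 1 - k * x.
  have : h = k * (1 - x).
    by rewrite Ek -mulrA (sq0_inv xx).1 mulr1.
  by rewrite e mulrBr mulr1 => E; apply: (eq_by_diff E); zmod.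
have Kk1 : K (k - 1) by apply: (dsB hK) => //; apply: (ds1 hK).
have yx : y * x = (k - 1) * x by rewrite {1}ey mulrBl -[k * x * x]mulrA xx mulr0 subr0.
have z : (k - 1) * ((k - 1) * x) = 0.
  by rewrite -yx mulrA (cenK Kk1 y) -mulrA -yx mulrA yy mul0r.
have [k1|nk1] := eqVneq (k - 1) 0.
  by move: ey; rewrite k1 sub0r (subr0_eq k1) mul1r => <-.
have uk1 := dsU hK Kk1 nk1.
have -> : x = 0 by apply: (mulrI uk1); apply: (mulrI uk1); rewrite z !mulr0.
by rewrite oppr0; apply: reversion0.
Qed.
End Reversion.

Lemma comm_scale (L : unitRingType) (k l c d : L) : central k -> central l ->
  k \is a GRing.unit -> l \is a GRing.unit -> c \is a GRing.unit -> d \is a GRing.unit ->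
  comm (k * c) (l * d) = comm c d.
Proof.
move=> ck cl uk ul uc ud; rewrite /comm !invrM //.
have -> : c^-1 * k^-1 * (d^-1 * l^-1) * (k * c) * (l * d) = c^-1 * k^-1 * d^-1 * (l^-1 * (k * (c * l))) * d.
  by rewrite !mulrA.
rewrite -(cl c) [k * (l * c)]mulrA ck -[l * k * c]mulrA mulKr //.
have -> : c^-1 * k^-1 * d^-1 * (k * c) = c^-1 * (k^-1 * (d^-1 * k)) * c by rewrite !mulrA.
by rewrite -(ck d^-1) mulKr.
Qed.

Section Scaling.
Variables (L : unitRingType) (K B : L -> Prop).
Hypotheses (hK : division_subring K) (cenK : forall k, K k -> central k) (gB : grp B).

Definition scalings y := exists k c, [/\ K k, k != 0, B c & y = k * c].

Lemma scalings_incl c : B c -> scalings c.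
Proof. by move=> Bc; exists 1, c; split; rewrite ?mul1r ?oner_neq0 //; apply: (ds1 hK). Qed.

Lemma scalingsK k : K k -> k != 0 -> scalings k.
Proof. by move=> Kk nk; exists k, 1; split; rewrite ?mulr1 //; apply: (grp1 gB). Qed.

Lemma scalings_grp : grp scalings.
Proof.
have uK := dsU hK; split.
- by move=> _ [k [c [Kk nk Bc ->]]]; rewrite unitrMl ?(grpU gB Bc) // uK.
- by apply: scalings_incl; apply: (grp1 gB).
- move=> _ _ [k [c [Kk nk Bc ->]]] [l [d [Kl nl Bd ->]]].
  exists (k * l), (c * d); split; [exact: (dsM hK)| |exact: (grpM gB)|].
    by apply: unit_neq0; rewrite unitrMl ?uK.
  by rewrite -!mulrA [c * (l * d)]mulrA -(cenK Kl c) !mulrA.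
- move=> _ [k [c [Kk nk Bc ->]]]; have uk := uK _ Kk nk.
  exists k^-1, c^-1; split; [exact: (dsV hK)| |exact: (grpV gB)|].
    by apply: unit_neq0; rewrite unitrV.
  have KV : K k^-1 by apply: (dsV hK).
  by rewrite invrM ?(grpU gB Bc) // (cenK KV).
Qed.

Lemma scalings_comm x y : scalings x -> scalings y -> exists c d, [/\ B c, B d & comm x y = comm c d].
Proof.
move=> [k [c [Kk nk Bc ->]]] [l [d [Kl nl Bd ->]]]; exists c, d; split=> //.
by apply: comm_scale; rewrite ?(dsU hK Kk nk) ?(dsU hK Kl nl) ?(grpU gB Bc) ?(grpU gB Bd) //; apply: cenK.
Qed.

Lemma scalings_norm (M : L -> Prop) : (forall m, M m -> m \is a GRing.unit) ->
  normalized_by M B -> normalized_by M scalings.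
Proof.
move=> uM nB m _ Mm [k [c [Kk nk Bc ->]]]; exists k, (m^-1 * c * m); split=> //; first exact: nB.
by rewrite mulrA -(cenK Kk m^-1) !mulrA.
Qed.
End Scaling.

Section Concrete.
Variables (D : unitRingType) (n : nat).
Hypothesis dD : forall x : D, x != 0 -> x \is a GRing.unit.
Local Notation N := n.+2.
Local Notation L := (clu 'M[D]_N).
Local Notation V := 'rV[D]_N.
Local Notation e_ := (@e_ D n).
Local Notation Tg := (@Tg D n).

(** Each rank one element of square zero would be negated. Products of two of them then show that rk
    phi ((x y) w) goes to rk psi ((y x) v), and the factorisations a b and (a b) 1 of one scalar
    give a b = b a. *)
Lemma transvections_not_similitudes (K B : L -> Prop) : division_subring K ->
  (forall k, K k -> central k) -> grp B ->
  (forall k, K k -> k != 0 -> B k) -> (forall x, kspan K B x) ->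
  (forall x y, B x -> B y -> K (comm x y)) ->
  (forall x y, B x -> B y -> comm x y * comm x y = 1) ->
  (forall b, B b -> ~ K b -> exists2 x, B x & comm b x <> 1) ->
  (forall b, B b -> exists f, [/\ K f, f != 0 & pm1 (f * b * (f * b))]) ->
  (forall g, K g -> g * g <> -1) ->
  (forall g, Tg g -> similitude K B g) -> forall a b : D, a * b = b * a.
Proof.
move=> hK cenK gB KB spanB BK sqB zB scaleB nsqK all a b.
have [v [phi [psi fr]]] := ex_frame_w dD (e_neq0 D (ord0 : 'I_N)).
set w := e_ ord0 in fr; have [wf wp vf vp] := fr.
have RT (chi : 'cV[D]_N) (u : V) : pr u chi = 0 -> reversion K B (rk chi u) (- rk chi u).
  move=> h; apply: (similitude_square_zero hK cenK gB KB spanB BK sqB zB scaleB nsqK).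
    exact: rk_sq.
  by apply: all; apply: Tg_tv.
have key x y : reversion K B (rk phi ((x * y) *: w)) (rk psi ((y * x) *: v)).
  have h1 : reversion K B (rk phi (x *: v)) (- rk phi (x *: v)) by apply: RT; rewrite prZl vf mulr0.
  have h2 : reversion K B (rk psi (y *: w)) (- rk psi (y *: w)) by apply: RT; rewrite prZl wp mulr0.
  have := reversionM hK cenK gB BK sqB h1 h2.
  by rewrite mulrNN !rkM !prZl vp wf !mulr1 !scalerA.
have h1 := key a b; have h2 := key (a * b) 1; rewrite mulr1 mul1r in h2.
have e := reversion_fun hK cenK gB BK sqB zB nsqK h1 h2.
have nv := frame_ne0 (frame_sym fr).
have := congr1 (fun x : L => v *m x) e; rewrite !act_rk vp !scale1r => ev.
apply/esym; apply: subr0_eq; apply: contrapT => /eqP ne; case/eqP: nv.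
by rewrite -[v]scale1r -(mulVr (dD ne)) -scalerA scalerBl ev subrr scaler0.
Qed.

Variable t : D.
Hypotheses (ct : forall d, t * d = d * t) (t0 : t != 0) (t1 : t * t != 1).
Hypothesis ncD : exists a b : D, a * b <> b * a.
Variables G M : L -> Prop.
Hypotheses (gG : grp G) (TG : forall x, Tg x -> G x) (gM : grp M) (MG : forall x, M x -> G x).
Hypothesis maxM : forall H : L -> Prop, grp H -> (forall x, M x -> H x) -> (forall x, H x -> G x) ->
  (forall x, H x -> M x) \/ (forall x, G x -> H x).
Variables (K A : L -> Prop).
Hypotheses (hK : division_subring K) (cK : forall x y, K x -> K y -> x * y = y * x).
Hypothesis ZK : forall z, central z -> K z.
Hypotheses (gA : grp A) (AK : forall a, A a -> K a) (AM : forall a, A a -> M a).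
Hypotheses (nA : normalized_by M A) (nK : normalized_by M K).
Hypothesis maxA : forall A' : L -> Prop, grp A' -> (forall x, A' x -> M x) -> normalized_by M A' ->
  (forall x y, A' x -> A' y -> x * y = y * x) -> (forall a, A a -> A' a) -> forall x, A' x -> A x.
Variable B : L -> Prop.
Hypotheses (gB : grp B) (AB : forall a, A a -> B a) (BM : forall b, B b -> M b) (nB : normalized_by M B).
Hypothesis bK : forall b k, B b -> K k -> b * k = k * b.
Hypothesis BA : forall x y, B x -> B y -> A (comm x y).
Variable p : nat.
Hypotheses (pp : prime p) (Bp : forall b, B b -> A (b ^+ p)).

Lemma beta_torsion_false : (exists2 b, B b & ~ A b) -> False.
Proof.
move=> exB.
have cenK := K_central dD ct t0 t1 gG TG gM MG maxM hK cK ZK gA AK nK maxA gB AB BM nB bK BA pp Bp exB.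
have span := span_all_of_noncentral dD ct t0 t1 gG TG gM MG maxM hK cK ZK gA AK nK maxA gB AB BM nB bK BA pp Bp exB.
have root := comm_root gA AK gB bK BA Bp.
have scal := scaled_root_all dD ct t0 t1 gG TG gM MG maxM hK cK ZK gA AK AM nA nK maxA gB AB BM nB bK BA pp Bp exB.
have zB := center_in_A gM AK maxA gB AB BM nB bK.
have BK x y : B x -> B y -> K (comm x y) by move=> Bx By; apply: AK; apply: BA.
have [b [x [Bb Bx c1 uns]]] := unscalable_pair dD ncD hK cenK gB span BK pp root.
have [f [Kf nf hf]] := scal _ Bb; have [f' [Kf' nf' hf']] := scal _ Bx.
(* For odd p the sign is absorbed by replacing f by -f, contrary to [uns]. *)
have p2 : p = 2%N.
  have [//|np2] := eqVneq p 2%N.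
  have odd_p : odd p by case: (even_prime pp) => // e; rewrite e in np2.
  case: hf => e; first by case: (uns f Kf nf) => /(_ e).
  have nNf : - f != 0 by rewrite oppr_eq0.
  have [h _] := uns (- f) (dsN hK Kf) nNf; case: h.
  by rewrite mulNr exprNn e -signr_odd odd_p expr1 mulrNN mulr1.
rewrite p2 in hf hf' uns root.
have fb : f * b * (f * b) = -1.
  by case: hf => e; [case: (uns f Kf nf) => /(_ e)|rewrite -expr2].
have fx : f' * x * (f' * x) = -1.
  by case: hf' => e; [case: (uns f' Kf' nf') => _ /(_ e)|rewrite -expr2].
(* A square root g of -1 in [K] would give (g f b)^2 = 1, contrary to [uns]. *)
have nsq g : K g -> g * g <> -1.
  move=> Kg gg; have ng : g != 0.
    by apply: unit_neq0; rewrite -(unitrX_pos g (isT : (0 < 2)%N)) expr2 gg unitrN1.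
  have Kgf : K (g * f) by apply: (dsM hK).
  have ngf : g * f != 0 by apply: unit_neq0; rewrite unitrMl ?(dsU hK).
  have [h _] := uns _ Kgf ngf; apply: h.
  have -> : (g * f * b) ^+ 2 = g * g * (f * b * (f * b)).
    by rewrite -mulrA exprMn_comm ?expr2 //; apply: (cenK g Kg).
  by rewrite gg fb mulrNN mulr1.
(* It is f b, and not b, that has square -1; so [B] is enlarged by the scalars, which changes no
   commutator. *)
pose B' := scalings K B; pose A' k := K k /\ k != 0.
have gB' : grp B' := scalings_grp hK cenK gB.
have gA' : grp A' := division_units_grp hK.
have spanB' y : kspan K B' y by apply: span_mono (span y) => c; apply: scalings_incl.
have BK' y z : B' y -> B' z -> K (comm y z).
  by move=> hy hz; have [c [d [Bc Bd ->]]] := scalings_comm hK cenK gB hy hz; apply: BK.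
have sq' y z : B' y -> B' z -> comm y z * comm y z = 1.
  by move=> hy hz; have [c [d [Bc Bd ->]]] := scalings_comm hK cenK gB hy hz; rewrite -expr2 root.
have zB' y : B' y -> ~ K y -> exists2 z, B' z & comm y z <> 1.
  move=> [k [c [Kk nk Bc ->]]] nKy.
  have [|z Bz ne] := zB _ Bc; first by move=> /AK Kc; apply: nKy; apply: (dsM hK).
  exists z; first exact: scalings_incl.
  have := @comm_scale _ k 1 c z (cenK _ Kk) (@central1 _).
  by rewrite mul1r => ->; rewrite ?unitr1 ?(dsU hK Kk nk) ?(grpU gB Bc) ?(grpU gB Bz).
have sc' y : B' y -> exists g, [/\ K g, g != 0 & pm1 (g * y * (g * y))].
  move=> [k [c [Kk nk Bc ->]]]; have [g [Kg ng hg]] := scal _ Bc.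
  have uk := dsU hK Kk nk; exists (g * k^-1); split.
  - by apply: (dsM hK) => //; apply: (dsV hK).
  - by apply: unit_neq0; rewrite unitrMl ?unitrV ?(dsU hK).
  by rewrite -[g * k^-1 * (k * c)]mulrA mulKr // -expr2 -p2.
have KB' k : K k -> k != 0 -> B' k by apply: scalingsK.
have nB' : normalized_by M B' by apply: (scalings_norm cenK (grpU gM) nB).
pose X := similitude K B'.
have gX : grp X := similitude_grp hK cenK gB' KB' spanB' BK' sq' zB' sc' nsq.
have MX m : M m -> X m := similitude_normalizer hK cenK gB' KB' spanB' BK' sq' zB' sc' nsq ZK gM nB'.
(* The similitudes in [G] contain [M] and do not contain T, so by maximality they are in [M]. They
   now play the part that the units of R play when R is not L. *)
have HX u v : X u -> X v -> M (comm u v).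
  move=> Xu Xv; have gXG : grp (fun y => X y /\ G y).
    split.
    - by move=> y [/(grpU gX)].
    - by split; [apply: (grp1 gX)|apply: (grp1 gG)].
    - by move=> y z [? ?] [? ?]; split; [apply: (grpM gX)|apply: (grpM gG)].
    - by move=> y [? ?]; split; [apply: (grpV gX)|apply: (grpV gG)].
  have [h|h] := maxM gXG (fun y My => conj (MX _ My) (MG My)) (fun y (h : X y /\ G y) => proj2 h).
    apply: h; split; first by rewrite /comm; do !apply: (grpM gX) => //; apply: (grpV gX).
    by apply: (comm_G dD TG); apply: (grpU gX).
  have [y [z nyz]] := ncD; case: nyz.
  apply: (transvections_not_similitudes hK cenK gB' KB' spanB' BK' sq' zB' sc' nsq).
  by move=> g /TG/h[].
have [T [cT T0 T1]] := central_t n dD ct t0 t1.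
have [w1 two] := comm_sign hK gA gB AK bK BA Bp Bb Bx p2 c1.
have Bfb : B' (f * b) by exists f, b.
have Bfx : B' (f' * x) by exists f', x.
have cfx : comm (f * b) (f' * x) = comm b x.
  by apply: comm_scale; rewrite ?(dsU hK Kf nf) ?(dsU hK Kf' nf') ?(grpU gB Bb) ?(grpU gB Bx) //; apply: cenK.
have KN1 : K (-1) by apply: (dsN hK); apply: (ds1 hK).
(* Since y^-1 = -y, the multiplier of T + y is T^2 + 1, which is nonzero because -1 is no square in
   [K]. *)
have inX y : B' y -> y * y = -1 -> X y /\ X (T + y).
  move=> By yy; have Hy : square_pm1 B' y by split=> //; right.
  have uy := grpU gB' By.
  have yV : y^-1 = - y by apply: (mulrI uy); rewrite mulrV // mulrN yy opprK.
  have ty := reversion_inv hK Hy; split.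
    by split=> //; exists y^-1; rewrite mulVr //; split; rewrite ?oner_neq0 //; apply: (ds1 hK).
  have KT := ZK cT.
  have E : (T + y^-1) * (T + y) = T * T + 1.
    by rewrite yV !(mulrDl, mulrDr, mulNr) yy (cT y); zmod.
  have E' : (T + y) * (T + y^-1) = T * T + 1.
    by rewrite yV !(mulrDl, mulrDr, mulrN) yy (cT y); zmod.
  have KE : K (T * T + 1) by apply: (dsD hK); [apply: (dsM hK)|apply: (ds1 hK)].
  have nE : T * T + 1 != 0.
    by apply/eqP => e; apply: (nsq _ KT); apply: (eq_by_diff e); zmod.
  have uE := dsU hK KE nE.
  split.
    have [] := unit_in_span hK (spanB' (T + y)) (spanB' (T + y^-1)) KE nE E' E.
    by [].
  exists (T + y^-1); split; rewrite ?E //.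
  by apply: reversionD => //; apply: reversionK.
have [Xb XTb] := inX _ Bfb fb; have [Xx XTx] := inX _ Bfx fx.
apply: (beta_two hK cK ZK gA' gB' gM _ nB' _ _ _ Bfb Bfx _ gX HX Xb Xx _ _ _ two cT T0 _ XTb cT T0 _ XTx).
- by move=> a [].
- by move=> y k _ Kk; rewrite (cenK _ Kk).
- by move=> y z hy hz; split; [apply: BK'|apply: unit_neq0; apply: comm_unit; apply: (grpU gB')].
- by move=> y hy nAy; apply: zB' => // Ky; apply: nAy; split=> //; apply: unit_neq0; apply: (grpU gB').
- by rewrite cfx.
- by rewrite fb; split=> //; rewrite oppr_eq0 oner_neq0.
- by rewrite fx; split=> //; rewrite oppr_eq0 oner_neq0.
- by rewrite cfx.
- by rewrite fb opprK.
- by rewrite fx opprK.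
Qed.
End Concrete.

(** * The theorem *)

Section Groups.
Variables (L : unitRingType) (M : L -> Prop).
Hypothesis gM : grp M.

(** The clauses hold for the empty set, so that Zorn's lemma may be applied to an empty chain as
    well; a maximal set of this kind contains 1. *)
Definition abelian_normal (X : L -> Prop) := [/\ forall x, X x -> M x,
  forall x y, X x -> X y -> X (x * y), forall x, X x -> X x^-1, normalized_by M X &
  forall x y, X x -> X y -> x * y = y * x].

Lemma maximal_abelian_normal : exists A, [/\ grp A, abelian_normal A &
  forall A', grp A' -> abelian_normal A' -> (forall a, A a -> A' a) -> forall x, A' x -> A x].
Proof.
have [F HF tot|X [aX maxX]] := @Zorn_bigcup L abelian_normal.
  have two x y : (\bigcup_(X in F) X)%classic x -> (\bigcup_(X in F) X)%classic y ->
      exists X, [/\ F X, X x & X y].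
    move=> [X FX Xx] [Y FY Yy]; have [s|s] := tot _ _ FX FY.
      by exists Y; split=> //; apply: s.
    by exists X; split=> //; apply: s.
  split.
  - by move=> x [X /HF[h _ _ _ _] /h].
  - by move=> x y hx hy; have [X [FX Xx Xy]] := two _ _ hx hy; exists X => //; have [_ h _ _ _] := HF _ FX; apply: h.
  - by move=> x [X FX Xx]; exists X => //; have [_ _ h _ _] := HF _ FX; apply: h.
  - by move=> m x Mm [X FX Xx]; exists X => //; have [_ _ _ h _] := HF _ FX; apply: h.
  - by move=> x y hx hy; have [X [FX Xx Xy]] := two _ _ hx hy; have [_ _ _ _ h] := HF _ FX; apply: h.
have [XM XMl XV nX cX] := aX.
have max A' : abelian_normal A' -> (forall a, X a -> A' a) -> forall x, A' x -> X x.
  move=> aA' sub x A'x; apply: contrapT => nXx; apply: (maxX A') => //; split=> // h.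
  by apply: nXx; apply: h.
have X1 : X 1.
  apply: contrapT => nX1; apply: (nX1); apply: (max (fun x => x = 1)) => //.
    split.
    - by move=> x ->; apply: (grp1 gM).
    - by move=> x y -> ->; rewrite mulr1.
    - by move=> x ->; rewrite invr1.
    - by move=> m x Mm ->; rewrite mulr1 mulVr // (grpU gM).
    - by move=> x y -> ->.
  move=> a Xa; exfalso; apply: nX1; rewrite -(mulrV (grpU gM (XM _ Xa))).
  by apply: XMl => //; apply: XV.
exists X; split=> //.
  by split=> // x /XM /(grpU gM).
by move=> A' _; apply: max.
Qed.

Lemma torsion_prime (A B : L -> Prop) b m : grp B -> B b -> ~ A b -> (0 < m)%N -> A (b ^+ m) ->
  exists p c, [/\ prime p, B c, ~ A c & A (c ^+ p)].
Proof.
move=> gB; elim/ltn_ind: m b => m IH b Bb nAb m0 Abm.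
have m1 : (1 < m)%N.
  by case: m m0 Abm {IH} => [|[|m]] //; rewrite expr1.
have pp := pdiv_prime m1; have pm := pdiv_dvd m.
have e : (m %/ pdiv m * pdiv m)%N = m by rewrite divnK.
have [h|h] := pselect (A (b ^+ (m %/ pdiv m))).
  have lt : (m %/ pdiv m < m)%N by rewrite ltn_Pdiv // prime_gt1.
  apply: (IH _ lt b Bb nAb) => //.
  by rewrite divn_gt0 ?prime_gt0 // dvdn_leq.
by exists (pdiv m), (b ^+ (m %/ pdiv m)); split=> //; [apply: grpX|rewrite -exprM e].
Qed.

Variables (A N : L -> Prop).
Hypotheses (gA : grp A) (nA : normalized_by M A) (AM : forall a, A a -> M a).
Hypotheses (gN : grp N) (NM : forall x, N x -> M x) (nN : normalized_by M N).
Hypothesis NA : forall x y, N x -> N y -> A (comm x y).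

Definition mulset x := exists m a, [/\ N m, A a & x = m * a].

Lemma mulset_l x : N x -> mulset x.
Proof. by move=> Nx; exists x, 1; split; rewrite ?mulr1 //; apply: (grp1 gA). Qed.
Lemma mulset_r x : A x -> mulset x.
Proof. by move=> Ax; exists 1, x; split; rewrite ?mul1r //; apply: (grp1 gN). Qed.
Lemma mulset_M x : mulset x -> M x.
Proof. by move=> [m [a [Nm Aa ->]]]; apply: (grpM gM); [apply: NM|apply: AM]. Qed.

Lemma mulset_grp : grp mulset.
Proof.
split.
- by move=> x /mulset_M/(grpU gM).
- by apply: mulset_l; apply: (grp1 gN).
- move=> _ _ [m [a [Nm Aa ->]]] [m' [a' [Nm' Aa' ->]]].
  exists (m * m'), (m'^-1 * a * m' * a'); split; first exact: (grpM gN).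
    by apply: (grpM gA) => //; apply: nA => //; apply: NM.
  have um := grpU gN Nm'; rewrite !mulrA mulrK //.
- move=> _ [m [a [Nm Aa ->]]]; have um := grpU gN Nm; have ua := grpU gA Aa.
  exists m^-1, (m * a^-1 * m^-1); split; first exact: (grpV gN).
    by apply: (grp_conjV gM nA); [apply: NM|apply: (grpV gA)].
  by rewrite invrM // !mulrA mulVr // mul1r.
Qed.

Lemma mulset_norm : normalized_by M mulset.
Proof.
move=> g _ Mg [m [a [Nm Aa ->]]]; have ug := grpU gM Mg.
exists (g^-1 * m * g), (g^-1 * a * g); split; [exact: nN|exact: nA|].
by rewrite !mulrA mulrK.
Qed.

Lemma mulset_comm x y : mulset x -> mulset y -> A (comm x y).
Proof.
move=> [m [a [Nm Aa ->]]] hy; have My := mulset_M hy; have [m' [a' [Nm' Aa' ey]]] := hy.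
have [um um'] := (grpU gN Nm, grpU gN Nm').
apply: comm_mod_l => //; [exact: (grpU gM)|exact: nA|].
rewrite ey; apply: comm_mod_r => //; last exact: NA.
by apply: nA; [apply: NM|apply: (grpV gA)].
Qed.
End Groups.

Section Concrete.
Variables (D : unitRingType) (n : nat).
Hypothesis dD : forall x : D, x != 0 -> x \is a GRing.unit.
Local Notation N := n.+2.
Local Notation L := (clu 'M[D]_N).
Local Notation Tg := (@Tg D n).
Variable t : D.
Hypotheses (ct : forall d, t * d = d * t) (t0 : t != 0) (t1 : t * t != 1).
Hypothesis ncD : exists a b : D, a * b <> b * a.
Variables G M : L -> Prop.
Hypotheses (gG : grp G) (TG : forall x, Tg x -> G x) (gM : grp M) (MG : forall x, M x -> G x).
Hypothesis maxM : forall H : L -> Prop, grp H -> (forall x, M x -> H x) -> (forall x, H x -> G x) ->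
  (forall x, H x -> M x) \/ (forall x, G x -> H x).
Hypothesis solM : solvable_in M.

Lemma solvable_maximal_comm x y : M x -> M y -> x * y = y * x.
Proof.
move=> Mx My; have [A [gA aA maxA]] := maximal_abelian_normal gM.
have [AM _ _ nA abA] := aA.
have {}maxA A' : grp A' -> (forall x, A' x -> M x) -> normalized_by M A' ->
    (forall x y, A' x -> A' y -> x * y = y * x) -> (forall a, A a -> A' a) -> forall x, A' x -> A x.
  by move=> gA' h1 h2 h3; apply: maxA => //; split=> //; [apply: (grpM gA')|apply: (grpV gA')].
have [MA|nMA] := pselect (forall z, M z -> A z); first by apply: abA; apply: MA.
exfalso.
pose K := KA A.
have hK : division_subring K := KA_division dD ct t0 t1 ncD gG TG gM MG maxM solM nA.
have cK (u v : L) : K u -> K v -> u * v = v * u := @KA_comm _ _ _ u v.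
have sK : subring_over_center K := KA_sub A.
have ZK := srZ sK.
have AK a : A a -> K a by apply: KA_A.
have nK : normalized_by M K := KA_norm gM nA.
have tfc := torsion_free_comm dD ct t0 t1 ncD gG TG gM MG maxM solM hK cK ZK gA.
(* The centraliser of [A] in [M]: whether it is inside [A] decides between cases alpha and beta. *)
pose H m := M m /\ forall a, A a -> a * m = m * a.
have [HA|nHA] := pselect (forall m, H m -> A m).
  have alpha m : M m -> (forall a, A a -> a * m = m * a) -> A m by move=> Mm h; apply: HA.
  have [P [gP PM nP nPA PP]] := solvable_abelian_section solM gM (fun _ h => h) (grpU gM) (grp_norm_self gM) (grp1 gA) nMA.
  pose B := mulset A P.
  have gB : grp B := mulset_grp gM gA nA AM gP PM.
  have AB a : A a -> B a by apply: mulset_r.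
  have BM b : B b -> M b by apply: mulset_M.
  have nB : normalized_by M B := mulset_norm gM nA nP.
  have BA u v : B u -> B v -> A (comm u v) by apply: (mulset_comm gM).
  have [c Bc nAc] : exists2 c, B c & ~ A c.
    apply: contrapT => nex; apply: nPA => c Pc; apply: contrapT => nAc; apply: nex.
    by exists c => //; apply: mulset_l.
  have tw := alpha_twisting cK gA gM AK nA alpha BM.
  have [tfree|] := pselect (forall b m, B b -> (0 < m)%N -> A (b ^+ m) -> A b).
    have [a Aa ne] := alpha_witness alpha (BM _ Bc) nAc.
    apply: ne; apply: (tfc B gB AK AB) => //; try by apply: spanb.
      by move=> b k /BM; apply: nK.
    by apply: spanb => //; apply: AB.
  move=> /existsNP[b /existsNP[m /not_implyP[Bb /not_implyP[m0 /not_implyP[Abm nAb]]]]].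
  have [p [c' [pp Bc' nAc' Acp]]] := torsion_prime gB Bb nAb m0 Abm.
  exact: (alpha_torsion_false dD ct t0 t1 ncD gG TG gM MG maxM hK cK ZK gA AK AM nA nK alpha gB AB BM nB BA pp Bc' nAc' Acp).
have gH : grp H.
  split.
  - by move=> z [/(grpU gM)].
  - by split; [apply: (grp1 gM)|move=> a _; rewrite mulr1 mul1r].
  - move=> u v [Mu hu] [Mv hv]; split; first exact: (grpM gM).
    by move=> a Aa; rewrite mulrA hu // -!mulrA hv.
  - move=> u [Mu hu]; have uu := grpU gM Mu; split; first exact: (grpV gM).
    by move=> a Aa; apply: (mulrI uu); apply: (mulIr uu); rewrite mulVKr // -mulrA mulrVK // hu.
have nH : normalized_by M H.
  move=> m u Mm [Mu hu]; have um := grpU gM Mm; split; first by apply: (grp_norm_self gM).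
  move=> a Aa; have h := hu _ (grp_conjV gM nA Mm Aa).
  apply: (mulrI um); apply: (mulIr (_ : m^-1 \is a GRing.unit)); rewrite ?unitrV //.
  by move: h; rewrite !mulrA mulrV // mul1r => ->; rewrite mulrK.
have [P [gP PH nP nPA PP]] := solvable_abelian_section solM gH (fun _ h => proj1 h) (grpU gM) nH (grp1 gA) nHA.
have PM z : P z -> M z by move=> /PH[].
pose B := mulset A P.
have gB : grp B := mulset_grp gM gA nA AM gP PM.
have AB a : A a -> B a by apply: mulset_r.
have BM b : B b -> M b by apply: mulset_M.
have nB : normalized_by M B := mulset_norm gM nA nP.
have BA u v : B u -> B v -> A (comm u v) by apply: (mulset_comm gM).
have bK b k : B b -> K k -> b * k = k * b.
  move=> [m [a [Pm Aa ->]]] [_ hk]; apply/esym; apply: hk => a' Aa'.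
  by rewrite -mulrA (abA _ _ Aa Aa') mulrA -((PH _ Pm).2 _ Aa') mulrA.
have [c Bc nAc] : exists2 c, B c & ~ A c.
  apply: contrapT => nex; apply: nPA => c Pc; apply: contrapT => nAc; apply: nex.
  by exists c => //; apply: mulset_l.
have zB := center_in_A gM AK maxA gB AB BM nB bK.
have tw := beta_twisting gB bK BA zB.
have [tfree|] := pselect (forall b m, B b -> (0 < m)%N -> A (b ^+ m) -> A b).
  have [d Bd ne] := zB _ Bc nAc; apply: ne; apply: comm1; rewrite ?(grpU gB) //.
  by apply: (tfc B gB AK AB) => //; [apply: (beta_norm gB bK)|apply: spanb|apply: spanb].
move=> /existsNP[b /existsNP[m /not_implyP[Bb /not_implyP[m0 /not_implyP[Abm nAb]]]]].
have [p [c' [pp Bc' nAc' Acp]]] := torsion_prime gB Bb nAb m0 Abm.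
(* Restricting to the elements of [B] with p-th power in [A] gives one prime for the whole group; it
   is closed under products because the correction w^C(p, 2) is in [A]. *)
pose Bp z := B z /\ A (z ^+ p).
have gBp : grp Bp.
  split.
  - by move=> z [/(grpU gB)].
  - by split; rewrite ?expr1n; [apply: (grp1 gB)|apply: (grp1 gA)].
  - move=> u v [Bu hu] [Bv hv]; split; first exact: (grpM gB).
    have Aw := BA _ _ Bv Bu; have Kw := AK _ Aw.
    have [uu uv] := (grpU gB Bu, grpU gB Bv).
    rewrite (expr_comm_bin p (esym (bK _ _ Bu Kw)) (esym (bK _ _ Bv Kw)) (commE uv uu)).
    by apply: (grpM gA); [apply: (grpM gA)|apply: grpX].
  - by move=> z [Bz hz]; split; rewrite ?exprVn; [apply: (grpV gB)|apply: (grpV gA)].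
apply: (beta_torsion_false dD ct t0 t1 ncD gG TG gM MG maxM hK cK ZK gA AK AM nA nK maxA gBp _ _ _ _ _ pp _) => //.
- by move=> a Aa; split; [apply: AB|apply: grpX].
- by move=> z [/BM].
- by move=> g z Mg [Bz hz]; split; [apply: nB|rewrite -conjX ?(grpU gM) //; apply: nA].
- by move=> z k [Bz _]; apply: bK.
- by move=> u v [Bu _] [Bv _]; apply: BA.
- by move=> z [].
- by exists c'.
Qed.
End Concrete.

(** * Transfer to the definitions of the statement *)

Section Bridge.
Variables (D : nzRingType) (n : nat).
Local Notation N := n.+2.
Local Notation L := (clu 'M[clu D]_N).
Implicit Types (H K : 'M[D]_N -> Prop) (x y : L).

Lemma mat_inv_pairP x y : @mat_inv_pair D N x y <-> x \is a GRing.unit /\ y = x^-1.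
Proof.
split.
  move=> [xy yx]; have ux : x \is a GRing.unit by apply/unitrP; exists y.
  by split=> //; apply: (mulrI ux); rewrite mulrV.
by move=> [ux ->]; split; [apply: (mulrV ux)|apply: (mulVr ux)].
Qed.

Lemma is_subgroup_grp H : is_subgroup H -> grp (H : L -> Prop).
Proof.
move=> [HGL [H1 [HM HV]]].
have uH (x : L) : H x -> x \is a GRing.unit by move=> /HGL[y /mat_inv_pairP[]].
split=> //.
by move=> x Hx; apply: (HV x) => //; apply/mat_inv_pairP; split=> //; apply: uH.
Qed.

Lemma grp_is_subgroup (H : L -> Prop) : grp H -> @is_subgroup D N H.
Proof.
move=> gH; split; last split; first 1 last.
- exact: (grp1 gH).
- by split; [apply: (grpM gH)|move=> x y Hx /mat_inv_pairP[_ ->]; apply: (grpV gH)].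
by move=> x Hx; exists (x : L)^-1; apply/mat_inv_pairP; split=> //; apply: (grpU gH).
Qed.

Lemma der_derived k (H : L -> Prop) : grp H -> forall x, der k H x -> @derived D N k H x.
Proof.
move=> gH; elim: k => //= k ih x hx K' sK cK.
apply: (hx K'); first exact: is_subgroup_grp.
move=> _ [a [b [ha hb ->]]]; apply: cK.
have gd := der_grp k gH.
exists a, b, (a : L)^-1, (b : L)^-1; split; first exact: ih.
split; first exact: ih.
by do !split; try exact: (mulrV (grpU gd ha)); try exact: (mulVr (grpU gd ha));
  try exact: (mulrV (grpU gd hb)); try exact: (mulVr (grpU gd hb)).
Qed.

Hypothesis dD : forall x : clu D, x != 0 -> x \is a GRing.unit.
Variable t : clu D.
Hypotheses (ct : forall d, t * d = d * t) (t0 : t != 0) (t1 : t * t != 1).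

(** Down the chain, a non-central normal subgroup of a group containing T contains T; below a
    central term everything is central. *)
Lemma subnormal_central_or_Tg H K : subnormal_in H K -> (forall x : L, Tg x -> K x) ->
  (forall x : L, H x -> central x) \/ (forall x : L, Tg x -> H x).
Proof.
elim=> {H K} [K _|H1 H2 K [sH1 [sH2 [sub nor]]] _ ih] TK; first by right.
have [cen|TH] := ih TK; first by left=> x /sub/cen.
have [cen|ncen] := pselect (forall x : L, H1 x -> central x); [by left|right].
have gH1 := is_subgroup_grp sH1.
apply: (normal_contains_Tg dD t0 t1 gH1).
  move=> x y Tx Hy; apply: (nor x x^-1 y) => //; first exact: TH.
  by apply/mat_inv_pairP; split=> //; apply: (grpU (Tg_grp _ _) Tx).
by move/existsNP: ncen => [x /not_implyP[Hx ncx]]; exists x.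
Qed.

Lemma abelian_of_solvable_maximal (G Mx : 'M[D]_N -> Prop) : noncommutative D ->
  is_subgroup G -> subnormal_in G (@GL D N) -> maximal_in Mx G -> solvable_grp Mx -> abelian_grp Mx.
Proof.
move=> ncD sG snG [sM [_ [sub [_ maxM]]]] [k hk] x y Mx' My'.
have gG := is_subgroup_grp sG; have gM := is_subgroup_grp sM.
have [cen|TG] := subnormal_central_or_Tg snG (fun x Tx => ex_intro _ x^-1 (proj2 (mat_inv_pairP x x^-1) (conj (grpU (Tg_grp _ _) Tx) erefl))).
  by have := cen x (sub _ Mx') y.
apply: (@solvable_maximal_comm (clu D) n dD t ct t0 t1 ncD G Mx gG TG gM sub _ _ x y Mx' My').
  by move=> H gH MH HG; apply: maxM => //; apply: grp_is_subgroup.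
by exists k => z /(der_derived gM)/hk.
Qed.
End Bridge.

Lemma exists_central_scalar (D : nzRingType) : is_division_ring D -> card_at_least (@center D) 5 ->
  exists t : D, [/\ forall d, t * d = d * t, t != 0 & t * t != 1].
Proof.
move=> dD [s [us [ss cs]]].
(* Five distinct elements do not fit into 0, 1, -1, and in a division ring x^2 = 1 only for x = 1 or
   x = -1. *)
have [/allP h|/allPn[x xs nx]] := boolP (all (fun x => x \in [:: 0; 1; -1]) s).
  by have := uniq_leq_size us h; rewrite ss.
exists x; split; first exact: cs.
  by apply: contra nx => /eqP ->; rewrite inE eqxx.
apply: contra nx => /eqP xx.
have [->|x1] := eqVneq x 1; first by rewrite !inE eqxx orbT.
have [z [_ zx]] : exists z, (x - 1) * z = 1 /\ z * (x - 1) = 1 by apply: dD; rewrite subr_eq0.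
have e : x + 1 = 0.
  have h : (x - 1) * (x + 1) = x * x - 1 by ncring.
  have : z * ((x - 1) * (x + 1)) = 0 by rewrite h xx subrr mulr0.
  by rewrite mulrA zx mul1r.
by rewrite -[x](addrK 1) e sub0r !inE eqxx !orbT.
Qed.

Theorem theorem3p6 (D : nzRingType) (n : nat)
  (G Mx : 'M[D]_n -> Prop) :
  is_division_ring D -> noncommutative D ->
  card_at_least (@center D) 5 ->
  (2 <= n)%N ->
  is_subgroup G -> subnormal_in G (@GL D n) ->
  maximal_in Mx G -> solvable_grp Mx ->
  abelian_grp Mx.
Proof.
case: n G Mx => [|[|n]] // G Mx dD ncD c5 _.
have [t [ct t0 t1]] := exists_central_scalar dD c5.
apply: (@abelian_of_solvable_maximal D n _ t) => //.
by move=> x nx; have [y [xy yx]] := dD x nx; apply/unitrP; exists y.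
Qed.
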